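(* For each $n\in\{1,\dots,N\}$ there exists a pair $(\overline f^n_*,\overline{\mathbf g}^n_* )\in\mathcal P^n$ such that $$\sum_{n=1}^N\overline f^n_*=f_*,\qquad \sum_{n=1}^N\overline g^n_{l,*}\le d_l,\quad l\in\{1,\dots,L\},$$ where $f_*$ is the optimal objective value of the problem in the context; i.e. the optimality is achievable within the Cartesian product $\otimes_{n=1}^N\mathcal P^n$. Furthermore, for any $(\overline f^n,\overline{\mathbf g}^n)\in\mathcal P^n$, $n\in\{1,\dots,N\}$, satisfying $\sum_{n=1}^N\overline g^n_l\le d_l$ for all $l\in\{1,\dots,L\}$, one has $\sum_{n=1}^N\overline f^n\ge f_*$.
   Context: **Model.** Time is slotted, $t\in\{0,1,2,\dots\}$. There are $N$ renewal systems. The timeline of system $n$ is divided into back-to-back renewal frames; $t_k^n$ is the slot of the $k$-th renewal, $t^n_0=0$, $T_k^n=t_{k+1}^n-t_k^n$ is a (random) positive integer, and $\mathcal T_k^n=\{t_k^n,\dots,t_{k+1}^n-1\}$. At time $t_k^n$ system $n$ chooses a (possibly random, possibly based on the past of all systems) action $\alpha_k^n\in\mathcal A^n$, which determines the distributions of the frame length $T_k^n$, of the performance vectors $\mathbf z^n[t]=(z_1^n[t],\dots,z_L^n[t])$ and of the penalties $y^n[t]$, $t\in\mathcal T_k^n$. Renewal property: given $\alpha_k^n=\alpha^n$, the variables $T_k^n$, $\mathbf z^n[t]$, $y^n[t]$ ($t\in\mathcal T^n_k$) are independent of the information of all systems from the slots before $t_k^n$, with conditional expectations $\widehat T^n(\alpha^n)=\mathbb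 E[T_k^n|\alpha_k^n=\alpha^n]$, $\widehat y^n(\alpha^n)=\mathbb E[\sum_{t\in\mathcal T_k^n}y^n[t]\,|\,\alpha_k^n=\alpha^n]$, $\widehat{\mathbf z}^n(\alpha^n)=\mathbb E[\sum_{t\in\mathcal T_k^n}\mathbf z^n[t]\,|\,\alpha_k^n=\alpha^n]$ not depending on $k$. There is an external process $\{\mathbf d[t]\}_{t\ge0}\subseteq\mathbb R^L$, i.i.d. over slots, with $d_l=\mathbb E[d_l[t]]$. **Problem.** Minimize $\limsup_{T\to\infty}\frac1T\sum_{t=0}^{T-1}\sum_{n=1}^N\mathbb E[y^n[t]]$ subject to $\limsup_{T\to\infty}\frac1T\sum_{t=0}^{T-1}\sum_{n=1}^N\mathbb E[z_l^n[t]]\le d_l$ for $l=1,\dots,L$. $f_*$ denotes the infimum objective value over all decision sequences satisfying the constraints. **Standing assumptions.** (1) The problem is feasible. (2) There are constants $y_{\max},z_{\max},d_{\max}$ with $|y^n[t]|\le y_{\max}$, $|z_l^n[t]|\le z_{\max}$, $|d_l[t]|\le d_{\max}$ for all $n,t,l$; and there is a constant $B\ge1$ such that for all $n$, $k$, every $\alpha^n\in\mathcal A^n$ and every $s\in\mathbb N$ with $\Pr(T_k^n\ge s|\alpha_k^n=\alpha^n)>0$, $\mathbb E[(T_k^n-s)^2\,|\,\alpha_k^n=\alpha^n,T_k^n\ge s]\le B$. (3) With $\widehat f^n(\alpha^n)=\widehat y^n(\alpha^n)/\widehat T^n(\alpha^n)$ and $\widehat{\mathbf g}^n(\alpha^n)=\widehat{\mathbf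 z}^n(\alpha^n)/\widehat T^n(\alpha^n)$, the set $\{(\widehat f^n(\alpha^n),\widehat{\mathbf g}^n(\alpha^n)):\alpha^n\in\mathcal A^n\}$ is compact for each $n$. **Performance region.** $\mathcal S^n\subseteq\mathbb R^{L+2}$ is the convex hull of $\{(\widehat y^n(\alpha^n),\widehat{\mathbf z}^n(\alpha^n),\widehat T^n(\alpha^n)):\alpha^n\in\mathcal A^n\}$ and $\mathcal P^n=\{(y/T,\mathbf z/T):(y,\mathbf z,T)\in\mathcal S^n\}\subseteq\mathbb R^{L+1}$. *)

(* Defs.v *)
From HB Require Import structures.
From mathcomp Require Import all_boot all_order all_algebra.
From mathcomp Require Import all_classical all_reals all_analysis.

Set Implicit Arguments.
Unset Strict Implicit.
Unset Printing Implicit Defensive.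

Import Order.TTheory GRing.Theory Num.Theory.
Import numFieldNormedType.Exports.

Local Open Scope classical_set_scope.
Local Open Scope ring_scope.

(** Renewal systems.

    An action determines the joint law of the length of a frame and of the
    penalties and performance vectors during that frame.  This law is carried
    by an auxiliary space [sample]: [frame_law a] is the law of a sample when
    action [a] is taken, and a sample [x] describes a frame of length
    [frame_length x] whose [i]-th slot ([0 <= i < frame_length x]) has penalty
    [frame_penalty x i] and performance vector [frame_perf x i]; the values for
    [i >= frame_length x] are never used.  Only the law of these variables
    matters, not [sample] itself. *)
Structure renewal_system (R : realType) (L : nat) := RenewalSystem {
  action_display : measure_display ;
  action : measurableType action_display ;
  sample_display : measure_display ;
  sample : measurableType sample_display ;
  frame_law : R.-pker action ~> sample ;
  frame_length : sample -> nat ;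
  frame_penalty : sample -> nat -> R ;
  frame_perf : sample -> nat -> L.-tuple R ;
  frame_length_gt0 : forall x, (0 < frame_length x)%N ;
  measurable_frame_length : measurable_fun setT frame_length ;
  measurable_frame_penalty :
    forall i, measurable_fun setT (fun x => frame_penalty x i) ;
  measurable_frame_perf :
    forall i, measurable_fun setT (fun x => frame_perf x i) }.

Section one_system.
Variables (R : realType) (L : nat) (S : renewal_system R L).

Definition That (a : action S) : R :=
  \int[frame_law S a]_x ((frame_length x)%:R : R).

Definition yhat (a : action S) : R :=
  \int[frame_law S a]_x (\sum_(i < frame_length x) frame_penalty x i).

Definition zhat (a : action S) : 'rV[R]_L :=
  \row_l \int[frame_law S a]_x
           (\sum_(i < frame_length x) tnth (frame_perf x i) l).

Definition fhat (a : action S) : R := yhat a / That a.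

Definition ghat (a : action S) : 'rV[R]_L := (That a)^-1 *: zhat a.

Definition ratio_set : set (R * 'rV[R]_L) :=
  [set v | exists a : action S, v = (fhat a, ghat a)].

(* The region called S^n : the convex hull of the triples (yhat, zhat, That). *)
Definition frame_region : set (R * 'rV[R]_L * R) :=
  [set v | exists (m : nat) (p : 'I_m -> R) (a : 'I_m -> action S),
     [/\ forall i, 0 <= p i, \sum_i p i = 1 &
         v = (\sum_i p i * yhat (a i), \sum_i p i *: zhat (a i),
              \sum_i p i * That (a i))]].

Definition performance_region : set (R * 'rV[R]_L) :=
  [set v | exists y z T, frame_region (y, z, T) /\ v = (y / T, T^-1 *: z)].

Definition frame_event (m : nat) (B : nat -> set R) (C : nat -> set (L.-tuple R))
    : set (sample S) :=
  [set x | frame_length x = m /\ forall i, (i < m)%N ->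
             B i (frame_penalty x i) /\ C i (frame_perf x i)].

End one_system.

(* Conditional expectation of f given the event E; meaningful if mu E > 0. *)
Definition cond_expectation (R : realType) d (T : measurableType d)
    (mu : {measure set T -> \bar R}) (f : T -> R) (E : set T) : \bar R :=
  ((\int[mu]_(x in E) (f x)%:E) * ((fine (mu E))^-1)%:E)%E.

Definition residual_bound (R : realType) (L : nat) (S : renewal_system R L)
    (B : R) : Prop :=
  forall (a : action S) (s : nat),
    (0 < frame_law S a [set x | (s <= frame_length x)%N])%E ->
    (cond_expectation (frame_law S a)
       (fun x => (((frame_length x)%:R - s%:R) ^+ 2)%R)
       [set x | (s <= frame_length x)%N] <= B%:E)%E.

(* The mean d_l of the external process, whose slots have law [ext]. *)
Definition ext_mean (R : realType) (L : nat)
    (ext : probability (L.-tuple R) R) (l : 'I_L) : R :=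
  \int[ext]_v (tnth v l).

Definition renewal_time (Omega : Type) (N : nat)
    (len : 'I_N -> nat -> Omega -> nat) (n : 'I_N) (k : nat) (w : Omega) : nat :=
  (\sum_(j < k) len n j w)%N.

Section information.
Variables (R : realType) (N L : nat) (sys : 'I_N -> renewal_system R L).
Variables (Omega : Type).
Variable len : 'I_N -> nat -> Omega -> nat.
Variable act : forall n : 'I_N, nat -> Omega -> action (sys n).
Variable y : 'I_N -> nat -> Omega -> R.
Variable z : 'I_N -> nat -> Omega -> L.-tuple R.
Variable d : nat -> Omega -> L.-tuple R.

Local Notation t_ := (renewal_time len).

(* The information of all systems from the slots before t.  It contains the
   renewals at slot t itself, since they are determined by the lengths of the
   frames that ended with slot t - 1. *)
Definition past (t : nat) : set_system Omega :=
  <<s [set E | (exists n k s, (s <= t)%N /\ E = [set w | t_ n k w = s])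
            \/ (exists n k s (A : set (action (sys n))),
                 [/\ (s < t)%N, measurable A &
                     E = [set w | t_ n k w = s /\ A (act n k w)]])
            \/ (exists n s (B : set R),
                 [/\ (s < t)%N, measurable B & E = y n s @^-1` B])
            \/ (exists n s (C : set (L.-tuple R)),
                 [/\ (s < t)%N, measurable C & E = z n s @^-1` C])
            \/ (exists s (D : set (L.-tuple R)),
                 [/\ (s < t)%N, measurable D & E = d s @^-1` D]) ] >>.

(* [past t] together with what a decision at slot t must not foresee: the whole
   of the frames begun before t (their lengths, and their variables at slots
   u >= t that are still inside them) and the future of the external process. *)
Definition past_and_underway (t : nat) : set_system Omega :=
  <<s past t `|`
      [set E | (exists n k s m, (s < t)%N /\
                 E = [set w | t_ n k w = s /\ len n k w = m])
            \/ (exists n k s u (B : set R),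
                 [/\ (s < t)%N, measurable B &
                     E = [set w | [/\ t_ n k w = s, (u < s + len n k w)%N
                                    & B (y n u w)]]])
            \/ (exists n k s u (C : set (L.-tuple R)),
                 [/\ (s < t)%N, measurable C &
                     E = [set w | [/\ t_ n k w = s, (u < s + len n k w)%N
                                    & C (z n u w)]]])
            \/ (exists u (D : set (L.-tuple R)),
                 measurable D /\ E = d u @^-1` D) ] >>.

End information.

(** A decision sequence, together with the processes that result from it.

    The probability space is part of the data, so that decisions may use any
    randomization.  [ds_d_iid] says that the external process is i.i.d. with
    law [ext] (finite-dimensional distributions on rectangles).  [ds_renewal]
    says that, given the action taken at the renewal t_k^n, the frame that
    starts there has the law prescribed by this action and is independent of
    the information from the slots before t_k^n (the events [frame_event] form
    a pi-system that determines the law of a frame).  [ds_nonanticipating] says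
    that the actions taken at slot t are drawn with a probability h that is a
    function of the past: given the past, they are independent of the remainder
    of the frames underway and of the future of the external process. *)
Record decision_sequence (R : realType) (N L : nat)
    (sys : 'I_N -> renewal_system R L) (ext : probability (L.-tuple R) R) :=
  DecisionSequence {
  ds_display : measure_display ;
  ds_space : measurableType ds_display ;
  ds_prob : probability ds_space R ;
  ds_len : 'I_N -> nat -> ds_space -> nat ;
  ds_act : forall n : 'I_N, nat -> ds_space -> action (sys n) ;
  ds_y : 'I_N -> nat -> ds_space -> R ;
  ds_z : 'I_N -> nat -> ds_space -> L.-tuple R ;
  ds_d : nat -> ds_space -> L.-tuple R ;
  ds_len_gt0 : forall n k w, (0 < ds_len n k w)%N ;
  ds_measurable_len : forall n k, measurable_fun setT (ds_len n k) ;
  ds_measurable_act : forall n k, measurable_fun setT (@ds_act n k) ;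
  ds_measurable_y : forall n t, measurable_fun setT (ds_y n t) ;
  ds_measurable_z : forall n t, measurable_fun setT (ds_z n t) ;
  ds_measurable_d : forall t, measurable_fun setT (ds_d t) ;
  ds_d_iid : forall (m : nat) (D : nat -> set (L.-tuple R)),
    (forall t, measurable (D t)) ->
    ds_prob [set w | forall t, (t < m)%N -> D t (ds_d t w)] =
    (\prod_(t < m) ext (D t))%E ;
  ds_renewal : forall (n : 'I_N) (k t : nat) (H : set ds_space)
      (A : set (action (sys n))) (m : nat)
      (B : nat -> set R) (C : nat -> set (L.-tuple R)),
    past ds_len ds_act ds_y ds_z ds_d t H -> measurable A ->
    (forall i, measurable (B i)) -> (forall i, measurable (C i)) ->
    let E := H `&` [set w | renewal_time ds_len n k w = t /\
                            A (ds_act n k w)] in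
    ds_prob (E `&` [set w | ds_len n k w = m /\ forall i, (i < m)%N ->
                      B i (ds_y n (t + i) w) /\ C i (ds_z n (t + i) w)]) =
    (\int[ds_prob]_(w in E)
       frame_law (sys n) (ds_act n k w) (frame_event m B C))%E ;
  ds_nonanticipating : forall (t : nat) (A : forall n, set (action (sys n))),
    (forall n, measurable (A n)) ->
    exists h : ds_space -> R,
      [/\ forall w, 0 <= h w <= 1,
          forall Y : set R, measurable Y ->
            past ds_len ds_act ds_y ds_z ds_d t (h @^-1` Y) &
          forall H, past_and_underway ds_len ds_act ds_y ds_z ds_d t H ->
            ds_prob (H `&` [set w | forall n k,
                       renewal_time ds_len n k w = t -> A n (ds_act n k w)]) =
            (\int[ds_prob]_(w in H) (h w)%:E)%E] }.

Arguments ds_len {R N L sys ext} _ _ _ _.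
Arguments ds_act {R N L sys ext} _ _ _ _.
Arguments ds_y {R N L sys ext} _ _ _ _.
Arguments ds_z {R N L sys ext} _ _ _ _.
Arguments ds_d {R N L sys ext} _ _ _.

Section problem.
Variables (R : realType) (N L : nat) (sys : 'I_N -> renewal_system R L).
Variable ext : probability (L.-tuple R) R.

Definition objective (pi : decision_sequence sys ext) : \bar R :=
  limn_esup (fun T : nat => ((T%:R^-1)%R%:E *
    \sum_(t < T) \sum_(n < N) 'E_(ds_prob pi)[ds_y pi n t])%E).

Definition constraint_value (pi : decision_sequence sys ext) (l : 'I_L)
    : \bar R :=
  limn_esup (fun T : nat => ((T%:R^-1)%R%:E *
    \sum_(t < T) \sum_(n < N)
       'E_(ds_prob pi)[(fun w => tnth (ds_z pi n t w) l)])%E).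

Definition feasible (pi : decision_sequence sys ext) : Prop :=
  forall l, (constraint_value pi l <= (ext_mean ext l)%:E)%E.

Definition f_star : \bar R :=
  ereal_inf [set v | exists pi, feasible pi /\ v = objective pi].

End problem.

(* Main.v *)
(** Let occ_T be the measure that counts, by action, the expected number of frames
    that system n begins before slot T.  By the renewal property the integral of
    yhat against occ_T is the expected sum of the penalties before T, up to the
    part beyond T of the frame underway at T; the residual bound makes this error
    at most ymax * B, and the same holds for zhat and That.  Hence the averages of
    y^n and z^n over T slots lie within O(1/T) of the mean of (fhat, ghat) with
    weight That against occ_T, and this mean is approximated by convex combinations
    of points of the compact set ratio_set.

    So every feasible policy has a limit point in the product of the compact convex
    hulls which satisfies the constraints and whose objective is at most that of
    the policy.  A minimizer among the points of this product that satisfy the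
    constraints therefore bounds f_* from below; it lies in the product of the
    performance regions because a convex combination of ratios is a ratio of
    convex combinations.

    Conversely, a point of P^n is (y / T, z / T) for a finite mixture of actions.
    Drawing an action from this mixture independently at each renewal makes occ_T
    proportional to the mixture, so that the averages converge to the point.  This
    policy lives on a countable product of probability spaces. *)

(* The actions form a bare measurable space without a topology; only the set of values of
   [(fhat, ghat)] is compact. This is why finite partitions occur: finitely many balls of radius 1/T
   cover the values, and sorting the actions by these balls turns the weighted mean into a finite
   convex combination at a further cost O(1/T). Compactness of the hulls in turn rests on
   Caratheodory: with a fixed number of points a hull is a continuous image of a compact product.

   A cluster point is taken of the whole N-tuple at a common horizon T. One point then serves the
   objective and all constraints, although their upper limits may be reached along different
   subsequences.

   For the converse the product is indexed by slots and not by frame numbers. What happened before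
   slot t, the frames underway included, is then a function of the coordinates of earlier slots and
   of the external process, although the number of frames begun by then is random and differs
   between systems. A new draw is one coordinate that this past does not involve. Both [ds_renewal]
   and [ds_nonanticipating] come down to this independence, which is proved by resampling a single
   coordinate. *)
From HB Require Import structures.
Require Import Defs.
From mathcomp Require Import all_boot all_order all_algebra.
From mathcomp Require Import all_classical all_reals all_analysis.
From mathcomp Require Import measurable_realfun giry ring lra.

Set Implicit Arguments.
Unset Strict Implicit.
Unset Printing Implicit Defensive.

Import Order.TTheory GRing.Theory Num.Theory.
Import numFieldNormedType.Exports.

Local Open Scope classical_set_scope.
Local Open Scope ring_scope.

(** * Countable products of probability spaces *)

Section countable_product.
Local Open Scope ereal_scope.
Context (R : realType) (I : countType) (d : I -> measure_display).
Variables (T : forall i, measurableType (d i)) (P : forall i, probability (T i) R).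

Definition coordinate_events : set_system (forall i, T i) :=
  [set C | exists i (A : set (T i)), measurable A /\ C = [set x | A (x i)]].

Definition product_space : Type := forall i, T i.
HB.instance Definition _ := Pointed.on product_space.

Definition Omega : measurableType _ := @g_sigma_algebraType product_space coordinate_events.

Implicit Types (f g : Omega -> \bar R) (x : Omega) (k m n : nat) (i : I).

Lemma measurable_coordinate i : measurable_fun [set: Omega] (fun x : Omega => x i).
Proof.
by move=> _ A mA; rewrite setTI; apply: sub_sigma_algebra; exists i, A.
Qed.

Lemma measurable_to_product d' (S : measurableType d') (f : S -> Omega) :
  (forall i, measurable_fun setT (fun s => f s i)) -> measurable_fun setT f.
Proof.
move=> mf; apply: (@measurability _ _ _ _ _ f coordinate_events) => // _ [_ [i [A [mA ->]]] <-].
exact: mf.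
Qed.

Lemma measurable_dfwith i :
  measurable_fun setT (fun p : Omega * T i => (eqtype.dfwith p.1 p.2 : Omega)).
Proof.
apply: measurable_to_product => j; case: (eqVneq i j) => [<-|ij].
  rewrite (_ : (fun _ => _) = snd) //; apply/funext => p /=.
  exact: dfwith_in.
rewrite (_ : (fun _ => _) = (fun x : Omega => x j) \o fst); last first.
  by apply/funext => p /=; apply: dfwith_out.
exact: measurableT_comp (measurable_coordinate (i:=j)) measurable_fst.
Qed.

Lemma measurable_dfwith_section i x : measurable_fun setT (fun y : T i => (eqtype.dfwith x y : Omega)).
Proof.
apply: (measurableT_comp (measurable_dfwith (i:=i)) (g := fun y => (x, y))).
exact: measurable_pair1.
Qed.

(** * Iterated integrals over finitely many coordinates *)

Definition integrate_coordinate i f : Omega -> \bar R :=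
  fun x => \int[P i]_y f (eqtype.dfwith x y).

(** Coordinates are enumerated by [pickle]; a number that codes none is skipped, so that the steps
    may run through all natural numbers. *)
Definition integrate_step k f : Omega -> \bar R :=
  if pickle_inv k is Some i then integrate_coordinate i f else f.

Fixpoint integrate_steps k m f : Omega -> \bar R :=
  if m is m'.+1 then integrate_step k (integrate_steps k.+1 m' f) else f.

Lemma integrate_step_ge0 k f : (forall x, 0 <= f x) -> forall x, 0 <= integrate_step k f x.
Proof.
by move=> f0 x; rewrite /integrate_step; case: pickle_inv => // i; apply: integral_ge0.
Qed.

Lemma measurable_integrate_step k f : (forall x, 0 <= f x) -> measurable_fun setT f ->
  measurable_fun setT (integrate_step k f).
Proof.
move=> f0 mf; rewrite /integrate_step; case: pickle_inv => // i.
have mg : measurable_fun setT (fun p : Omega * T i => f (eqtype.dfwith p.1 p.2)).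
  exact: measurableT_comp mf (measurable_dfwith (i:=i)).
exact: (measurable_fun_fubini_tonelli_F (m2 := P i) _ mg (fun p => f0 _)).
Qed.

Lemma measurable_section f i x : measurable_fun setT f ->
  measurable_fun setT (fun y : T i => f (eqtype.dfwith x y)).
Proof. by move=> mf; apply: (measurableT_comp mf (measurable_dfwith_section x)). Qed.

Lemma integrate_stepD k f g : (forall x, 0 <= f x) -> measurable_fun setT f ->
  (forall x, 0 <= g x) -> measurable_fun setT g ->
  integrate_step k (f \+ g) = integrate_step k f \+ integrate_step k g.
Proof.
move=> f0 mf g0 mg; rewrite /integrate_step; case: pickle_inv => // i.
apply/funext => x; rewrite /integrate_coordinate ge0_integralD //;
  exact: measurable_section.
Qed.

Lemma integrate_step_le k f g : (forall x, 0 <= f x) -> measurable_fun setT f ->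
  measurable_fun setT g -> (forall x, f x <= g x) ->
  forall x, integrate_step k f x <= integrate_step k g x.
Proof.
move=> f0 mf mg fg x; rewrite /integrate_step; case: pickle_inv => // i.
by apply: ge0_le_integral => //; apply: measurable_section.
Qed.

(** The target [V] is left open so that this covers functions as well as sets, which are functions
    to [Prop]. *)
Definition depends_before n (V : Type) (f : Omega -> V) :=
  forall x y : Omega, (forall i, (pickle i < n)%N -> x i = y i) -> f x = f y.

Lemma depends_beforeW m n V (f : Omega -> V) : (m <= n)%N -> depends_before m f -> depends_before n f.
Proof. by move=> mn df x y xy; apply: df => i im; apply: xy; apply: leq_trans mn. Qed.

Lemma pickle_inv_Some k (i : I) : pickle_inv k = Some i -> pickle i = k.
Proof. by move=> E; move: (@pickle_invK I k); rewrite E. Qed.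

Lemma integrate_step_id k f : depends_before k f -> integrate_step k f = f.
Proof.
move=> df; rewrite /integrate_step; case E: pickle_inv => [i|//].
apply/funext => x; rewrite /integrate_coordinate.
under eq_integral => y _.
  rewrite (df _ x); last first.
    move=> j jk; apply: dfwith_out; apply: contraTneq jk => <-.
    by rewrite (pickle_inv_Some E) ltnn.
  over.
rewrite integral_cst// -[RHS]mule1; congr (_ * _); exact: probability_setT.
Qed.

Lemma integrate_steps_ge0 k m f : (forall x, 0 <= f x) -> forall x, 0 <= integrate_steps k m f x.
Proof. by elim: m k => //= m IH k f0; apply: integrate_step_ge0; apply: IH. Qed.

Lemma measurable_integrate_steps k m f : (forall x, 0 <= f x) -> measurable_fun setT f ->
  measurable_fun setT (integrate_steps k m f).
Proof.
elim: m k => //= m IH k f0 mf; apply: measurable_integrate_step; last exact: IH.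
exact: integrate_steps_ge0.
Qed.

Lemma integrate_stepsD k m f g : (forall x, 0 <= f x) -> measurable_fun setT f ->
  (forall x, 0 <= g x) -> measurable_fun setT g ->
  integrate_steps k m (f \+ g) = integrate_steps k m f \+ integrate_steps k m g.
Proof.
move=> f0 mf g0 mg; elim: m k => //= m IH k; rewrite IH integrate_stepD //.
all: by [apply: integrate_steps_ge0|apply: measurable_integrate_steps].
Qed.

Lemma integrate_steps_le k m f g : (forall x, 0 <= f x) -> measurable_fun setT f ->
  measurable_fun setT g -> (forall x, f x <= g x) ->
  forall x, integrate_steps k m f x <= integrate_steps k m g x.
Proof.
move=> f0 mf mg fg; have g0 x : 0 <= g x by apply: le_trans (fg x).
elim: m k => //= m IH k; apply: integrate_step_le => //.
- exact: integrate_steps_ge0.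
- exact: measurable_integrate_steps.
- exact: measurable_integrate_steps.
Qed.

Lemma integrate_stepsSr k m f : integrate_steps k m.+1 f = integrate_steps k m (integrate_step (k + m) f).
Proof.
elim: m k => [|m IH] k; first by rewrite addn0.
by rewrite /= -/(integrate_steps k.+1 m.+1 f) IH addSnnS.
Qed.

Lemma integrate_steps_stable n k m f : depends_before n f -> (n <= k + m)%N ->
  integrate_steps k m.+1 f = integrate_steps k m f.
Proof.
move=> df nkm; rewrite integrate_stepsSr integrate_step_id//.
exact: depends_beforeW df.
Qed.

(** For a cylinder the iterated integral of the indicator over enough coordinates is constant, hence
    the evaluation at [point]. Any sufficient number of steps will do, as [pcontentE] shows; the
    default 0 concerns only sets that are not cylinders. *)
Definition pcontent (A : set Omega) : \bar R :=
  integrate_steps 0 (xget 0%N [set n | depends_before n A])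
    (fun x => (\1_A x)%:E) (point : Omega).

Lemma depends_before_indic n (A : set Omega) : depends_before n A ->
  depends_before n (fun x => (\1_A x)%:E : \bar R).
Proof.
move=> dA x y xy; rewrite !indicE; congr ((nat_of_bool _)%:R%:E).
by apply/idP/idP; rewrite !inE (dA _ _ xy).
Qed.

Lemma integrate_steps_indep n m f : depends_before n f -> (n <= m)%N ->
  integrate_steps 0 m f = integrate_steps 0 n f.
Proof.
move=> df; elim: m => [|m IH]; first by rewrite leqn0 => /eqP ->.
rewrite leq_eqVlt => /orP[/eqP -> //|]; rewrite ltnS => nm.
by rewrite (integrate_steps_stable df)// IH.
Qed.

Lemma pcontentE n (A : set Omega) : depends_before n A ->
  pcontent A = integrate_steps 0 n (fun x => (\1_A x)%:E) (point : Omega).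
Proof.
move=> dA; rewrite /pcontent; set m := xget _ _.
have dm : depends_before m A by apply: (xgetPex 0%N (P := [set n | depends_before n A])); exists n.
have dA' := depends_before_indic dA; have dm' := depends_before_indic dm.
have [nm|/ltnW mn] := leqP n m; first by rewrite (integrate_steps_indep dA').
by rewrite (integrate_steps_indep dm' mn).
Qed.

Definition cylinder : set (set Omega) :=
  [set A | measurable A /\ exists n, depends_before n A].

Lemma cylinder0 : cylinder set0.
Proof. by split => //; exists 0%N. Qed.

Lemma cylinderC A : cylinder A -> cylinder (~` A).
Proof.
move=> [mA [n dA]]; split; first exact: measurableC.
by exists n => x y xy; rewrite /setC /mkset (dA x y xy).
Qed.

Lemma cylinderU A B : cylinder A -> cylinder B -> cylinder (A `|` B).
Proof.
move=> [mA [n dA]] [mB [m dB]]; split; first exact: measurableU.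
exists (maxn n m) => x y xy; rewrite /setU /mkset.
by rewrite (depends_beforeW (leq_maxl n m) dA xy) (depends_beforeW (leq_maxr n m) dB xy).
Qed.

(** A second name for the same type: [Omega] carries the full sigma-algebra, this copy only the
    algebra of cylinders from which the measure is extended. *)
Definition cylinder_space : Type := product_space.
HB.instance Definition _ := Pointed.on cylinder_space.
HB.instance Definition _ := @isAlgebraOfSets.Build default_measure_display
  cylinder_space cylinder cylinder0 cylinderU cylinderC.

Lemma measurable_indicE (A : set Omega) : measurable A ->
  measurable_fun setT (fun x => (\1_A x)%:E : \bar R).
Proof. by move=> mA; apply/measurable_EFinP; exact: measurable_indic. Qed.

Lemma indicE_ge0 (A : set Omega) x : 0 <= (\1_A x)%:E :> \bar R.
Proof. by rewrite lee_fin. Qed.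

Definition cylinder_content (A : set cylinder_space) : \bar R := pcontent A.

Lemma cylinder_content_ge0 A : 0 <= cylinder_content A.
Proof. by apply: integrate_steps_ge0 => x; exact: indicE_ge0. Qed.

Lemma cylinder_content0 : cylinder_content set0 = 0.
Proof. by rewrite /cylinder_content (@pcontentE 0) //= indicE in_set0. Qed.

Lemma cylinder_contentT : cylinder_content setT = 1.
Proof. by rewrite /cylinder_content (@pcontentE 0) //= indicE in_setT. Qed.

Lemma cylinder_content_additive2 : additive2 cylinder_content.
Proof.
rewrite /cylinder_content.
move=> A B [mA [n dA]] [mB [m dB]] AB0.
have dA' := depends_beforeW (leq_maxl n m) dA.
have dB' := depends_beforeW (leq_maxr n m) dB.
have dAB : depends_before (maxn n m) ((A : set Omega) `|` B).
  by move=> x y xy; rewrite /setU /mkset (dA' x y xy) (dB' x y xy).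
rewrite (pcontentE dA') (pcontentE dB') (pcontentE dAB).
have iD := integrate_stepsD 0 (maxn n m) (indicE_ge0 A) (measurable_indicE mA)
  (indicE_ge0 B) (measurable_indicE mB).
rewrite -[RHS]/((integrate_steps _ _ _ \+ integrate_steps _ _ _) _) -iD.
congr (integrate_steps _ _ _ _); apply/funext => x.
rewrite -EFinD; congr (_%:E); rewrite !indicE in_setU.
have [xA|] := boolP (x \in A); have [xB|] := boolP (x \in B); rewrite ?addr0 ?add0r//.
have : (A `&` B) x by split; exact: set_mem.
by rewrite AB0.
Qed.

HB.instance Definition _ := isContent.Build _ cylinder_space R cylinder_content
  cylinder_content_ge0 ((additive2P cylinder_content0).2 cylinder_content_additive2).

(* By dominated convergence the sections [y |-> f j (x[i := y])] cannot all tend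
   to 0, since their integrals stay above [e]. *)
Lemma choose_coordinate k (f : nat -> Omega -> \bar R) x (e : R) : (0 < e)%R ->
  (forall j, measurable_fun setT (f j)) ->
  (forall j y, 0 <= f j y <= 1) ->
  (forall j y, f j.+1 y <= f j y) ->
  (forall j, e%:E <= integrate_step k (f j) x) ->
  exists x' : Omega, (forall i, (pickle i < k)%N -> x' i = x i) /\
    exists2 e' : R, (0 < e')%R & forall j, e'%:E <= f j x'.
Proof.
move=> e0 mf f01 fdec; rewrite /integrate_step; case E: pickle_inv => [i|]; last first.
  by move=> h; exists x; split => //; exists e.
move=> h; apply: contrapT => nex.
have f_cvg (y : T i) : f ^~ (eqtype.dfwith x y : Omega) @ \oo --> (0 : \bar R).
  set x' := (X in f ^~ X).
  have ninc : nonincreasing_seq (f ^~ x').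
    by apply/nonincreasing_seqP => j; exact: fdec.
  have cf := ereal_nonincreasing_cvgn ninc.
  rewrite (_ : 0 = ereal_inf (range (f ^~ x'))) //.
  apply/eqP; rewrite eq_le; apply/andP; split.
    by apply: le_ereal_inf_tmp => _ [j _ <-]; have /andP[] := f01 j x'.
  rewrite leNgt; apply/negP => inf0; apply: nex; exists x'; split.
    move=> l lk; apply: dfwith_out; apply: contraTneq lk => <-.
    by rewrite (pickle_inv_Some E) ltnn.
  have inf1 : ereal_inf (range (f ^~ x')) <= 1.
    apply: (@le_trans _ _ (f 0%N x')); first by apply: ereal_inf_lbound; exists 0%N.
    by have /andP[] := f01 0%N x'.
  have inffin : ereal_inf (range (f ^~ x')) \is a fin_num.
    by rewrite ge0_fin_numE ?(ltW inf0)//; apply: le_lt_trans inf1 _; rewrite ltry.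
  exists (fine (ereal_inf (range (f ^~ x')))); first by rewrite fine_gt0// inf0 ltey_eq inffin.
  by move=> j; rewrite fineK//; apply: ereal_inf_lbound; exists j.
have [] := @dominated_convergence _ (T i) R (P i) setT measurableT
  (fun j y => f j (eqtype.dfwith x y)) (cst 0) (cst 1).
- by move=> j; apply: measurable_section.
- exact: measurable_cst.
- by apply: aeW => y _; exact: f_cvg.
- exact: finite_measure_integrable_cst.
- by apply: aeW => y j _; rewrite gee0_abs; have /andP[] := f01 j (eqtype.dfwith x y).
move=> _ _; rewrite integral0 => cv.
have : e%:E <= 0.
  rewrite -(cvg_lim _ cv)//; apply: lime_ge; first by apply/cvg_ex; exists 0.
  by apply: nearW => j; exact: h.
by rewrite lee_fin leNgt e0.
Qed.

(** This is continuity at the empty set. A common point is built coordinate by coordinate: at stage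
    [k] the coordinates before [k] are fixed so that the integrals over the others stay above one
    positive number for all [j] at once, and [choose_coordinate] carries this to the next stage. *)
Lemma cylinder_compact (A : nat -> set cylinder_space) (e : R) : (0 < e)%R ->
  (forall j, measurable (A j)) -> (forall j, A j.+1 `<=` A j) ->
  (forall j, e%:E <= cylinder_content (A j)) -> \bigcap_j A j !=set0.
Proof.
move=> e0 mA decA eA.
have mA' j : measurable (A j : set Omega) by have [] := mA j.
have /choice[n dA] : forall j, exists n, depends_before n (A j : set Omega).
  by move=> j; have [_ []] := mA j => n; exists n.
pose f j x : \bar R := (\1_(A j : set Omega) x)%:E.
have df j : depends_before (n j) (f j) by exact: depends_before_indic.
have mf j : measurable_fun setT (f j) by exact: measurable_indicE.
have f0 j x : 0 <= f j x by exact: indicE_ge0.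
have fdec j x : f j.+1 x <= f j x.
  rewrite lee_fin !indicE ler_nat; case: (boolP (x \in A j.+1)) => // /set_mem/decA xA.
  by rewrite (mem_set xA).
(* In [h k j] the coordinates before [k] are still free. By truncated subtraction it is [f j] itself
   as soon as [k] reaches [n j]. *)
pose h k j := integrate_steps k (n j - k) (f j).
have hS k j : h k j = integrate_step k (h k.+1 j).
  rewrite /h; have [kn|nk] := ltnP k (n j); first by rewrite -subSS subSn.
  have -> : (n j - k = 0)%N by apply/eqP.
  have -> : (n j - k.+1 = 0)%N by apply/eqP; rewrite subn_eq0 leqW.
  by rewrite /= integrate_step_id//; apply: depends_beforeW (df j).
have hE k j m : (n j <= k + m)%N -> h k j = integrate_steps k m (f j).
  move=> njm; rewrite /h -(subnKC (_ : n j - k <= m)%N); last by rewrite leq_subLR.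
  elim: (m - _)%N => [|l IH]; first by rewrite addn0.
  by rewrite addnS (integrate_steps_stable (df j)) -?IH// -leq_subLR leq_addr.
have h01 k j x : 0 <= h k j x <= 1.
  apply/andP; split; first exact: integrate_steps_ge0.
  have f1 : forall x, f j x <= 1 by move=> y; rewrite lee_fin indicE lern1 leq_b1.
  have m1 : measurable_fun [set: Omega] (cst 1 : Omega -> \bar R) by exact: measurable_cst.
  apply: (le_trans (integrate_steps_le k (n j - k) (f0 j) (mf j) m1 f1 x)).
  suff -> : forall m k', integrate_steps k' m (cst 1) = cst 1 by [].
  by elim=> //= m IH k'; rewrite IH integrate_step_id.
have hdec k j x : h k j.+1 x <= h k j x.
  rewrite (hE _ _ (maxn (n j) (n j.+1))); last by rewrite (leq_trans (leq_maxr (n j) (n j.+1)))// leq_addl.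
  rewrite (hE _ _ (maxn (n j) (n j.+1))); last by rewrite (leq_trans (leq_maxl (n j) (n j.+1)))// leq_addl.
  exact: integrate_steps_le.
have mh k j : measurable_fun setT (h k j) by exact: measurable_integrate_steps.
pose good k x := exists2 e' : R, (0 < e')%R & forall j, e'%:E <= h k j x.
have good0 : good 0%N point.
  by exists e => // j; apply: le_trans (eA j) _; rewrite /cylinder_content (pcontentE (dA j)) (hE _ _ (n j)).
have goodS k x : good k x -> exists x' : Omega,
    (forall i, (pickle i < k)%N -> x' i = x i) /\ good k.+1 x'.
  move=> [e' e'0 he']; apply: (@choose_coordinate k (h k.+1) x e') => // j.
  by rewrite -hS.
have /choice[nx hnx] : forall p : nat * Omega, exists x' : Omega, good p.1 p.2 ->
    (forall i, (pickle i < p.1)%N -> x' i = p.2 i) /\ good p.1.+1 x'.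
  move=> [k x] /=; have [g|ng] := pselect (good k x); last by exists x.
  by have [x' hx'] := goodS k x g; exists x'.
pose xs := fix xs k : Omega := if k is k'.+1 then nx (k', xs k') else point.
have xs_good k : good k (xs k).
  by elim: k => // k IH; have [] := hnx (k, xs k) IH.
have xsE k m i : (pickle i < k)%N -> xs (k + m)%N i = xs k i.
  move=> ik; elim: m => [|m IH]; first by rewrite addn0.
  rewrite addnS -IH; have [ag _] := hnx ((k + m)%N, xs (k + m)%N) (xs_good _).
  by apply: ag; rewrite (leq_trans ik)// leq_addr.
(* Later stages keep the coordinates already fixed, so this diagonal point agrees with stage [k] on
   all coordinates before [k]. *)
pose x : Omega := fun i => xs (pickle i).+1 i.
have xE k i : (pickle i < k)%N -> x i = xs k i.
  by move=> ik; rewrite /x -(subnKC ik) xsE.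
exists x => j _; rewrite (dA j x (xs (n j)) (xE _)).
have [e' e'0 /(_ j)] := xs_good (n j).
(* At stage [n j] nothing is left to integrate, and an indicator that is at least [e'] equals 1. *)
rewrite (hE _ _ 0%N) ?addn0// /f /= indicE lee_fin.
by case: (boolP (_ \in _)) => [/set_mem//|_]; rewrite leNgt e'0.
Qed.

(** The sets [D n], what is left of [A] after [n] members of the cover, decrease to the empty set.
    By [cylinder_compact] their content falls below any [e], and finite subadditivity does the
    rest. *)
Lemma cylinder_content_sub : measurable_subset_sigma_subadditive cylinder_content.
Proof.
move=> A F mF mA AF; apply/lee_addgt0Pr => e e0.
pose D n := A `\` \big[setU/set0]_(l < n) F l.
have mD n : measurable (D n) by apply: measurableD => //; exact: bigsetU_measurable.
have [n Dn] : exists n, cylinder_content (D n) < e%:E.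
  apply: contrapT => /forallNP nD.
  have [||x capD] := cylinder_compact e0 mD.
  - move=> n x [Ax nx]; split => // Fx; apply: nx.
    by rewrite big_ord_recr; left.
  - by move=> n; rewrite leNgt; apply/negP/nD.
  have [k _ Fkx] := AF _ (capD 0%N Logic.I).1.
  have [_] := capD k.+1 Logic.I; apply; rewrite big_ord_recr; right; exact: Fkx.
have mU : measurable (\big[setU/set0]_(l < n) F l) by exact: bigsetU_measurable.
apply: (@le_trans _ _ (\sum_(l < n) cylinder_content (F l) + cylinder_content (D n))).
  have sub : A `<=` \big[setU/set0]_(l < n) F l `|` D n.
    by move=> x Ax; have [xU|xU] := pselect ((\big[setU/set0]_(l < n) F l) x); [left|right].
  apply: (@le_trans _ _ (cylinder_content (\big[setU/set0]_(l < n) F l `|` D n))).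
    by apply: le_measure => //; rewrite inE//; exact: measurableU.
  rewrite cylinder_content_additive2//; last first.
    by rewrite -subset0 => x [? []].
  by rewrite leeD2r// content_subadditive.
rewrite leeD ?(ltW Dn)//.
rewrite -(big_mkord xpredT (fun l => cylinder_content (F l))).
by apply: nneseries_lim_ge => *; exact: cylinder_content_ge0.
Qed.

HB.instance Definition _ := Content_SigmaSubAdditive_isMeasure.Build _ R cylinder_space
  cylinder_content cylinder_content_sub.

Definition product_measure (A : set Omega) : \bar R :=
  @measure_extension _ cylinder_space R cylinder_content A.

Lemma Omega_sub_cylinder (A : set Omega) : measurable A ->
  <<s (@measurable _ cylinder_space) >> A.
Proof.
apply: sub_smallest2r; first exact: smallest_sigma_algebra.
move=> _ [i [B [mB ->]]]; split.
  by rewrite -[X in measurable X]setTI; exact: measurable_coordinate.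
by exists (pickle i).+1 => x y xy; rewrite /mkset (xy i (ltnSn _)).
Qed.

Lemma product_measureE (A : set cylinder_space) : measurable A ->
  product_measure A = cylinder_content A.
Proof. exact: measurable_mu_extE. Qed.

Lemma product_measure0 : product_measure set0 = 0.
Proof. exact: measure0. Qed.

Lemma product_measure_ge0 (A : set Omega) : 0 <= product_measure A.
Proof. exact: measure_ge0. Qed.

Lemma product_measure_sigma_additive : semi_sigma_additive product_measure.
Proof.
move=> F mF tF mUF; apply: measure_semi_sigma_additive => //.
- by move=> k; exact: Omega_sub_cylinder.
- exact: Omega_sub_cylinder.
Qed.

HB.instance Definition _ := isMeasure.Build _ _ R product_measure
  product_measure0 product_measure_ge0 product_measure_sigma_additive.

Lemma product_measureT : product_measure setT = 1.
Proof. by rewrite product_measureE ?cylinder_contentT. Qed.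

HB.instance Definition _ := Measure_isProbability.Build _ _ R product_measure
  product_measureT.

(** * Boxes, and independence of a single coordinate *)

Definition box (B : forall i, set (T i)) : set Omega := [set x | forall i, B i (x i)].

Definition truncate k (B : forall i, set (T i)) i : set (T i) :=
  if (pickle i < k)%N then B i else setT.

Definition box_factor (B : forall i, set (T i)) k : \bar R :=
  if pickle_inv k is Some i then P i (B i) else 1.

Lemma measurable_box (B : forall i, set (T i)) :
  (forall i, measurable (B i)) -> measurable (box B).
Proof.
move=> mB; rewrite (_ : box B = \bigcap_k
    (if pickle_inv k is Some i then [set x : Omega | B i (x i)] else setT)).
  apply: bigcapT_measurable => k; case: pickle_inv => // i.
  by rewrite -[X in measurable X]setTI; exact: measurable_coordinate.
apply/seteqP; split => [x Bx k _|x Bx i]; first by case: pickle_inv.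
by have := Bx (pickle i) Logic.I; rewrite pickleK_inv.
Qed.

Lemma truncate_box n (B : forall i, set (T i)) :
  (forall i, (n <= pickle i)%N -> B i = setT) -> truncate n B = B.
Proof. by move=> Bn; apply/functional_extensionality_dep => i; rewrite /truncate; case: ltnP => // /Bn. Qed.

(** The indicator of a box splits into the condition on coordinate [k] and the conditions before it.
    The factor [c] collects the probabilities already integrated out, so that the statement
    iterates. *)
Lemma integrate_step_box k (B : forall i, set (T i)) (c : \bar R) :
  (forall i, measurable (B i)) -> 0 <= c ->
  integrate_step k (fun x => (\1_(box (truncate k.+1 B)) x)%:E * c) =
  fun x => (\1_(box (truncate k B)) x)%:E * (box_factor B k * c).
Proof.
move=> mB c0; rewrite /integrate_step /box_factor; case E: pickle_inv => [i|]; last first.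
  rewrite (_ : truncate k.+1 B = truncate k B); first by under [RHS]eq_fun do rewrite mul1e.
  apply/functional_extensionality_dep => i; rewrite /truncate ltnS leq_eqVlt.
  by case: eqP => // ik; move: E; rewrite -ik pickleK_inv.
have ik := pickle_inv_Some E.
apply/funext => x; rewrite /integrate_coordinate.
transitivity (\int[P i]_y ((\1_(B i) y)%:E * ((\1_(box (truncate k B)) x)%:E * c))).
  apply: eq_integral => y _; rewrite muleA; congr (_ * _); rewrite -EFinM; congr (_%:E).
  rewrite !indicE -natrM mulnb; congr (_%:R); congr nat_of_bool.
  apply/idP/andP; rewrite !inE.
    move=> b; split; first by have := b i; rewrite dfwith_in /truncate ik ltnSn.
    move=> j; have := b j; rewrite /truncate; case: (ltnP (pickle j) k) => // jk.
    rewrite (ltnW jk : (pickle j < k.+1)%N) dfwith_out//.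
    by apply: contraTneq jk => <-; rewrite ik ltnn.
  move=> [By b] j; case: (eqVneq i j) => [<-|ij].
    by rewrite dfwith_in /truncate ik ltnSn.
  rewrite dfwith_out//; have := b j; rewrite /truncate.
  rewrite [(pickle j < k.+1)%N]ltnS [(pickle j <= k)%N]leq_eqVlt.
  case: (eqVneq (pickle j) k) => //= jk; exfalso; move/eqP: ij; apply.
  by apply: (pcan_inj pickleK); rewrite ik jk.
rewrite (@ge0_integralZr _ (T i) R (P i) setT measurableT (fun y => (\1_(B i) y)%:E)).
- by rewrite integral_indic// setIT muleCA muleA.
- by apply/measurable_EFinP; exact: measurable_indic.
- by move=> y _; rewrite lee_fin.
- by rewrite mule_ge0// lee_fin.
Qed.

Lemma box_factor_ge0 (B : forall i, set (T i)) k : 0 <= box_factor B k.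
Proof. by rewrite /box_factor; case: pickle_inv. Qed.

Lemma integrate_steps_box k m (B : forall i, set (T i)) (c : \bar R) :
  (forall i, measurable (B i)) -> 0 <= c ->
  integrate_steps k m (fun x => (\1_(box (truncate (k + m)%N B)) x)%:E * c) =
  fun x => (\1_(box (truncate k B)) x)%:E * ((\prod_(j < m) box_factor B (k + j)%N) * c).
Proof.
move=> mB; elim: m c => [|m IH] c c0.
  by rewrite big_ord0 /= addn0; under [RHS]eq_fun do rewrite mul1e.
rewrite integrate_stepsSr addnS integrate_step_box// IH ?mule_ge0 ?box_factor_ge0//.
by apply/funext => x; rewrite big_ord_recr/= !muleA.
Qed.

Lemma product_measure_box n (B : forall i, set (T i)) :
  (forall i, measurable (B i)) -> (forall i, (n <= pickle i)%N -> B i = setT) ->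
  product_measure (box B) = \prod_(k < n) box_factor B k.
Proof.
move=> mB Bn.
have dB : depends_before n (box B).
  move=> x y xy; apply/propext; split => h i; have [/xy xyi|/Bn -> //] := ltnP (pickle i) n.
    by rewrite -xyi.
  by rewrite xyi.
rewrite product_measureE; last by split; [exact: measurable_box|exists n].
rewrite /cylinder_content (pcontentE dB).
have := integrate_steps_box 0 n mB (@lee01 R).
under eq_fun do rewrite mule1.
rewrite add0n (truncate_box Bn) => ->.
by rewrite indicE mem_set// mul1e mule1.
Qed.

(** Boxes constrained in finitely many coordinates are closed under intersection and have explicit
    measures, so two measures can be compared on them. *)
Lemma measurable_product_box : measurable = <<s [set A | exists (B : forall i, set (T i)) n,
  [/\ forall i, measurable (B i), forall i, (n <= pickle i)%N -> B i = setT & A = box B] ] >> :> set (set Omega).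
Proof.
apply/seteqP; split; last first.
  apply: smallest_sub; first exact: sigma_algebra_measurable.
  by move=> _ [B [n [mB _ ->]]]; exact: measurable_box.
apply: sub_smallest2r; first exact: smallest_sigma_algebra.
move=> _ [i [A [mA ->]]].
exists (@eqtype.dfwith _ (fun j => set (T j)) (fun j => setT) i A), (pickle i).+1; split.
- by move=> j; case: (eqVneq i j) => [<-|ij]; rewrite ?dfwith_in ?dfwith_out.
- move=> j ij; rewrite dfwith_out//; apply: contraTneq ij => <-.
  by rewrite ltnn.
- apply/seteqP; split => [x Ax j|x /(_ i)]; last by rewrite dfwith_in.
  by case: (eqVneq i j) => [<-|ij]; rewrite ?dfwith_in ?dfwith_out.
Qed.

(** Replacing one coordinate by an independent fresh draw preserves the law, because on boxes both
    sides are the same product. This gives independence of a coordinate without splitting the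
    dependent product into two factors. *)
Lemma product_measure_resample i (A : set Omega) : measurable A ->
  product_measure A = (product_measure \x P i) ((fun p => eqtype.dfwith p.1 p.2) @^-1` A).
Proof.
pose mf := measurable_dfwith (i:=i).
pose Q : {measure set Omega -> \bar R} :=
  measure_function_pushforward__canonical__measure_function_Measure
    (product_measure \x P i) mf.
have pre (B : forall j, set (T j)) :
    (fun p : Omega * T i => eqtype.dfwith p.1 p.2 : Omega) @^-1` (box B) =
    box (@eqtype.dfwith _ (fun j => set (T j)) B i setT) `*` B i.
  apply/seteqP; split => [[x y] /= b|[x y] [/= b By] j].
    split; last by have /= := b i; rewrite dfwith_in.
    move=> j; have := b j.
    by case: (eqVneq i j) => [<-|ij]; rewrite ?dfwith_in ?dfwith_out.
  by have := b j; case: (eqVneq i j) => [<-|ij]; rewrite ?dfwith_in ?dfwith_out.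
move=> mA; rewrite -[RHS]/(Q A).
pose G := [set A | exists (B : forall i, set (T i)) n,
  [/\ forall i, measurable (B i), forall i, (n <= pickle i)%N -> B i = setT & A = box B] ]
  : set (set Omega).
have GT : G setT by exists (fun i => setT), 0%N; split => //; apply/seteqP; split.
apply: (g_sigma_algebra_measure_unique G _ (fun=> setT)) => //.
- by move=> _ [B [n [mB _ ->]]]; exact: measurable_box.
- by apply/seteqP; split => // x _; exists 0%N.
- move=> _ _ [B [n [mB Bn ->]]] [C [m [mC Cm ->]]].
  exists (fun i => B i `&` C i), (maxn n m); split.
  + by move=> j; exact: measurableI.
  + by move=> j; rewrite geq_max => /andP[/Bn -> /Cm ->]; rewrite setIT.
  + by apply/seteqP; split => [x [b c] j|x b]; [split; [exact: b|exact: c]|split => j; have [] := b j].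
- move=> _ [B [n0 [mB Bn0 ->]]].
  pose n := maxn n0 (pickle i).+1.
  have Bn j : (n <= pickle j)%N -> B j = setT.
    by move=> nj; apply: Bn0; apply: leq_trans nj; exact: leq_maxl.
  have ni : (pickle i < n)%N by exact: leq_maxr.
  pose B' := @eqtype.dfwith _ (fun j => set (T j)) B i setT.
  have mB' j : measurable (B' j).
    by rewrite /B'; case: (eqVneq i j) => [<-|ij]; rewrite ?dfwith_in ?dfwith_out.
  rewrite -[RHS]/((product_measure \x P i) (_ @^-1` _)) pre product_measure1E//; last first.
    exact: measurable_box.
  have B'n j : (n <= pickle j)%N -> B' j = setT.
    by move=> nj; rewrite /B'; case: (eqVneq i j) => [<-|ij]; rewrite ?dfwith_in ?dfwith_out// Bn.
  rewrite [LHS](product_measure_box mB Bn) [X in _ = X * _](product_measure_box mB' B'n).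
  rewrite (bigD1 (Ordinal ni))//= [in RHS](bigD1 (Ordinal ni))//=.
  rewrite {1 3}/box_factor pickleK_inv /B' dfwith_in (probability_setT (P i)) mul1e muleC.
  congr (_ * _); apply: eq_bigr => -[j jn]; rewrite -val_eqE /= => ji.
  rewrite /box_factor; case E: pickle_inv => [l|//].
  rewrite dfwith_out//; apply: contra_neq ji => il.
  by rewrite il (pickle_inv_Some E).
- by move=> _; rewrite [X in X < _]product_measureT ltry.
- by rewrite -measurable_product_box.
Qed.

(** Invariance under [dfwith] says that [H] ignores coordinate [i]. After resampling, [H] constrains
    only the old point and [G] only the fresh draw, so the event is a rectangle. *)
Lemma product_measure_indep i (H : set Omega) (G : set (T i)) :
  measurable H -> (forall x (y : T i), H (eqtype.dfwith x y) <-> H x) -> measurable G ->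
  product_measure (H `&` [set x | G (x i)]) = product_measure H * P i G.
Proof.
move=> mH dH mG; rewrite (@product_measure_resample i); last first.
  apply: measurableI => //; rewrite -[X in measurable X]setTI; exact: measurable_coordinate.
rewrite -product_measure1E//; congr (_ _).
by apply/seteqP; split => [[x y]|[x y]] [/= /dH Hx]; rewrite dfwith_in.
Qed.

End countable_product.

(** * Renewal accounting *)

Section pushforward_as_measure.
Context d d' (T1 : measurableType d) (T2 : measurableType d') (R : realType).

Definition pushforward_measure (m : {measure set T1 -> \bar R}) (f : T1 -> T2)
    (mf : measurable_fun setT f) : {measure set T2 -> \bar R} :=
  measure_function_pushforward__canonical__measure_function_Measure m mf.

Lemma ge0_integral_pushforward_measure m f (mf : measurable_fun setT f) (h : T2 -> \bar R) :
  measurable_fun setT h -> (forall y, (0 <= h y)%E) ->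
  (\int[pushforward_measure m mf]_y h y = \int[m]_x h (f x))%E.
Proof. by move=> mh h0; apply: ge0_integral_pushforward. Qed.

End pushforward_as_measure.

Section measure_to_subprobability.
Context d (T : measurableType d) (R : realType) (m : {measure set T -> \bar R}).
Hypothesis mT : (m setT <= 1)%E.

(** A copy of [m] that carries its mass bound, so that it becomes a point of the Giry monad and
    [giry_bind] can integrate families of such measures. *)
Definition as_subprobability : set T -> \bar R := m.
HB.instance Definition _ := isMeasure.Build _ _ R as_subprobability
  (measure0 m) (measure_ge0 m) (@measure_semi_sigma_additive _ _ _ m).
HB.instance Definition _ := Measure_isSubProbability.Build _ _ R as_subprobability mT.

Definition giry_of_measure : giry T R := as_subprobability.

End measure_to_subprobability.

Section mixture.
Local Open Scope ereal_scope.
Context d1 d2 d3 (Om : measurableType d1) (A : measurableType d2) (S : measurableType d3)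
  (R : realType) (P : probability Om R) (kappa : R.-pker A ~> S)
  (act : Om -> A) (mact : measurable_fun setT act) (E : set Om) (mE : measurable E).

(** Outside [E] this is the zero measure, so that the mixture has mass [P E]: laws on disjoint
    events can be added without conditioning. *)
Definition restricted_kernel (w : Om) : {measure set S -> \bar R} :=
  if w \in E then kappa (act w) else mzero.

Lemma restricted_kernelT w : restricted_kernel w setT <= 1.
Proof.
rewrite /restricted_kernel; case: ifP => _ /=; last by rewrite /mzero lee_fin ler01.
by rewrite (prob_kernel (s := kappa)).
Qed.

Definition restricted_giry (w : Om) : giry S R :=
  giry_of_measure (restricted_kernelT w).

Lemma measurable_restricted_giry : measurable_fun setT restricted_giry.
Proof.
apply: measurable_giry_codensity => // B mB.
rewrite [X in measurable_fun _ X](_ : _ = fun w => if w \in E then kappa (act w) B else 0).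
  apply: measurable_fun_ifT => //.
    apply: (measurable_fun_bool true).
    rewrite (_ : _ `&` _ = E)//; apply/seteqP; split => w /=.
      by move=> [_ /set_mem].
    by move=> /mem_set.
  exact: measurableT_comp (measurable_kernel kappa _ mB) mact.
by apply/funext => w; rewrite /restricted_giry /= /restricted_kernel; case: ifP.
Qed.

Definition mixture : {measure set S -> \bar R} :=
  giry_bind (P : giry Om R) measurable_restricted_giry.

Lemma ge0_integral_mixture (h : S -> \bar R) : measurable_fun setT h -> (forall x, 0 <= h x) ->
  \int[mixture]_x h x = \int[P]_(w in E) \int[kappa (act w)]_x h x.
Proof.
move=> mh h0.
rewrite -[LHS]/(giry_int (giry_bind (P : giry Om R) measurable_restricted_giry) h).
rewrite giry_int_bind// /giry_int [RHS]integral_mkcond.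
apply: eq_integral => w _; rewrite patchE.
rewrite -[LHS]/(\int[restricted_kernel w]_x h x) /restricted_kernel.
by case: ifP => //; rewrite integral_measure_zero.
Qed.

Lemma mixtureE F : measurable F -> mixture F = \int[P]_(w in E) kappa (act w) F.
Proof.
move=> mF; have := @ge0_integral_mixture (fun x => (\1_F x)%:E).
rewrite integral_indic// setIT => ->.
- by apply: eq_integral => w _; rewrite integral_indic// setIT.
- by apply/measurable_EFinP; exact: measurable_indic.
- by move=> x; rewrite lee_fin.
Qed.

End mixture.

Section renewal_accounting.
Local Open Scope ereal_scope.
Context d1 d2 d3 (Om : measurableType d1) (A : measurableType d2) (S : measurableType d3)
  (R : realType) (P : probability Om R) (kappa : R.-pker A ~> S)
  (flen : S -> nat) (mflen : measurable_fun setT flen)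
  (len : nat -> Om -> nat) (act : nat -> Om -> A).
Hypothesis len_gt0 : forall k w, (0 < len k w)%N.
Hypothesis mlen : forall k, measurable_fun setT (len k).
Hypothesis mact : forall k, measurable_fun setT (act k).

Definition renewal k w := (\sum_(j < k) len j w)%N.
Definition renewal_at k t : set Om := [set w | renewal k w = t].

Lemma renewalS k w : renewal k.+1 w = (renewal k w + len k w)%N.
Proof. by rewrite /renewal big_ord_recr. Qed.

Lemma measurable_len_event k (Q : set nat) : measurable (len k @^-1` Q).
Proof. by rewrite -[X in measurable X]setTI; exact: mlen. Qed.

Lemma measurable_renewal k : measurable_fun setT (renewal k).
Proof.
elim: k => [|k IH].
  rewrite (_ : renewal 0 = cst 0%N); first exact: measurable_cst.
  by apply/funext => w; rewrite /renewal big_ord0.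
rewrite (_ : renewal k.+1 = (fun w => renewal k w + len k w)%N).
  exact: measurable_fun_addn.
by apply/funext => w; rewrite renewalS.
Qed.

Lemma measurable_renewal_at k t : measurable (renewal_at k t).
Proof.
have := @measurable_renewal k measurableT [set t] Logic.I.
by rewrite setTI.
Qed.

Lemma leq_renewal k w : (k <= renewal k w)%N.
Proof.
elim: k => // k IH; rewrite renewalS -addn1; exact: leq_add.
Qed.

(** The sum telescopes: its first [n] terms add up to the truth value of [u < renewal n w], and [T]
    frames of positive length reach past [u]. *)
Lemma sum_renewal_window (T u : nat) (w : Om) : (u < T)%N ->
  (\sum_(k < T) ((renewal k w <= u) && (u < renewal k.+1 w)))%N = 1%N.
Proof.
move=> uT.
suff E : forall n, (\sum_(k < n) ((renewal k w <= u) && (u < renewal k.+1 w)) = (u < renewal n w))%N.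
  by rewrite E (leq_trans uT)// leq_renewal.
elim=> [|n IH]; first by rewrite big_ord0 /renewal big_ord0.
rewrite big_ord_recr /= IH; have := renewalS n w; move: (len n w) => l ->.
case: (leqP (renewal n w) u) => /= h; first by rewrite add0n.
by rewrite addn0 (leq_trans h)// leq_addr.
Qed.

Definition underway k t i : set Om := renewal_at k t `&` [set w | (i < len k w)%N].

Lemma measurable_underway k t i : measurable (underway k t i).
Proof.
apply: measurableI; first exact: measurable_renewal_at.
exact: (measurable_len_event k [set m | (i < m)%N]).
Qed.

Lemma sum_underway (T u : nat) (w : Om) : (u < T)%N ->
  (\sum_(t < T | t <= u) \sum_(k < T) (w \in underway k t (u - t)))%N = 1%N.
Proof.
move=> uT; rewrite exchange_big /= -(sum_renewal_window w uT); apply: eq_bigr => k _.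
have inE' t : (w \in underway k t (u - t)) = (renewal k w == t) && (u - t < len k w)%N.
  by apply/idP/andP; rewrite inE /underway /renewal_at /= => -[/eqP].
under eq_bigr do rewrite inE'.
case: (leqP (renewal k w) u) => h /=; last first.
  rewrite big1// => t tu; case: eqP => // rt; move: h.
  by rewrite rt ltnNge tu.
rewrite (bigD1 (Ordinal (leq_ltn_trans h uT)))//= eqxx /= big1 ?addn0.
  by rewrite renewalS -ltn_subLR// subSn// ltnS.
move=> t /andP[_]; rewrite -val_eqE /= => tk; case: eqP => // rt.
by rewrite rt eqxx in tk.
Qed.

(** An expectation at slot [u] is split by the index [k] and the first slot [t] of the frame that
    contains [u]. Both are below [T], so the sums are finite. *)
Lemma integral_underway (v : Om -> R) (T u : nat) : (u < T)%N ->
  measurable_fun setT v -> (forall w, 0 <= v w)%R ->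
  \int[P]_w (v w)%:E =
  \sum_(t < T | (t <= u)%N) \sum_(k < T) \int[P]_(w in underway k t (u - t)) (v w)%:E.
Proof.
move=> uT mv v0.
have mvE k t : measurable_fun setT ((EFin \o v) \_ (underway k t (u - t))).
  apply/(measurable_restrictT _ _).1; first exact: measurable_underway.
  by apply/measurable_EFinP; exact: measurable_funTS.
have v0E k t w : 0 <= ((EFin \o v) \_ (underway k t (u - t))) w.
  by apply: erestrict_ge0 => x _; rewrite lee_fin.
under eq_bigr do under eq_bigr do rewrite integral_mkcond.
under eq_bigr do rewrite -ge0_integral_sum//.
rewrite -[RHS]big_filter -ge0_integral_sum//; last 2 first.
- by move=> t; exact: emeasurable_sum.
- by move=> t w _; exact: sume_ge0.
apply: eq_integral => w _; rewrite big_filter.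
under eq_bigr do under eq_bigr do rewrite patchE /=.
transitivity (\sum_(t < T | (t <= u)%N) \sum_(k < T)
   (v w * (w \in underway k t (u - t))%:R)%:E).
  under eq_bigr do rewrite sumEFin -mulr_sumr -natr_sum.
  by rewrite sumEFin -mulr_sumr -natr_sum sum_underway// mulr1.
by apply: eq_bigr => t _; apply: eq_bigr => k _; case: ifP; rewrite ?mulr1 ?mulr0.
Qed.

(* The law of the [k]-th frame on the event that it begins at slot [t]. *)
Definition frame_mixture k t : {measure set S -> \bar R} :=
  mixture P kappa (mact k) (measurable_renewal_at k t).

Lemma measurable_flen_event (Q : set nat) : measurable (flen @^-1` Q).
Proof. by rewrite -[X in measurable X]setTI; apply: mflen. Qed.

Section process.
Variables (v : nat -> Om -> R) (pen : S -> nat -> R) (M B : R).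
Hypothesis mv : forall u, measurable_fun setT (v u).
Hypothesis v0 : forall u w, (0 <= v u w)%R.
Hypothesis mpen : forall i, measurable_fun setT (fun x => pen x i).
Hypothesis pen0 : forall x i, (0 <= pen x i)%R.
Hypothesis M0 : (0 <= M)%R.
Hypothesis penM : forall x i, (i < flen x)%N -> (pen x i <= M)%R.
Hypothesis B0 : (0 <= B)%R.
Hypothesis residualB : forall a s,
  \int[kappa a]_x ((flen x - s)%N%:R)%:E <= B%:E * kappa a [set x | (s <= flen x)%N].
Hypothesis law : forall k t i m (D : set R), (i < m)%N -> measurable D ->
  P (renewal_at k t `&` [set w | len k w = m /\ D (v (t + i)%N w)]) =
  \int[P]_(w in renewal_at k t) kappa (act k w) [set x | flen x = m /\ D (pen x i)].

(** The hypothesis [law] concerns frames of an exact length [m]; adding up over all [m > i] yields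
    the frames still running at their slot [i]. *)
Lemma law_underway k t i (D : set R) : measurable D ->
  P (underway k t i `&` [set w | D (v (t + i)%N w)]) =
  frame_mixture k t [set x | (i < flen x)%N /\ D (pen x i)].
Proof.
move=> mD.
pose F m := if (i < m)%N then
  renewal_at k t `&` [set w | len k w = m /\ D (v (t + i)%N w)] else set0.
pose G m := if (i < m)%N then [set x | flen x = m /\ D (pen x i)] else set0.
have mF m : measurable (F m).
  rewrite /F; case: ifP => // _; apply: measurableI; first exact: measurable_renewal_at.
  apply: measurableI; first exact: (measurable_len_event k [set m]).
  by rewrite -[X in measurable X]setTI; exact: mv.
have mG m : measurable (G m).
  rewrite /G; case: ifP => // _.
  apply: measurableI; first exact: (measurable_flen_event [set m]).
  by rewrite -[X in measurable X]setTI; exact: mpen.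
have -> : underway k t i `&` [set w | D (v (t + i)%N w)] = \bigcup_m F m.
  apply/seteqP; split => w.
    by move=> [[rt il] Dv]; exists (len k w) => //; rewrite /F il.
  by move=> [m _]; rewrite /F; case: ifP => // im [rt [lm Dv]]; split => //; split => //=; rewrite lm.
have -> : [set x | (i < flen x)%N /\ D (pen x i)] = \bigcup_m G m.
  apply/seteqP; split => x.
    by move=> [il Dv]; exists (flen x) => //; rewrite /G il.
  by move=> [m _]; rewrite /G; case: ifP => // im [lm Dv]; split => //=; rewrite lm.
rewrite measure_bigcup//; last first.
  apply/trivIsetP => m m' _ _ mm'; rewrite /F; case: ifP; case: ifP; rewrite ?setI0 ?set0I// => _ _.
  rewrite -subset0 => w [[_ [lm _]] [_ [lm' _]]].
  by move/eqP: mm'; apply; rewrite -lm -lm'.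
rewrite measure_bigcup//; last first.
  apply/trivIsetP => m m' _ _ mm'; rewrite /G; case: ifP; case: ifP; rewrite ?setI0 ?set0I// => _ _.
  rewrite -subset0 => w [[lm _] [lm' _]].
  by move/eqP: mm'; apply; rewrite -lm -lm'.
apply: eq_eseriesr => m _.
have := mG m; rewrite /F /G; case: ifP => [im mGm|_ _]; last by rewrite !measure0.
by rewrite [RHS]mixtureE//; exact: law.
Qed.

(** By [law_underway] the process and the sample have the same law on the two events. Both integrals
    are integrals of the identity on the nonnegative reals against the image measures. *)
Lemma integral_law k t i :
  \int[P]_(w in underway k t i) (v (t + i)%N w)%:E =
  \int[frame_mixture k t]_(x in [set x | (i < flen x)%N]) (pen x i)%:E.
Proof.
have mU := measurable_underway k t i.
have mL : measurable [set x | (i < flen x)%N] := measurable_flen_event [set n | (i < n)%N].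
(* The value -1 marks the samples outside the event. *)
pose v' w := (if w \in underway k t i then v (t + i)%N w else -1)%R.
pose pen' x := (if (i < flen x)%N then pen x i else -1)%R.
have mv' : measurable_fun setT v'.
  apply: measurable_fun_ifT => //; apply: (measurable_fun_bool true).
  rewrite (_ : _ `&` _ = underway k t i)//; apply/seteqP; split => w /=.
    by move=> [_ /set_mem].
  by move=> /mem_set.
have mpen' : measurable_fun setT pen'.
  apply: measurable_fun_ifT => //; apply: (measurable_fun_bool true).
  by rewrite (_ : _ `&` _ = [set x | (i < flen x)%N])//; apply/seteqP; split => w //= -[].
pose D : set R := [set` `[0%R, +oo[%R].
have mD : measurable D by exact: measurable_itv.
have v'D : v' @^-1` D = underway k t i.
  apply/seteqP; split => w; rewrite /D /v' /= in_itv /= andbT.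
    by case: ifP => [/set_mem//|_]; rewrite lerNr oppr0 ler10.
  by move=> wU; rewrite mem_set.
have pen'D : pen' @^-1` D = [set x | (i < flen x)%N].
  apply/seteqP; split => x; rewrite /D /pen' /= in_itv /= andbT.
    by case: ifP => // _; rewrite lerNr oppr0 ler10.
  by move=> ->.
transitivity (\int[pushforward_measure P mv']_(r in D) r%:E).
  rewrite [RHS]ge0_integral_pushforward//; last first.
    by move=> r; rewrite inE /D /= in_itv /= andbT lee_fin.
  rewrite v'D; apply: eq_integral => w wU.
  by rewrite /= /v' wU.
transitivity (\int[pushforward_measure (frame_mixture k t) mpen']_(r in D) r%:E); last first.
  rewrite [LHS]ge0_integral_pushforward//; last first.
    by move=> r; rewrite inE /D /= in_itv /= andbT lee_fin.
  rewrite pen'D; apply: eq_integral => x; rewrite inE /= => xU.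
  by rewrite /= /pen' xU.
apply: eq_measure_integral => C mC CD.
rewrite -[LHS]/(P (v' @^-1` C)) -[RHS]/(frame_mixture k t (pen' @^-1` C)).
have CN1 : ~ C (-1)%R.
  by move=> /CD; rewrite /D /= in_itv /= andbT lerNr oppr0 ler10.
have -> : v' @^-1` C = underway k t i `&` [set w | C (v (t + i)%N w)].
  apply/seteqP; split => w; rewrite /v' /=.
    by case: ifP => // /set_mem.
  by move=> [wU Cv]; rewrite mem_set.
have -> : pen' @^-1` C = [set x | (i < flen x)%N /\ C (pen x i)].
  apply/seteqP; split => x; rewrite /pen' /=.
    by case: ifP.
  by move=> [xU Cv]; rewrite xU.
exact: law_underway.
Qed.

Definition truncated_frame_sum s x : R :=
  (\sum_(i < s) (if (i < flen x)%N then pen x i else 0))%R.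

Definition frame_sum x : R := (\sum_(i < flen x) pen x i)%R.

Lemma measurable_truncated_frame_sum s : measurable_fun setT (truncated_frame_sum s).
Proof.
apply: measurable_sum => i; apply: measurable_fun_ifT => //.
apply: (measurable_fun_bool true).
rewrite (_ : _ `&` _ = [set x | (i < flen x)%N]); first exact: (measurable_flen_event [set n | (i < n)%N]).
by apply/seteqP; split => w //= -[].
Qed.

Lemma frame_sumE x : frame_sum x = truncated_frame_sum (flen x) x.
Proof. by apply: eq_bigr => i _; rewrite ltn_ord. Qed.

Lemma measurable_frame_sum : measurable_fun setT frame_sum.
Proof.
move=> _ Y mY; rewrite setTI (_ : _ @^-1` _ =
    \bigcup_n ([set x | flen x = n] `&` truncated_frame_sum n @^-1` Y)).
  apply: bigcupT_measurable => n; apply: measurableI.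
    exact: (measurable_flen_event [set n]).
  by rewrite -[X in measurable X]setTI; exact: measurable_truncated_frame_sum.
apply/seteqP; split => [x Yx|x [n _ [/= <-]]]; last by rewrite -frame_sumE.
by exists (flen x) => //; split => //=; rewrite -frame_sumE.
Qed.

Lemma frame_sum_bounds s x :
  (truncated_frame_sum s x <= frame_sum x <= truncated_frame_sum s x + M * (flen x - s)%N%:R)%R.
Proof.
have [sn|/ltnW ns] := leqP s (flen x).
  have -> : frame_sum x = (truncated_frame_sum s x + \sum_(s <= i < flen x) pen x i)%R.
    rewrite /frame_sum -(big_mkord xpredT (pen x)) (big_cat_nat (n := s))//=; congr (_ + _)%R.
    by rewrite big_mkord; apply: eq_bigr => i _; rewrite (leq_trans (ltn_ord i)).
  rewrite lerDl sumr_ge0//= lerD2l.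
  rewrite mulr_natr -sumr_const_nat; apply: ler_sum_nat => i /andP[_ ?].
  exact: penM.
have -> : truncated_frame_sum s x = frame_sum x.
  rewrite /truncated_frame_sum -(big_mkord xpredT (fun i => if (i < flen x)%N then pen x i else 0%R)).
  rewrite (big_cat_nat (n := flen x))//=.
  rewrite [X in (_ + X)%R = _]big_nat_cond [X in (_ + X)%R = _]big1 ?addr0.
    by rewrite big_mkord /frame_sum; apply: eq_bigr => i _; rewrite ltn_ord.
  by move=> i /andP[/andP[+ _] _]; rewrite leqNgt => /negbTE ->.
by rewrite lexx lerDl mulr_ge0.
Qed.

(** Of a frame begun at slot [t], exactly its first [T - t] slots can lie before [T]. Hence there is
    no error yet; it arises only when truncated sums are completed to whole frames. *)
Lemma sum_process T : \sum_(u < T) \int[P]_w (v u w)%:E =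
  \sum_(t < T) \sum_(k < T) \int[frame_mixture k t]_x (truncated_frame_sum (T - t) x)%:E.
Proof.
under eq_bigr => u _ do rewrite (integral_underway (ltn_ord u) (mv _) (v0 _)).
rewrite (exchange_big_dep xpredT)//=; apply: eq_bigr => t _.
rewrite exchange_big /=; apply: eq_bigr => k _.
transitivity (\sum_(i < T - t) \int[frame_mixture k t]_(x in [set x | (i < flen x)%N]) (pen x i)%:E).
  rewrite -(big_mkord xpredT (fun i => \int[frame_mixture k t]_(x in [set x | (i < flen x)%N]) (pen x i)%:E)).
  rewrite -(big_geq_mkord t T xpredT (fun u => \int[P]_(w in underway k t (u - t)) (v u w)%:E)).
  rewrite -{1}[nat_of_ord t]add0n big_addn; apply: eq_bigr => i _.
  by rewrite addnK -integral_law addnC.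
under [RHS]eq_integral do rewrite /truncated_frame_sum -sumEFin.
rewrite ge0_integral_sum//; last 2 first.
- move=> i; apply/measurable_EFinP; apply: measurable_fun_ifT => //.
  apply: (measurable_fun_bool true).
  rewrite (_ : _ `&` _ = [set x | (i < flen x)%N]); first exact: (measurable_flen_event [set n | (i < n)%N]).
  by apply/seteqP; split => w //= -[].
- by move=> i x _; case: ifP; rewrite lee_fin.
apply: eq_bigr => i _; rewrite integral_mkcond; apply: eq_integral => x _.
rewrite patchE; case: ifPn => [/set_mem/= -> //|].
by case: ifP => // xi /negP[]; rewrite inE.
Qed.

(* A frame that reaches beyond [T] contains slot [T - 1], and exactly one frame
   does. *)
Lemma overshoot_bound T : (0 < T)%N ->
  \sum_(t < T) \sum_(k < T) \int[frame_mixture k t]_x ((flen x - (T - t))%N%:R)%:E <= B%:E.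
Proof.
case: T => // T _.
have mres s : measurable_fun setT (fun x => ((flen x - s)%N%:R : R)%:E).
  apply/measurable_EFinP; apply: (@measurableT_comp _ _ _ _ _ _ (fun n : nat => ((n - s)%N%:R : R))) => //.
have key (t : 'I_T.+1) k : \int[frame_mixture k t]_x ((flen x - (T.+1 - t))%N%:R)%:E <=
    B%:E * \int[P]_(w in underway k t (T - t)) (1%R)%:E.
  rewrite ge0_integral_mixture//.
  have mL s : measurable [set x | (s <= flen x)%N] := measurable_flen_event [set n | (s <= n)%N].
  apply: (@le_trans _ _ (\int[P]_(w in renewal_at k t)
     (B%:E * kappa (act k w) [set x | (T.+1 - t <= flen x)%N]))).
    apply: ge0_le_integral => //.
    - exact: measurable_renewal_at.
    - by move=> w _; exact: integral_ge0.
    - apply: measurable_funTS.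
      apply: (@measurableT_comp _ _ _ _ _ _ (fun a => \int[kappa a]_x ((flen x - (T.+1 - t))%N%:R)%:E)) => //.
      apply: measurable_fun_integral_kernel => // U mU; exact: measurable_kernel.
    - apply: measurable_funTS; apply: measurable_funeM.
      exact: measurableT_comp (measurable_kernel kappa _ (mL _)) (mact k).
  rewrite ge0_integralZl//; last 2 first.
  - exact: measurable_renewal_at.
  - apply: measurable_funTS.
    exact: measurableT_comp (measurable_kernel kappa _ (mL _)) (mact k).
  rewrite lee_wpmul2l ?lee_fin//.
  rewrite integral_cst ?mul1e; last exact: measurable_underway.
  have E := law_underway k t (T - t) measurableT.
  rewrite setIT in E; rewrite [leRHS]E [leRHS]mixtureE; last first.
    rewrite (_ : [set x | _ /\ _] = [set x | (T - t < flen x)%N]).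
      exact: (measurable_flen_event [set n | (T - t < n)%N]).
    by apply/seteqP; split => x //= -[].
  rewrite subSn; last by rewrite -ltnS.
  rewrite (_ : [set x | (T - t < flen x)%N /\ _] = [set x | (T - t < flen x)%N])//.
  by apply/seteqP; split => x //= -[].
apply: (@le_trans _ _ (\sum_(t < T.+1) \sum_(k < T.+1)
    B%:E * \int[P]_(w in underway k t (T - t)) (1%R)%:E)).
  by apply: lee_sum => t _; apply: lee_sum => k _; exact: key.
have one0 (w : Om) : (0 <= (cst 1 : Om -> R) w)%R by [].
have E := integral_underway (ltnSn T) (measurable_cst (1 : R)%R) one0.
have P1 : \int[P]_w ((cst 1%R : Om -> R) w)%:E = 1.
  rewrite [LHS](_ : _ = \int[P]_w (cst 1 w))// integral_cst// mul1e.
  exact: probability_setT.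
rewrite P1 in E.
rewrite (eq_bigl xpredT) in E; last by move=> t; rewrite -ltnS ltn_ord.
under eq_bigr => t _.
  rewrite -ge0_sume_distrr; first over.
  by move=> k _; apply: integral_ge0.
rewrite -ge0_sume_distrr; first by rewrite -E mule1.
by move=> t _; apply: sume_ge0 => k _; apply: integral_ge0 => w _.
Qed.

Lemma process_accounting T : (0 < T)%N ->
  let V := \sum_(u < T) \int[P]_w (v u w)%:E in
  let J := \sum_(t < T) \sum_(k < T) \int[frame_mixture k t]_x (frame_sum x)%:E in
  V <= J <= V + (M * B)%:E.
Proof.
rewrite /= => T0; rewrite sum_process; apply/andP; split.
  apply: lee_sum => t _; apply: lee_sum => k _; apply: ge0_le_integral => //.
  - by move=> x _; rewrite lee_fin; apply: sumr_ge0 => i _; case: ifP.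
  - exact/measurable_EFinP/measurable_truncated_frame_sum.
  - exact/measurable_EFinP/measurable_frame_sum.
  - by move=> x _; rewrite lee_fin; have /andP[] := frame_sum_bounds (T - t) x.
apply: (@le_trans _ _ (\sum_(t < T) \sum_(k < T)
  (\int[frame_mixture k t]_x (truncated_frame_sum (T - t) x)%:E +
   M%:E * \int[frame_mixture k t]_x ((flen x - (T - t))%N%:R)%:E))).
  apply: lee_sum => t _; apply: lee_sum => k _.
  have mres : measurable_fun setT (fun x => ((flen x - (T - t))%N%:R : R)%:E).
    by apply/measurable_EFinP; apply: (@measurableT_comp _ _ _ _ _ _ (fun n : nat => ((n - (T - t))%N%:R : R))).
  rewrite -ge0_integralZl_EFin//.
  have t0 x : [set: S] x -> 0 <= (truncated_frame_sum (T - t) x)%:E.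
    by move=> _; rewrite lee_fin; apply: sumr_ge0 => i _; case: ifP.
  rewrite -ge0_integralD//; last 3 first.
  - exact/measurable_EFinP/measurable_truncated_frame_sum.
  - by move=> x _; rewrite mule_ge0 ?lee_fin.
  - exact: measurable_funeM.
  apply: ge0_le_integral => //.
  - by move=> x _; rewrite lee_fin; apply: sumr_ge0.
  - exact/measurable_EFinP/measurable_frame_sum.
  - apply: emeasurable_funD; last exact: measurable_funeM.
    exact/measurable_EFinP/measurable_truncated_frame_sum.
  - move=> x _; rewrite -EFinM -EFinD lee_fin.
    by have /andP[] := frame_sum_bounds (T - t) x.
under eq_bigr do rewrite big_split/=.
rewrite big_split/= leeD2l//.
apply: le_trans (_ : M%:E * \sum_(t < T) \sum_(k < T)
    \int[frame_mixture k t]_x ((flen x - (T - t))%N%:R)%:E <= _).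
  rewrite ge0_sume_distrr; last first.
    by move=> t _; apply: sume_ge0 => k _; apply: integral_ge0 => x _; rewrite lee_fin.
  apply: lee_sum => t _; rewrite ge0_sume_distrr//.
  by move=> k _; apply: integral_ge0 => x _; rewrite lee_fin.
by rewrite EFinM lee_wpmul2l ?lee_fin// overshoot_bound.
Qed.

End process.

(** With the identity kernel the mixture becomes the law of the [k]-th action itself, on the event
    that its frame begins at [t]. *)
Definition visits k t : {measure set A -> \bar R} :=
  mixture P (kdirac (@measurable_id _ A setT)) (mact k) (measurable_renewal_at k t).

Lemma ge0_integral_visits k t (h : A -> \bar R) : measurable_fun setT h ->
  (forall a, 0 <= h a) -> \int[visits k t]_a h a = \int[P]_(w in renewal_at k t) h (act k w).
Proof.
move=> mh h0; rewrite ge0_integral_mixture//; apply: eq_integral => w _.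
by rewrite /kdirac /= integral_dirac// diracT mul1e.
Qed.

(* The expected number of frames begun before slot [T], by action; the [k]-th
   frame begins at slot [k] at the earliest, hence the range of [k]. *)
Definition occupation T : {measure set A -> \bar R} :=
  msum (fun t => msum (fun k => visits k t) T) T.

Lemma ge0_integral_occupation T (h : A -> \bar R) : measurable_fun setT h ->
  (forall a, 0 <= h a) -> \int[occupation T]_a h a =
  \sum_(t < T) \sum_(k < T) \int[P]_(w in renewal_at k t) h (act k w).
Proof.
move=> mh h0; rewrite /occupation ge0_integral_measure_sum//; apply: eq_bigr => t _.
rewrite ge0_integral_measure_sum//; apply: eq_bigr => k _.
exact: ge0_integral_visits.
Qed.

Lemma ge0_integral_occupation_kernel T (h : S -> \bar R) : measurable_fun setT h ->
  (forall x, 0 <= h x) -> \int[occupation T]_a \int[kappa a]_x h x =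
  \sum_(t < T) \sum_(k < T) \int[frame_mixture k t]_x h x.
Proof.
move=> mh h0; rewrite ge0_integral_occupation.
- apply: eq_bigr => t _; apply: eq_bigr => k _.
  by rewrite ge0_integral_mixture.
- by apply: measurable_fun_integral_kernel => // U mU; exact: measurable_kernel.
- by move=> a; exact: integral_ge0.
Qed.

Section real_process.
Variables (v : nat -> Om -> R) (pen : S -> nat -> R) (M B : R).
Hypothesis mv : forall u, measurable_fun setT (v u).
Hypothesis mpen : forall i, measurable_fun setT (fun x => pen x i).
Hypothesis M0 : (0 <= M)%R.
Hypothesis penM : forall x i, (i < flen x)%N -> (`|pen x i| <= M)%R.
Hypothesis B0 : (0 <= B)%R.
Hypothesis residualB : forall a s,
  \int[kappa a]_x ((flen x - s)%N%:R)%:E <= B%:E * kappa a [set x | (s <= flen x)%N].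
Hypothesis law : forall k t i m (D : set R), (i < m)%N -> measurable D ->
  P (renewal_at k t `&` [set w | len k w = m /\ D (v (t + i)%N w)]) =
  \int[P]_(w in renewal_at k t) kappa (act k w) [set x | flen x = m /\ D (pen x i)].

Lemma comp_accounting (f : R -> R) (M' : R) T : (0 < T)%N -> measurable_fun setT f ->
  (forall r, 0 <= f r)%R -> (0 <= M')%R ->
  (forall x i, (i < flen x)%N -> (f (pen x i) <= M')%R) ->
  let V := \sum_(u < T) \int[P]_w (f (v u w))%:E in
  let J := \int[occupation T]_a \int[kappa a]_x (frame_sum (fun x i => f (pen x i)) x)%:E in
  V <= J <= V + (M' * B)%:E.
Proof.
move=> T0 mf f0 M'0 fM'.
have mfpen i : measurable_fun setT (fun x => f (pen x i)) by exact: measurableT_comp.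
have mfv u : measurable_fun setT (fun w => f (v u w)) by exact: measurableT_comp.
rewrite /= ge0_integral_occupation_kernel.
- apply: (@process_accounting (fun u w => f (v u w)) (fun x i => f (pen x i))) => //.
  move=> k t i m D im mD; apply: (law k t (D := f @^-1` D) im).
  by rewrite -[X in measurable X]setTI; apply: mf.
- exact/measurable_EFinP/measurable_frame_sum.
- by move=> x; rewrite lee_fin; apply: sumr_ge0.
Qed.

Lemma frame_sum_one x : frame_sum (fun _ _ => 1%R) x = (flen x)%:R.
Proof. by rewrite /frame_sum sumr_const card_ord. Qed.

(** The process constantly equal to 1 has sum [T] before slot [T], and its frame sums are the frame
    lengths. *)
Lemma length_accounting T : (0 < T)%N ->
  T%:R%:E <= \int[occupation T]_a \int[kappa a]_x (flen x)%:R%:E <= (T%:R + B)%:E.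
Proof.
move=> T0; have m1 : measurable_fun setT (cst 1%R : R -> R) by exact: measurable_cst.
have := @comp_accounting (cst 1%R) 1%R T T0 m1 (fun=> ler01) ler01 (fun _ _ _ => lexx _).
rewrite mul1r; have -> : \sum_(u < T) \int[P]_w (cst 1%R (v u w))%:E = T%:R%:E.
  have P1 u : \int[P]_w (cst 1%R (v u w) : R)%:E = 1.
    rewrite [LHS](_ : _ = \int[P]_w (cst 1 w))// integral_cst// mul1e.
    exact: probability_setT.
  under eq_bigr do rewrite P1.
  by rewrite sumEFin sumr_const card_ord.
rewrite EFinD; have -> // : \int[occupation T]_a \int[kappa a]_x
    (frame_sum (fun x i => cst 1%R (pen x i)) x)%:E =
  \int[occupation T]_a \int[kappa a]_x (flen x)%:R%:E.
by apply: eq_integral => a _; apply: eq_integral => x _; rewrite frame_sum_one.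
Qed.

Definition mean_frame_sum (q : S -> nat -> R) a : R := (\int[kappa a]_x frame_sum q x)%R.
Definition mean_length a : R := (\int[kappa a]_x (flen x)%:R)%R.

Lemma measurable_length : measurable_fun setT (fun x => (flen x)%:R : R).
Proof. by apply: (@measurableT_comp _ _ _ _ _ _ (fun n : nat => n%:R : R)). Qed.

Lemma integral_length_le a : \int[kappa a]_x (flen x)%:R%:E <= B%:E.
Proof.
have := residualB a 0; under eq_integral do rewrite subn0.
rewrite (_ : [set x | (0 <= flen x)%N] = setT); last exact/seteqP.
by rewrite (prob_kernel (s := kappa)) mule1.
Qed.

Lemma integrable_length a : (kappa a).-integrable setT (fun x => (flen x)%:R%:E).
Proof.
apply/integrableP; split; first exact/measurable_EFinP/measurable_length.
under eq_integral do rewrite gee0_abs ?lee_fin//.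
exact: le_lt_trans (integral_length_le a) (ltry _).
Qed.

Lemma mean_lengthE a : (mean_length a)%:E = \int[kappa a]_x (flen x)%:R%:E.
Proof. by rewrite fineK//; apply: integrable_fin_num => //; exact: integrable_length. Qed.

Lemma measurable_mean_length : measurable_fun setT mean_length.
Proof.
apply/measurable_EFinP; rewrite (_ : _ \o _ = fun a => \int[kappa a]_x (flen x)%:R%:E).
  apply: measurable_fun_integral_kernel => //.
  - by move=> U mU; exact: measurable_kernel.
  - exact/measurable_EFinP/measurable_length.
by apply/funext => a; rewrite -mean_lengthE.
Qed.

Lemma mean_length_ge0 a : (0 <= mean_length a)%R.
Proof. exact: Rintegral_ge0. Qed.

Lemma integrable_mean_length T : (0 < T)%N -> (occupation T).-integrable setT (EFin \o mean_length).
Proof.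
move=> T0; apply/integrableP; split; first exact/measurable_EFinP/measurable_mean_length.
under eq_integral do rewrite /= ger0_norm ?mean_length_ge0// mean_lengthE.
have /andP[_ h] := length_accounting T0.
exact: le_lt_trans h (ltry _).
Qed.

Lemma mean_length_accounting T : (0 < T)%N ->
  (T%:R <= \int[occupation T]_a mean_length a <= T%:R + B)%R.
Proof.
move=> T0; rewrite -!lee_fin fineK; last first.
  by apply: integrable_fin_num => //; exact: integrable_mean_length.
have := length_accounting T0.
by under eq_integral do rewrite -mean_lengthE.
Qed.

Lemma integrable_frame_sum (q : S -> nat -> R) a : (forall i, measurable_fun setT (fun x => q x i)) ->
  (forall x i, (i < flen x)%N -> (`|q x i| <= M)%R) ->
  (kappa a).-integrable setT (fun x => (frame_sum q x)%:E).
Proof.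
move=> mq qM; have iM : (kappa a).-integrable setT (fun x => M%:E * (flen x)%:R%:E).
  exact: (integrableZl measurableT _ (integrable_length a)).
apply: le_integrable iM => //; first exact/measurable_EFinP/measurable_frame_sum.
move=> x _; rewrite -EFinM lee_fin (ger0_norm (mulr_ge0 M0 _))//.
apply: (le_trans (ler_norm_sum _ _ _)).
rewrite -[X in (_ <= M * X%:R)%R]card_ord mulr_natr -sumr_const.
by apply: ler_sum => i _; exact: qM.
Qed.

Lemma mean_frame_sumE (q : S -> nat -> R) a : (forall i, measurable_fun setT (fun x => q x i)) ->
  (forall x i, (i < flen x)%N -> (`|q x i| <= M)%R) ->
  (mean_frame_sum q a)%:E = \int[kappa a]_x (frame_sum q x)%:E.
Proof.
by move=> mq qM; rewrite fineK//; apply: integrable_fin_num => //; exact: integrable_frame_sum.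
Qed.

Lemma norm_mean_frame_sum (q : S -> nat -> R) a : (forall i, measurable_fun setT (fun x => q x i)) ->
  (forall x i, (i < flen x)%N -> (`|q x i| <= M)%R) ->
  (`|mean_frame_sum q a| <= M * mean_length a)%R.
Proof.
move=> mq qM; have ip := integrable_frame_sum a mq qM.
apply: (le_trans (le_normr_Rintegral measurableT ip)).
rewrite -RintegralZl//; last exact: integrable_length.
apply: le_Rintegral => //.
- exact: integrable_abse ip.
- exact: (integrableZl measurableT _ (integrable_length a)).
- move=> x _; apply: (le_trans (ler_norm_sum _ _ _)).
  rewrite -[X in (_ <= M * X%:R)%R]card_ord mulr_natr -sumr_const.
  by apply: ler_sum => i _; exact: qM.
Qed.

Let pos (r : R) := Num.max r 0%R.

Let measurable_pos_comp d4 (X : measurableType d4) (f : X -> R) :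
  measurable_fun setT f -> measurable_fun setT (pos \o f).
Proof. by move=> mf; apply: measurable_maxr. Qed.

Let posB (r : R) : (r = pos r - pos (- r))%R.
Proof. by rewrite /pos; have [?|?] := leP r 0%R; have [?|?] := leP (- r)%R 0%R; lra. Qed.

Let pos_ge0 (r : R) : (0 <= pos r)%R.
Proof. by rewrite /pos le_max lexx orbT. Qed.

Let pos_norm (r : R) : (pos r <= `|r|)%R.
Proof. by rewrite /pos ge_max ler_norm normr_ge0. Qed.

(** Meant for [f] the positive or the negative part, since the accounting so far is for nonnegative
    processes. The estimate is kept one-sided: completing the last frame can only increase the
    sum. *)
Lemma signed_accounting (f : R -> R) T : (0 < T)%N -> measurable_fun setT f ->
  (forall r, 0 <= f r <= `|r|)%R ->
  let q x i := f (pen x i) in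
  exists X : R, [/\ \sum_(u < T) \int[P]_w (f (v u w))%:E = X%:E,
    (occupation T).-integrable setT (EFin \o mean_frame_sum q) &
    (X <= \int[occupation T]_a mean_frame_sum q a <= X + M * B)%R].
Proof.
move=> T0 mf f0 q.
have mq i : measurable_fun setT (fun x => q x i) by exact: measurableT_comp.
have qM x i : (i < flen x)%N -> (`|q x i| <= M)%R.
  move=> /penM pM; have /andP[f1 f2] := f0 (pen x i).
  by rewrite ger0_norm//; exact: le_trans f2 pM.
have fsE : EFin \o mean_frame_sum q = fun a => \int[kappa a]_x (frame_sum q x)%:E.
  by apply/funext => a; rewrite -mean_frame_sumE.
have iq : (occupation T).-integrable setT (EFin \o mean_frame_sum q).
  apply: (le_integrable measurableT _ _ (integrableZl measurableT M (integrable_mean_length T0))).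
    rewrite fsE; apply: measurable_fun_integral_kernel.
    - by move=> U mU; exact: measurable_kernel.
    - by move=> x; rewrite lee_fin; apply: sumr_ge0 => i _; have /andP[] := f0 (pen x i).
    - exact/measurable_EFinP/measurable_frame_sum.
  move=> a _; rewrite -EFinM lee_fin (ger0_norm (mulr_ge0 M0 (mean_length_ge0 a))).
  exact: norm_mean_frame_sum.
have f1 r : (0 <= f r)%R by have /andP[] := f0 r.
have f2 x i : (i < flen x)%N -> (f (pen x i) <= M)%R.
  by move=> /penM; apply: le_trans; have /andP[] := f0 (pen x i).
have JE : (\int[occupation T]_a mean_frame_sum q a)%R%:E =
    \int[occupation T]_a \int[kappa a]_x (frame_sum (fun x i => f (pen x i)) x)%:E.
  rewrite fineK; first by apply: eq_integral => a _; rewrite mean_frame_sumE.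
  by apply: integrable_fin_num => //; exact: iq.
have /= := comp_accounting T0 mf f1 M0 f2; rewrite -JE.
set V := (X in X <= _) => /andP[V1 V2].
have V0 : 0 <= V by apply: sume_ge0 => u _; apply: integral_ge0 => w _; rewrite lee_fin.
have Vfin : V \is a fin_num by rewrite ge0_fin_numE//; exact: le_lt_trans V1 (ltry _).
exists (fine V); split; rewrite ?fineK//.
by rewrite -!lee_fin EFinD fineK// V1 V2.
Qed.

Lemma real_accounting T : (0 < T)%N ->
  exists X : R, [/\ \sum_(u < T) \int[P]_w (v u w)%:E = X%:E,
    (occupation T).-integrable setT (EFin \o mean_frame_sum pen) &
    (`|X - \int[occupation T]_a mean_frame_sum pen a| <= M * B)%R].
Proof.
move=> T0.
pose neg (r : R) := pos (- r)%R.
have mpos : measurable_fun setT pos by exact: (measurable_pos_comp (@measurable_id _ _ _)).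
have mneg : measurable_fun setT neg.
  exact: (measurable_pos_comp (@oppr_measurable R setT)).
have neg_ge0 r : (0 <= neg r <= `|r|)%R by rewrite pos_ge0 -[in X in _ && X]normrN pos_norm.
have pos_ge0' r : (0 <= pos r <= `|r|)%R by rewrite pos_ge0 pos_norm.
have [Xp [EXp ip hp]] := signed_accounting T0 mpos pos_ge0'.
have [Xn [EXn inn hn]] := signed_accounting T0 mneg neg_ge0.
have mean_split : mean_frame_sum pen =
    (fun a => mean_frame_sum (fun x i => pos (pen x i)) a -
              mean_frame_sum (fun x i => neg (pen x i)) a)%R.
  apply/funext => a; rewrite /mean_frame_sum -RintegralB//; last 2 first.
  - apply: integrable_frame_sum => [i|x i /penM]; first exact: measurableT_comp.
    by apply: le_trans; rewrite ger0_norm ?pos_ge0 ?pos_norm.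
  - apply: integrable_frame_sum => [i|x i /penM]; first exact: measurableT_comp.
    by apply: le_trans; have /andP[n1 n2] := neg_ge0 (pen x i); rewrite ger0_norm.
  apply: eq_Rintegral => x _; rewrite /frame_sum -sumrB.
  by apply: eq_bigr => i _; exact: posB.
exists (Xp - Xn)%R; split.
- have fin (h : R -> R) X (u : 'I_T) : (forall r, 0 <= h r)%R ->
      \sum_(u < T) \int[P]_w (h (v u w))%:E = X%:E ->
      \int[P]_w (h (v u w))%:E = (fine (\int[P]_w (h (v u w))%:E))%:E.
    move=> h0 EX; rewrite fineK// ge0_fin_numE; last first.
      by apply: integral_ge0 => w _; rewrite lee_fin.
    apply: (@le_lt_trans _ _ X%:E); last exact: ltry.
    rewrite -EX (bigD1 u)//= leeDl//; apply: sume_ge0 => l _.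
    by apply: integral_ge0 => w _; rewrite lee_fin.
  have h2 r : (0 <= neg r)%R by have /andP[] := neg_ge0 r.
  have fp u := fin pos Xp u pos_ge0 EXp; have fn u := fin neg Xn u h2 EXn.
  move: EXp EXn; under eq_bigr => u _ do rewrite fp.
  rewrite sumEFin => -[EXp]; under eq_bigr => u _ do rewrite fn.
  rewrite sumEFin => -[EXn].
  rewrite -EXp -EXn -sumrB -sumEFin; apply: eq_bigr => u _.
  rewrite integralE EFinB -fp -fn; congr (_ - _); apply: eq_integral => w _.
    by rewrite funeposE /pos EFin_max.
  by rewrite funenegE /neg /pos EFin_max EFinN.
- rewrite mean_split; exact: (integrableB measurableT ip inn).
(* The errors of the two parts both lie between 0 and [M * B], so their difference is at most
   [M * B] in absolute value and no factor 2 arises. *)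
- rewrite mean_split RintegralB//; move: hp hn.
  set a := Rintegral _ _ _; set b := Rintegral _ _ _ => /andP[h1 h2] /andP[h3 h4].
  by rewrite ler_norml; apply/andP; split; lra.
Qed.

End real_process.
End renewal_accounting.

(** * Finite partitions of the actions *)

Section cells.
Context (R : realType) d (A : measurableType d) (mu : {measure set A -> \bar R}).
Variables (m : nat) (c : A -> 'I_m).
Hypothesis mc : forall i, measurable (c @^-1` [set i]).
Variable w : A -> R.
Hypotheses (w0 : forall x, 0 <= w x) (iw : mu.-integrable setT (EFin \o w)).

Let mw : measurable_fun setT w.
Proof. by case/integrableP: iw => /measurable_EFinP. Qed.

(** With [w] the mean frame length and [mu] the occupation measure, this is the expected total
    length of the frames whose action lies in cell [i]. *)
Definition cell_mass i : R := \int[mu]_x (w x * (c x == i)%:R).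

Lemma measurable_cell i : measurable_fun setT (fun x => (c x == i)%:R : R).
Proof.
rewrite (_ : (fun _ => _) = \1_(c @^-1` [set i])); first exact: measurable_indic.
apply/funext => x; rewrite indicE; congr ((nat_of_bool _)%:R).
by apply/eqP/idP; rewrite inE.
Qed.

Lemma integrable_cell i : mu.-integrable setT (EFin \o (fun x => w x * (c x == i)%:R)).
Proof.
apply: (le_integrable measurableT _ _ iw).
  by apply/measurable_EFinP; apply: measurable_funM => //; exact: measurable_cell.
move=> x _; rewrite lee_fin normrM ler_piMr//.
by rewrite normr_nat lern1 leq_b1.
Qed.

Lemma cell_mass_ge0 i : 0 <= cell_mass i.
Proof. by apply: Rintegral_ge0 => x _; rewrite mulr_ge0. Qed.

Lemma Rintegral_sum (I : Type) (s : seq I) (f : I -> A -> R) :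
  (forall i, mu.-integrable setT (EFin \o f i)) ->
  mu.-integrable setT (EFin \o (fun x => \sum_(i <- s) f i x)) /\
  \int[mu]_x (\sum_(i <- s) f i x) = \sum_(i <- s) \int[mu]_x f i x.
Proof.
move=> intf; elim: s => [|i s [IH1 IH2]].
  rewrite (_ : (fun x => _) = cst 0); last by apply/funext => x; rewrite big_nil.
  by split; [exact: integrable0|rewrite Rintegral_cst// mul0r big_nil].
rewrite (_ : (fun x => _) = fun x => f i x + \sum_(i <- s) f i x); last first.
  by apply/funext => x; rewrite big_cons.
split; last by rewrite RintegralD// IH2 big_cons.
exact: (integrableD measurableT (intf i) IH1).
Qed.

Lemma Rintegral_cells (b : 'I_m -> R) :
  mu.-integrable setT (EFin \o (fun x => b (c x) * w x)) /\
  \int[mu]_x (b (c x) * w x) = \sum_i b i * cell_mass i.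
Proof.
rewrite (_ : (fun x => b (c x) * w x) = fun x => \sum_i b i * (w x * (c x == i)%:R)).
  have intb i : mu.-integrable setT (EFin \o (fun x => b i * (w x * (c x == i)%:R))).
    exact: (integrableZl measurableT (b i) (integrable_cell i)).
  have [-> ->] := Rintegral_sum (index_enum _) intb; split => //.
  apply: eq_bigr => i _; rewrite RintegralZl//; exact: integrable_cell.
apply/funext => x; rewrite (bigD1 (c x))//= eqxx mulr1 big1 ?addr0// => i ic.
by rewrite eq_sym (negbTE ic) !mulr0.
Qed.

Lemma sum_cell_mass : \sum_i cell_mass i = \int[mu]_x w x.
Proof.
have [_ ] := Rintegral_cells (fun=> 1).
under eq_Rintegral do rewrite mul1r.
by move=> ->; apply: eq_bigr => i _; rewrite mul1r.
Qed.

Lemma cell_approximation (g : A -> R) (b : 'I_m -> R) (e : R) :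
  mu.-integrable setT (EFin \o (fun x => g x * w x)) ->
  (forall x, `|g x - b (c x)| <= e) ->
  `|\int[mu]_x (g x * w x) - \sum_i b i * cell_mass i| <= e * \int[mu]_x w x.
Proof.
move=> ig ge; have [ib <-] := Rintegral_cells b.
rewrite -RintegralB//.
have ibg : mu.-integrable setT (EFin \o (fun x => g x * w x - b (c x) * w x)).
  exact: (integrableB measurableT ig ib).
apply: (le_trans (le_normr_Rintegral measurableT ibg)).
rewrite -RintegralZl//; apply: le_Rintegral => //.
- exact: (integrable_abse ibg).
- exact: (integrableZl measurableT e iw).
- by move=> x _; rewrite -mulrBl normrM (ger0_norm (w0 x)) ler_wpM2r.
Qed.

End cells.

Section finite_cells.
Context (R : realType) (L : nat) d (A : measurableType d).
Variables (f : A -> R) (g : A -> 'rV[R]_L).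
Hypothesis mf : measurable_fun setT f.
Hypothesis mg : forall l, measurable_fun setT (fun x => g x ord0 l).
Hypothesis cK : compact [set v | exists x, v = (f x, g x)].

(** Compactness is available for the values only: finitely many balls centred at values cover them,
    and the centres supply one action per cell. An action goes to the first set [E y] that contains
    it, which makes the cells disjoint and keeps them measurable. *)
Lemma finite_cells (e : R) : 0 < e -> exists m (c : A -> 'I_m) (a : 'I_m -> A),
  (forall i, measurable (c @^-1` [set i])) /\
  forall x, `|f x - f (a (c x))| <= e /\ forall l, `|g x ord0 l - g (a (c x)) ord0 l| <= e.
Proof.
move=> e0; pose E y := [set x | `|f x - f y| <= e /\ forall l, `|g x ord0 l - g y ord0 l| <= e].
have mle (h : A -> R) y : measurable_fun setT h -> measurable [set x | `|h x - h y| <= e].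
  move=> mh; rewrite (_ : [set x | _] = (fun x => `|h x - h y|) @^-1` `]-oo, e]).
    rewrite -[X in measurable X]setTI; apply: (measurableT_comp (f := fun r : R => `|r|)) => //.
    exact: measurable_funB.
  by apply/seteqP; split => x; rewrite /= in_itv.
have mE y : measurable (E y).
  have -> : E y = [set x | `|f x - f y| <= e] `&`
      \big[setI/setT]_l [set x | `|g x ord0 l - g y ord0 l| <= e].
    rewrite -bigcap_seq; apply/seteqP; split => [x [h1 h2]|x [h1 h2]]; split => // l.
      by move=> _; exact: h2.
    by apply: h2; rewrite /= mem_index_enum.
  apply: measurableI; first exact: mle.
  by apply: bigsetI_measurable => l _; apply: (mle (fun x => g x ord0 l)).
have [s sE] : exists s : seq A, forall x, exists2 y, y \in s & E y x.
  have : @cover_compact ((R * 'rV[R]_L)%type : normedModType R) [set v | exists x, v = (f x, g x)].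
    by rewrite -compact_cover; exact: cK.
  move=> /(_ A setT (fun y => ball (f y, g y) e)).
  case.
  - by move=> y _; exact: ball_open.
  - by move=> _ [x ->]; exists x => //; exact: ballxx.
  move=> D' _ Dcov; exists (finmap.enum_fset D') => x.
  have [|y /= yD [/= b1 b2]] := Dcov (f x, g x); first by exists x.
  exists y => //; split; first by rewrite distrC ltW.
  by move=> l; rewrite distrC ltW//; case: b2 => _ b2l; exact: b2l.
pose ix x := find (fun y => x \in E y) s.
have ixs x : (ix x < size s)%N.
  by rewrite -has_find; apply/hasP; have [y ys Eyx] := sE x; exists y => //; rewrite inE.
exists (size s), (fun x => Ordinal (ixs x)), (fun i => nth point s i); split; last first.
  by move=> x; have := nth_find point (_ : has (fun y => x \in E y) s); rewrite has_find ixs => /(_ isT)/set_mem.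
move=> i.
rewrite (_ : _ @^-1` _ = E (nth point s i) `&`
    \big[setI/setT]_(j < i) ~` E (nth point s j)).
  apply: measurableI => //; apply: bigsetI_measurable => j _; exact: measurableC.
rewrite -(bigcap_mkord i (fun j => ~` E (nth point s j))); apply/seteqP; split => [x /= <-|x [Ex nE]] /=.
  split.
    by have := nth_find point (_ : has (fun y => x \in E y) s); rewrite has_find ixs => /(_ isT)/set_mem.
  by move=> j /= /(before_find point)/negbT/negP; apply: contra_not => /mem_set.
apply: val_inj => /=; apply/eqP; rewrite eqn_leq; apply/andP; split.
  rewrite leqNgt; apply/negP => /(before_find point)/negbT/negP; apply; exact: mem_set.
rewrite leqNgt; apply/negP => h; apply: (nE _ h).
by have := nth_find point (_ : has (fun y => x \in E y) s); rewrite has_find ixs => /(_ isT)/set_mem.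
Qed.

End finite_cells.

(** * Convex hulls *)

Section convex_hull.
Context (R : realType) (V : normedModType R).
Implicit Types K : set V.

Definition convex_comb K m v := exists (p : 'I_m -> R) (a : 'I_m -> V),
  [/\ forall i, K (a i), forall i, 0 <= p i, \sum_i p i = 1 & v = \sum_i p i *: a i].

Definition convex_hull K : set V := [set v | exists m, convex_comb K m v].

(** A multiple of the affine dependence [l] is subtracted from the weights until one of them
    vanishes; neither the total weight nor the barycentre changes. *)
Lemma convex_comb_drop K m (p l : 'I_m.+1 -> R) (a : 'I_m.+1 -> V) :
  (forall i, K (a i)) -> (forall i, 0 <= p i) -> \sum_i p i = 1 ->
  (exists i, l i != 0) -> \sum_i l i = 0 -> \sum_i l i *: a i = 0 ->
  convex_comb K m (\sum_i p i *: a i).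
Proof.
move=> Ka p0 p1 [i1 li1] l0 la0.
wlog [j0 lj0] : l i1 li1 l0 la0 / exists j, 0 < l j.
  move=> h; have [ex|nex] := pselect (exists j, 0 < l j); first exact: (h l i1).
  have lle i : l i <= 0 by rewrite leNgt; apply/negP => li; apply: nex; exists i.
  apply: (h (fun i => - l i) i1); rewrite ?oppr_eq0//.
  - by rewrite sumrN l0 oppr0.
  - by under eq_bigr do rewrite scaleNr; rewrite sumrN la0 oppr0.
  - by exists i1; rewrite oppr_gt0 lt_neqAle li1 lle.
(* The smallest ratio over the positive entries of [l] is the largest multiple of [l] that leaves
   all weights nonnegative. *)
pose t i := p i / l i.
case: (@Order.TotalTheory.arg_minP _ _ _ j0 (fun i => 0 < l i) t lj0) => i0 li0 tmin.
pose p' i := p i - t i0 * l i.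
have p'i0 : p' i0 = 0 by rewrite /p' /t divfK ?subrr// gt_eqF.
have p'0 i : 0 <= p' i.
  rewrite subr_ge0; have [li|li] := ltP 0 (l i).
    by rewrite -ler_pdivlMr//; exact: tmin.
  apply: le_trans (p0 i); apply: mulr_ge0_le0 => //.
  by rewrite divr_ge0// ltW.
have sumlift (W : zmodType) (F : 'I_m.+1 -> W) : F i0 = 0 ->
    \sum_i F i = \sum_(i < m) F (lift i0 i).
  by move=> F0; rewrite (bigD1_ord i0)//= F0 add0r.
exists (fun i => p' (lift i0 i)), (fun i => a (lift i0 i)); split => //.
  rewrite -(sumlift _ p')// sumrB p1 -mulr_sumr l0 mulr0 subr0//.
rewrite -(sumlift _ (fun i => p' i *: a i)) ?p'i0 ?scale0r//.
under [RHS]eq_bigr do rewrite /p' scalerBl -scalerA.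
by rewrite sumrB -scaler_sumr la0 scaler0 subr0.
Qed.

Lemma convex_comb_pad K m v : (0 < m)%N -> convex_comb K m v -> convex_comb K m.+1 v.
Proof.
case: m => // m _ [p [a [Ka p0 p1 ->]]].
exists (fun i => if unlift ord_max i is Some j then p j else 0).
exists (fun i => if unlift ord_max i is Some j then a j else a ord0).
split.
- by move=> i; case: unlift.
- by move=> i; case: unlift.
- rewrite (bigD1_ord ord_max)//= unlift_none add0r.
  by under eq_bigr do rewrite liftK.
- rewrite [RHS](bigD1_ord ord_max)//= unlift_none scale0r add0r.
  by under [RHS]eq_bigr do rewrite liftK.
Qed.

(* [c] witnesses that [V] has dimension at most [D]. *)
Variables (D : nat) (c : {linear V -> 'rV[R]_D}).
Hypothesis c_inj : injective c.

Lemma caratheodory K v : convex_hull K v -> convex_comb K D.+1 v.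
Proof.
move=> [m]; elim: m => [|m IH].
  by move=> [p [a [_ _ + _]]]; rewrite big_ord0 => /eqP; rewrite eq_sym oner_eq0.
have [mD|Dm] := ltnP m D.+1.
  move=> h; rewrite -(subnKC mD); elim: (D.+1 - m.+1)%N => [|n IHn]; first by rewrite addn0.
  by rewrite addnS; apply: convex_comb_pad; rewrite ?addSn.
move=> [p [a [Ka p0 p1 ve]]]; apply: IH; rewrite ve.
(* The column of ones forces a vector of the left kernel to have sum 0, so it is an affine
   dependence. Such a vector exists because the [m.+1] rows outnumber the [1 + D] columns. *)
pose A : 'M[R]_(m.+1, 1 + D) := \matrix_(i < m.+1) row_mx 1 (c (a i)).
have rkA : (\rank (kermx A) != 0)%N.
  rewrite mxrank_ker subn_eq0 -ltnNge; apply: (leq_ltn_trans (rank_leq_col A)).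
  by rewrite ltnS.
have /rowV0Pn[u] : kermx A != 0 by rewrite -mxrank_eq0.
move=> /sub_kermxP uA u0.
have rowA i : row i A = row_mx 1 (c (a i)) by rewrite rowK.
have : \sum_i u 0 i *: row i A = 0 by rewrite -mulmx_sum_row.
under eq_bigr do rewrite rowA.
move=> sum0.
apply: (@convex_comb_drop K m p (u 0) a) => //.
- apply: contrapT => /forallNP nu; move/negP: u0; apply; apply/eqP/rowP => i.
  by rewrite mxE; apply/eqP; have /negP := nu i; rewrite negbK.
- have := congr1 (fun M : 'rV_(1 + D) => M 0 (lshift D 0)) sum0.
  rewrite summxE mxE => sum1; rewrite -[RHS]sum1.
  by apply: eq_bigr => i _; rewrite mxE row_mxEl mxE eqxx mulr1.
- apply: c_inj; rewrite linear_sum linear0; apply/rowP => j.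
  have := congr1 (fun M : 'rV_(1 + D) => M 0 (rshift 1 j)) sum0.
  rewrite !summxE !mxE => sumj; rewrite -[RHS]sumj.
  by apply: eq_bigr => i _; rewrite linearZ [RHS]mxE row_mxEr mxE.
Qed.

(** With the number of points fixed at [D.+1], the hull is the image of a compact set of weights and
    points under the continuous barycentre map. *)
Lemma compact_convex_hull K : compact K -> compact (convex_hull K).
Proof.
move=> cK.
pose T := fun _ : 'I_D.+1 => ((R * V)%type : topologicalType).
pose A : set (prod_topology T) := [set f | forall i, (`[0, 1]%classic `*` K) (f i)].
have cA : compact A.
  apply: (@tychonoff _ T (fun _ => `[0, 1]%classic `*` K)) => i.
  by apply: compact_setX => //; exact: segment_compact.
have cproj i : continuous (fun f : prod_topology T => f i).
  exact: (@proj_continuous _ T i).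
pose tot (f : prod_topology T) := \sum_i (f i).1.
pose bar (f : prod_topology T) := \sum_i (f i).1 *: (f i).2.
have c1 i : continuous (fun f : prod_topology T => (f i).1).
  by move=> f; apply: (continuous_comp (cproj i f)); exact: cvg_fst.
have c2 i : continuous (fun f : prod_topology T => (f i).2).
  by move=> f; apply: (continuous_comp (cproj i f)); exact: cvg_snd.
have ctot : continuous tot.
  by apply: continuous_big => //; exact: add_continuous.
have cbar : continuous bar.
  apply: continuous_big => //; first exact: add_continuous.
  move=> i _ f; apply: cvgZ; first exact: nbhs_filter.
    exact: c1.
  exact: c2.
have -> : convex_hull K = bar @` (A `&` tot @^-1` [set 1]).
  apply/seteqP; split => [v /caratheodory[p [a [Ka p0 p1 ->]]]|v [f [Af t1] <-]].
    exists (fun i => (p i, a i)) => //; split => //= i; split => //=.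
    rewrite in_itv /= p0 /= -p1 (bigD1 i)//= lerDl.
    exact: sumr_ge0.
  exists D.+1, (fun i => (f i).1), (fun i => (f i).2); split => //.
  - by move=> i; have [] := Af i.
  - by move=> i; have [] := Af i; rewrite /= in_itv /= => /andP[].
apply: continuous_compact.
  by apply: continuous_subspaceT => f; exact: cbar.
apply: compact_closedI => //; apply: closed_comp; last exact: closed_eq.
by move=> f _; exact: ctot.
Qed.

End convex_hull.

(** * The averages of a policy *)

Section system.
Context (R : realType) (L : nat) (S : renewal_system R L) (B : R).
Hypothesis hB : residual_bound S B.

Let measurable_length_event (Q : set nat) : measurable ((@frame_length _ _ S) @^-1` Q).
Proof. by rewrite -[X in measurable X]setTI; apply: measurable_frame_length. Qed.

(** A natural number is at most its square, so the bound on the second moment bounds the first;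
    multiplying by the probability of the event removes the conditioning. Off the event the
    truncated difference is 0. *)
Lemma residual_truncated (a : action S) (s : nat) :
  (\int[frame_law S a]_x ((frame_length x - s)%N%:R)%:E <=
   B%:E * frame_law S a [set x | (s <= frame_length x)%N])%E.
Proof.
set E := [set x | _]; set mu := frame_law S a.
have mE : measurable E := measurable_length_event [set n | (s <= n)%N].
have mres : measurable_fun setT (fun x : sample S => ((frame_length x - s)%N%:R : R)%:E).
  apply/measurable_EFinP.
  by apply: (@measurableT_comp _ _ _ _ _ _ (fun n : nat => (n - s)%N%:R : R)) => //; exact: measurable_frame_length.
have msq : measurable_fun setT (fun x : sample S => (((frame_length x)%:R - s%:R) ^+ 2 : R)%:E).
  apply/measurable_EFinP.
  by apply: (@measurableT_comp _ _ _ _ _ _ (fun n : nat => (n%:R - s%:R) ^+ 2 : R)) => //; exact: measurable_frame_length.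
have -> : (\int[mu]_x ((frame_length x - s)%N%:R)%:E = \int[mu]_(x in E) ((frame_length x - s)%N%:R)%:E)%E.
  rewrite [RHS]integral_mkcond; apply: eq_integral => x _; rewrite patchE.
  case: ifPn => // xE; have : (frame_length x < s)%N.
    by rewrite ltnNge; apply: contra xE => h; rewrite inE.
  by move=> /ltnW; rewrite -subn_eq0 => /eqP ->.
(* On a null event [residual_bound] says nothing, but both sides vanish. *)
have [muE|muE] := eqVneq (mu E) 0%E.
  by rewrite muE mule0 null_set_integral//; exact: measurable_funTS.
have muEgt : (0 < mu E)%E by rewrite lt0e muE measure_ge0.
have muEfin : mu E \is a fin_num.
  rewrite ge0_fin_numE//; apply: (@le_lt_trans _ _ (mu setT)).
    by apply: le_measure; rewrite ?inE.
  by rewrite /mu (prob_kernel (s := frame_law S)) ltry.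
have := hB muEgt; rewrite /cond_expectation -/E -/mu.
rewrite -lee_pdivlMr ?invr_gt0 ?fine_gt0//; last by rewrite muEgt ltey_eq muEfin.
rewrite invrK fineK// => h; apply: le_trans h; apply: ge0_le_integral => //.
- exact: measurable_funTS.
- exact: measurable_funTS.
- move=> x; rewrite /E /= => sx; rewrite lee_fin -natrB// -natrX ler_nat.
  by case: (_ - _)%N => // n; rewrite expnS leq_pmulr// expn_gt0.
Qed.

Lemma That_ge1 (a : action S) : 1 <= That a.
Proof.
have iL := integrable_length (@measurable_frame_length _ _ S) residual_truncated a.
have -> : 1 = \int[frame_law S a]_x (1 : R).
  by rewrite Rintegral_cst// mul1r (prob_kernel (s := frame_law S)).
apply: le_Rintegral => //.
  apply: (le_integrable measurableT _ _ iL); first exact: measurable_cst.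
  by move=> x _; rewrite /= lee_fin normr1 ger0_norm// ler1n frame_length_gt0.
by move=> x _; rewrite ler1n frame_length_gt0.
Qed.

Lemma That_gt0 (a : action S) : 0 < That a.
Proof. exact: lt_le_trans (That_ge1 a). Qed.

(* The weights of a combination of ratios, divided by [That] and normalized, are
   weights of a combination of the triples [(yhat, zhat, That)]. *)
Lemma hull_sub_performance_region : convex_hull (@ratio_set _ _ S) `<=` performance_region S.
Proof.
move=> v [m [p [b [Kb p0 p1 ->]]]].
have /choice[a ab] : forall i, exists a : action S, b i = (fhat a, ghat a) by move=> i; exact: Kb.
pose Z := \sum_i p i / That (a i).
have q0 i : 0 <= p i / That (a i) by rewrite divr_ge0// ltW// That_gt0.
have Z0 : 0 < Z.
  rewrite lt_neqAle sumr_ge0// andbT eq_sym; apply/negP => /eqP Z0.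
  have p00 i : p i = 0.
    have /eqP := psumr_eq0P (fun i _ => q0 i) Z0 (i := i) isT.
    by rewrite mulf_eq0 invr_eq0 (gt_eqF (That_gt0 _)) orbF => /eqP.
  by move: p1; under eq_bigr do rewrite p00; rewrite big1// => /eqP; rewrite eq_sym oner_eq0.
pose q i := p i / That (a i) / Z.
exists (\sum_i q i * yhat (a i)), (\sum_i q i *: zhat (a i)), (\sum_i q i * That (a i)).
have TE : \sum_i q i * That (a i) = Z^-1.
  rewrite -[RHS]mul1r -p1 mulr_suml; apply: eq_bigr => i _.
  by rewrite /q; field; rewrite !gt_eqF// That_gt0.
split.
  exists m, q, a; split => //.
    by move=> i; rewrite divr_ge0// ltW.
  by rewrite -mulr_suml mulfV// gt_eqF.
rewrite TE invrK; rewrite [LHS]surjective_pairing; congr (_, _).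
  rewrite (raddf_sum fst) /= mulr_suml; apply: eq_bigr => i _.
  transitivity (p i * fhat (a i)); first by rewrite ab.
  by rewrite /fhat /q; field; rewrite !gt_eqF// That_gt0.
rewrite (raddf_sum snd) /= scaler_sumr; apply: eq_bigr => i _.
rewrite ab /= /ghat !scalerA; congr (_ *: _).
by rewrite /q; field; rewrite !gt_eqF// That_gt0.
Qed.

End system.

Section policy.
Context (R : realType) (N L : nat) (sys : 'I_N -> renewal_system R L)
  (ext : probability (L.-tuple R) R) (pi : decision_sequence sys ext) (n : 'I_N).
Variables (ymax zmax B : R).
Hypothesis h_y : forall (x : sample (sys n)) (i : nat),
  (i < frame_length x)%N -> `|frame_penalty x i| <= ymax.
Hypothesis h_z : forall (x : sample (sys n)) (i : nat) (l : 'I_L),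
  (i < frame_length x)%N -> `|tnth (frame_perf x i) l| <= zmax.
Hypothesis h_B1 : 1 <= B.
Hypothesis h_B : residual_bound (sys n) B.
Hypothesis h_compact : compact (ratio_set (sys n)).

Let P := ds_prob pi.
Let lens := ds_len pi n.
Let acts := @ds_act _ _ _ _ _ pi n.

Lemma past_setT t : past (ds_len pi) (ds_act pi) (ds_y pi) (ds_z pi) (ds_d pi) t setT.
Proof. exact: (@measurableT _ (g_sigma_algebraType _)). Qed.

(** The renewal property for the trivial past event [setT] and all actions, in the shape of the
    hypothesis [law] of the accounting. *)
Lemma decision_law k t m (D : nat -> set R) (C : nat -> set (L.-tuple R)) :
  (forall i, measurable (D i)) -> (forall i, measurable (C i)) ->
  P (renewal_at lens k t `&` [set w | lens k w = m /\ forall i, (i < m)%N ->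
       D i (ds_y pi n (t + i) w) /\ C i (ds_z pi n (t + i) w)]) =
  (\int[P]_(w in renewal_at lens k t) frame_law (sys n) (acts k w) (frame_event m D C))%E.
Proof.
move=> mD mC; have := ds_renewal (d := pi) (n := n) k m (@past_setT t) measurableT mD mC.
rewrite setTI /=.
have -> : [set w | renewal_time (ds_len pi) n k w = t /\ [set: action (sys n)] (ds_act pi n k w)] =
    renewal_at lens k t by apply/seteqP; split => [w []|w].
exact.
Qed.

Lemma penalty_law k t i m (D : set R) : (i < m)%N -> measurable D ->
  P (renewal_at lens k t `&` [set w | lens k w = m /\ D (ds_y pi n (t + i) w)]) =
  (\int[P]_(w in renewal_at lens k t)
     frame_law (sys n) (acts k w) [set x | frame_length x = m /\ D (frame_penalty x i)])%E.
Proof.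
move=> im mD.
have mDi j : measurable (if j == i then D else setT) by case: ifP.
have := @decision_law k t m (fun j => if j == i then D else setT) (fun=> setT) mDi (fun=> measurableT).
have -> : [set w | lens k w = m /\ forall j, (j < m)%N ->
    (if j == i then D else setT) (ds_y pi n (t + j) w) /\ [set: L.-tuple R] (ds_z pi n (t + j) w)] =
    [set w | lens k w = m /\ D (ds_y pi n (t + i) w)].
  apply/seteqP; split => w [lm h]; split => //.
    by have := h i im; rewrite eqxx => -[].
  by move=> j jm; split => //; case: eqP => // ->.
have -> : frame_event m (fun j => if j == i then D else setT) (fun=> setT) =
    [set x : sample (sys n) | frame_length x = m /\ D (frame_penalty x i)].
  apply/seteqP; split => x [lm h]; split => //.
    by have := h i im; rewrite eqxx => -[].
  by move=> j jm; split => //; case: eqP => // ->.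
exact.
Qed.

Lemma perf_law l k t i m (D : set R) : (i < m)%N -> measurable D ->
  P (renewal_at lens k t `&` [set w | lens k w = m /\ D (tnth (ds_z pi n (t + i) w) l)]) =
  (\int[P]_(w in renewal_at lens k t)
     frame_law (sys n) (acts k w) [set x | frame_length x = m /\ D (tnth (frame_perf x i) l)])%E.
Proof.
move=> im mD.
pose C j : set (L.-tuple R) := if j == i then [set v | D (tnth v l)] else setT.
have mC j : measurable (C j).
  rewrite /C; case: ifP => // _.
  by rewrite -[X in measurable X]setTI; apply: (measurable_tnth l).
have := @decision_law k t m (fun=> setT) C (fun=> measurableT) mC.
have -> : [set w | lens k w = m /\ forall j, (j < m)%N ->
    [set: R] (ds_y pi n (t + j) w) /\ C j (ds_z pi n (t + j) w)] =
    [set w | lens k w = m /\ D (tnth (ds_z pi n (t + i) w) l)].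
  apply/seteqP; split => w [lm h]; split => //.
    by have := h i im; rewrite /C eqxx => -[].
  by move=> j jm; split => //; rewrite /C; case: eqP => // ->.
have -> : frame_event m (fun=> setT) C =
    [set x : sample (sys n) | frame_length x = m /\ D (tnth (frame_perf x i) l)].
  apply/seteqP; split => x [lm h]; split => //.
    by have := h i im; rewrite /C eqxx => -[].
  by move=> j jm; split => //; rewrite /C; case: eqP => // ->.
exact.
Qed.

Let mlens : forall k, measurable_fun setT (lens k).
Proof. by move=> k; exact: ds_measurable_len. Qed.

Let macts : forall k, measurable_fun setT (acts k).
Proof. by move=> k; exact: ds_measurable_act. Qed.

Let lens_gt0 : forall k w, (0 < lens k w)%N.
Proof. by move=> k w; exact: ds_len_gt0. Qed.

Let mys : forall u, measurable_fun setT (ds_y pi n u).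
Proof. by move=> u; exact: ds_measurable_y. Qed.

Let mpens : forall i, measurable_fun setT (fun x : sample (sys n) => frame_penalty x i).
Proof. by move=> i; exact: measurable_frame_penalty. Qed.

Let mflen : measurable_fun setT (@frame_length _ _ (sys n)).
Proof. exact: measurable_frame_length. Qed.

Definition frame_count T := occupation P mlens macts T.

Let occ := frame_count.

Let B0 : 0 <= B. Proof. exact: le_trans h_B1. Qed.

Lemma penalty_bound_ge0 : 0 <= ymax.
Proof.
by have := h_y (frame_length_gt0 (point : sample (sys n))); exact: le_trans.
Qed.

Lemma perf_bound_ge0 (l : 'I_L) : 0 <= zmax.
Proof.
by have := h_z l (frame_length_gt0 (point : sample (sys n))); exact: le_trans.
Qed.

Lemma penalty_accounting T : (0 < T)%N ->
  exists X : R, [/\ (\sum_(u < T) 'E_P[ds_y pi n u])%E = X%:E,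
    (occ T).-integrable setT (EFin \o @yhat _ _ (sys n)) &
    `|X - \int[occ T]_a yhat a| <= ymax * B].
Proof.
move=> T0; under eq_bigr do rewrite unlock.
apply: (real_accounting mflen lens_gt0 mlens macts mys mpens
  penalty_bound_ge0 h_y B0 (residual_truncated h_B) penalty_law T0).
Qed.

Lemma perf_accounting l T : (0 < T)%N ->
  exists X : R, [/\ (\sum_(u < T) 'E_P[(fun w => tnth (ds_z pi n u w) l)])%E = X%:E,
    (occ T).-integrable setT (EFin \o (fun a : action (sys n) => zhat a ord0 l)) &
    `|X - \int[occ T]_a zhat a ord0 l| <= zmax * B].
Proof.
move=> T0; under eq_bigr do rewrite unlock.
have -> : (fun a : action (sys n) => zhat a ord0 l) =
  mean_frame_sum (frame_law (sys n)) (@frame_length _ _ (sys n)) (fun x i => tnth (frame_perf x i) l).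
  by apply/funext => a; rewrite mxE.
have mv u : measurable_fun setT (fun w => tnth (ds_z pi n u w) l).
  by apply: (measurableT_comp (measurable_tnth l)); exact: ds_measurable_z.
have mp i : measurable_fun setT (fun x : sample (sys n) => tnth (frame_perf x i) l).
  by apply: (measurableT_comp (measurable_tnth l)); exact: measurable_frame_perf.
exact: (real_accounting mflen lens_gt0 mlens macts mv mp
  (perf_bound_ge0 l) (fun x i => @h_z x i l) B0 (residual_truncated h_B) (@perf_law l) T0).
Qed.

Lemma That_accounting T : (0 < T)%N ->
  (occ T).-integrable setT (EFin \o @That _ _ (sys n)) /\
  T%:R <= \int[occ T]_a That a <= T%:R + B.
Proof.
move=> T0; split.
  exact: (integrable_mean_length mflen lens_gt0 mlens macts mys mpens
  B0 (residual_truncated h_B) penalty_law T0).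
exact: (mean_length_accounting mflen lens_gt0 mlens macts mys mpens
  B0 (residual_truncated h_B) penalty_law T0).
Qed.

(* [G] is [yhat] or a coordinate of [zhat], and [g = G / That].  Replacing [g] by its
   value at one action of each cell turns the [That]-weighted mean of [g] into a
   finite convex combination. *)
Lemma near_weighted_mean (T : nat) (m : nat) (c : action (sys n) -> 'I_m)
    (a : 'I_m -> action (sys n)) (g G : action (sys n) -> R) (X M : R) : (0 < T)%N ->
  (forall i, measurable (c @^-1` [set i])) -> 0 <= M ->
  (forall x, G x = g x * That x) -> (occ T).-integrable setT (EFin \o G) ->
  (forall x, `|G x| <= M * That x) ->
  (forall x, `|g x - g (a (c x))| <= T%:R^-1) ->
  `|X - \int[occ T]_x G x| <= M * B ->
  `|T%:R^-1 * X - \sum_i cell_mass (occ T) c (@That _ _ (sys n)) i / (\int[occ T]_x That x) * g (a i)|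
    <= (2 * (M * B) + 1 + B) / T%:R.
Proof.
move=> T0 mc M0 GE iG GM gc XI.
have [iThat /andP[T1 T2]] := That_accounting T0.
have That0 x : 0 <= @That _ _ (sys n) x by rewrite ltW// (That_gt0 h_B).
have gM x : `|g x| <= M.
  rewrite -(ler_pM2r (That_gt0 h_B x)); apply: le_trans (GM x).
  by rewrite GE normrM (ger0_norm (That0 x)).
set theta := \int[occ T]_x That x in T1 T2 *; set W := cell_mass _ _ _.
have TR : 1 <= T%:R :> R by rewrite ler1n.
have TR0 : 0 < T%:R :> R by rewrite ltr0n.
have theta0 : 0 < theta by exact: lt_le_trans T1.
have W0 i : 0 <= W i by exact: cell_mass_ge0.
have WE : \sum_i W i = theta by exact: (sum_cell_mass mc iThat).
set s := \sum_i _.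
have sE : \sum_i g (a i) * W i = theta * s.
  rewrite /s mulr_sumr; apply: eq_bigr => i _.
  by field; rewrite gt_eqF.
have sM : `|s| <= M.
  rewrite -(ler_pM2l theta0) -[X in X * _](ger0_norm (ltW theta0)) -normrM -sE.
  apply: (le_trans (ler_norm_sum _ _ _)); rewrite -WE mulr_suml.
  by apply: ler_sum => i _; rewrite normrM (ger0_norm (W0 i)) mulrC ler_wpM2l.
have := @cell_approximation _ _ _ (occ T) m c mc (@That _ _ (sys n)) That0 iThat g (fun i => g (a i)) T%:R^-1.
rewrite -/theta -/W sE; under eq_Rintegral do rewrite -GE.
have -> : (fun x => g x * That x) = G by apply/funext => x; rewrite GE.
move=> /(_ iG gc); set I := \int[occ T]_x G x in XI * => Is.
have e1 : T%:R^-1 * theta <= 1 + B.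
  rewrite mulrC ler_pdivrMr//; apply: le_trans T2 _.
  rewrite mulrDl mul1r lerD2l ler_peMr//; exact: B0.
have e2 : `|(theta - T%:R) * s| <= B * M.
  rewrite normrM ler_pM//; rewrite ger0_norm; lra.
(* Three errors: the accounting, at most [M * B]; the cell width 1/T times [theta], at most [1 + B];
   and [theta] in place of [T], off by at most [B] while [s] is at most [M] in absolute value. This
   is the origin of [2 * (M * B) + 1 + B]. *)
have e3 : X - T%:R * s = (X - I) + (I - theta * s) + (theta - T%:R) * s by ring.
have e4 : `|X - T%:R * s| <= 2 * (M * B) + 1 + B.
  rewrite e3; apply: le_trans (ler_normD _ _) _.
  apply: le_trans (lerD (le_trans (ler_normD _ _) (lerD XI (le_trans Is e1))) e2) _.
  by rewrite (mulrC B M); lra.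
have -> : T%:R^-1 * X - s = (X - T%:R * s) / T%:R by field; rewrite gt_eqF.
by rewrite normrM normfV (ger0_norm (ltW TR0)) ler_pM2r// invr_gt0.
Qed.

(** The cells shrink with the horizon, so that partitioning costs no more than the accounting. One
    constant serves penalty and performance; it contains an absolute value because the sign of
    [zmax] is unknown when [L = 0]. *)
Lemma policy_near_hull T : (0 < T)%N ->
  exists (X : R) (Z : 'I_L -> R) (v : R * 'rV[R]_L),
  [/\ convex_hull (@ratio_set _ _ (sys n)) v,
      (\sum_(u < T) 'E_P[ds_y pi n u])%E = X%:E,
      forall l, (\sum_(u < T) 'E_P[(fun w => tnth (ds_z pi n u w) l)])%E = (Z l)%:E,
      `|T%:R^-1 * X - v.1| <= (2 * ((ymax + `|zmax|) * B) + 1 + B) / T%:R &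
      forall l, `|T%:R^-1 * Z l - v.2 ord0 l| <= (2 * ((ymax + `|zmax|) * B) + 1 + B) / T%:R].
Proof.
move=> T0; have TR0 : 0 < T%:R :> R by rewrite ltr0n.
have [X [EX iy hX]] := penalty_accounting T0.
have /choice[Z hZ] := fun l => perf_accounting l T0.
have [iThat /andP[T1 T2]] := That_accounting T0.
have That0 x : 0 < @That _ _ (sys n) x by rewrite (That_gt0 h_B).
(* Measurability of [That], and below of [yhat] and [zhat], is read off from integrability against
   the occupation measure. *)
have mThat : measurable_fun setT (@That _ _ (sys n)).
  by case/integrableP: iThat => /measurable_EFinP.
have mThatV : measurable_fun setT (fun a => (@That _ _ (sys n) a)^-1).
  rewrite (_ : (fun a => _) = (fun r : R => r `^ (-1)) \o @That _ _ (sys n)).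
    exact: measurableT_comp (@measurable_powR R (-1)) mThat.
  by apply/funext => a /=; rewrite powR_inv1// ltW.
have mfh : measurable_fun setT (@fhat _ _ (sys n)).
  by apply: measurable_funM => //; case/integrableP: iy => /measurable_EFinP.
have mgh l : measurable_fun setT (fun a => @ghat _ _ (sys n) a ord0 l).
  rewrite (_ : (fun a => _) = (fun a => (That a)^-1 * zhat a ord0 l)).
    by apply: measurable_funM => //; have [_ + _] := hZ l; case/integrableP => /measurable_EFinP.
  by apply/funext => a; rewrite mxE.
have TV : 0 < T%:R^-1 :> R by rewrite invr_gt0.
have [m [c [a [mc hc]]]] := finite_cells mfh mgh h_compact TV.
set theta := \int[occ T]_x That x in T1 T2.
have theta0 : 0 < theta by apply: lt_le_trans T1.
pose p i := cell_mass (occ T) c (@That _ _ (sys n)) i / theta.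
have ymax0 := penalty_bound_ge0.
have Cmono M : 0 <= M -> M <= ymax + `|zmax| ->
    (2 * (M * B) + 1 + B) / T%:R <= (2 * ((ymax + `|zmax|) * B) + 1 + B) / T%:R.
  move=> M0 MM; rewrite ler_pM2r// lerD2r lerD2r ler_pM2l// ler_wpM2r//; exact: B0.
exists X, Z, (\sum_i p i * fhat (a i), \sum_i p i *: ghat (a i)); split.
- exists m, p, (fun i => (fhat (a i), ghat (a i))); split.
  + by move=> i; exists (a i).
  + move=> i; apply: divr_ge0; last exact: ltW.
    by apply: cell_mass_ge0 => x; exact: ltW.
  + by rewrite -mulr_suml (sum_cell_mass mc iThat) mulfV// gt_eqF.
  + by rewrite [RHS]surjective_pairing (raddf_sum fst) (raddf_sum snd).
- exact: EX.
- by move=> l; have [] := hZ l.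
- have h1 : ymax <= ymax + `|zmax| by rewrite lerDl.
  apply: le_trans _ (Cmono ymax ymax0 h1).
  apply: (@near_weighted_mean T m c a (@fhat _ _ (sys n)) (@yhat _ _ (sys n)) X ymax T0 mc ymax0) => //.
  + by move=> x; rewrite /fhat divfK// gt_eqF.
  + move=> x; exact: (norm_mean_frame_sum mflen ymax0 (residual_truncated h_B) x mpens h_y).
  + by move=> x; have [] := hc x.
- move=> l; have [EZ iz hz] := hZ l.
  have zmax0 := perf_bound_ge0 l.
  have h1 : zmax <= ymax + `|zmax| by rewrite (ger0_norm zmax0) lerDr.
  apply: le_trans _ (Cmono zmax zmax0 h1).
  rewrite summxE; under [X in _ - X]eq_bigr do rewrite mxE.
  apply: (@near_weighted_mean T m c a (fun x => ghat x ord0 l) (fun x => zhat x ord0 l) (Z l) zmax T0 mc zmax0) => //.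
  + by move=> x; rewrite /ghat [X in _ = X * _]mxE mulrAC mulVf ?mul1r// gt_eqF.
  + move=> x; rewrite mxE.
    have mp i : measurable_fun setT (fun x : sample (sys n) => tnth (frame_perf x i) l).
      by apply: (measurableT_comp (measurable_tnth l)); exact: measurable_frame_perf.
    exact: (norm_mean_frame_sum mflen zmax0 (residual_truncated h_B) x mp (fun x i => @h_z x i l)).
  + by move=> x; have [_] := hc x.
Qed.

End policy.

(** * The lower bound *)

Lemma limn_esup_lt (R : realType) (u : nat -> \bar R) (r : \bar R) :
  (limn_esup u < r)%E -> \forall n \near \oo, (u n < r)%E.
Proof.
rewrite /limn_esup /limf_esup => /ereal_inf_lt[_ [A FA <-] Ar].
apply: filterS FA => n An; apply: le_lt_trans Ar.
by apply: ereal_sup_ubound; exists n.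
Qed.

Section cluster.
Context (R : realType) (N L : nat).
Let V : normedModType R := (R * 'rV[R]_L)%type.
Let W := prod_topology (fun _ : 'I_N => (V : topologicalType)).

Lemma near_inv_le (C e : R) : 0 < e -> \forall T \near \oo, C / T%:R <= e.
Proof.
move=> e0; exists (Num.truncn (`|C| / e)).+1 => // T /= hT.
have T0 : 0 < T%:R :> R by rewrite ltr0n (leq_trans _ hT).
rewrite ler_pdivrMr// mulrC -ler_pdivrMr//; apply: (@le_trans _ _ (`|C| / e)).
  by rewrite ler_pM2r ?invr_gt0// ler_norm.
apply: (@le_trans _ _ (Num.truncn (`|C| / e)).+1%:R); last by rewrite ler_nat.
by rewrite ltW// truncnS_gt.
Qed.

Lemma continuous_sum_coord (h : V -> R) : continuous h ->
  continuous (fun f : W => \sum_n h (f n)).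
Proof.
move=> ch; apply: continuous_big => //; first exact: add_continuous.
move=> n _ f; apply: (continuous_comp (f := fun f : W => f n)); last exact: ch.
exact: (@proj_continuous _ (fun _ : 'I_N => (V : topologicalType)) n).
Qed.

(** If the upper limit were below the value at [p], the points [w T] would eventually lie in a
    closed set that excludes [p]. No subsequence is chosen, so the same [p] can be used for several
    functionals [h]. *)
Lemma cluster_le (w : nat -> W) (p : W) (h : V -> R) (u : nat -> \bar R)
    (X : nat -> 'I_N -> R) (C : R) (b : \bar R) :
  continuous h -> cluster (w @ \oo) p ->
  (forall T, (0 < T)%N -> u T = ((T%:R^-1 : R)%:E * (\sum_n X T n)%:E)%E) ->
  (forall T n, (0 < T)%N -> `|T%:R^-1 * X T n - h (w T n)| <= C / T%:R) ->
  (limn_esup u <= b)%E -> ((\sum_n h (p n))%:E <= b)%E.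
Proof.
move=> ch clus uE wX ub; set s := \sum_n _.
rewrite leNgt; apply/negP => bs.
have [r br rs] : exists2 r : R, (limn_esup u < r%:E)%E & r < s.
  have : (limn_esup u < s%:E)%E by exact: le_lt_trans bs.
  case: (limn_esup u) => [q| |_].
  - rewrite lte_fin => qs; exists ((q + s) / 2); [rewrite lte_fin|]; lra.
  - by rewrite ltNge leey.
  - by exists (s - 1); [exact: ltNyr|lra].
(* [r + e] is the midpoint of [r] and [s]: it leaves room [e] for the approximation error and stays
   below [s]. *)
pose e := (s - r) / 2.
have e0 : 0 < e by rewrite /e; lra.
pose F := [set f : W | \sum_n h (f n) <= r + e].
have cF : closed F.
  apply: (closed_comp (f := fun f : W => \sum_n h (f n)) (D := [set x | x <= r + e])).
    by move=> f _; exact: continuous_sum_coord.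
  exact: closed_le.
suff : F p by rewrite /F /=  -/s /e; lra.
apply: cF => U nU; apply: clus nU.
have := near_inv_le (N%:R * C) e0; have := limn_esup_lt br => lt1 lt2.
suff : \forall k \near \oo, F (w k) by [].
near=> T; rewrite /F /=.
have T0 : (0 < T)%N by near: T; exists 1%N.
have uT : (u T < r%:E)%E by near: T.
have eT : N%:R * C / T%:R <= e by near: T.
have : \sum_n h (w T n) <= \sum_n (T%:R^-1 * X T n + C / T%:R).
  apply: ler_sum => n _; have := wX T n T0; rewrite ler_norml => /andP[]; lra.
rewrite big_split/= -mulr_sumr sumr_const card_ord -[_ *+ N]mulr_natl [_ * (_ / _)]mulrA.
move: uT; rewrite uE// -EFinM lte_fin => uT hle.
by apply: (le_trans hle); rewrite lerD// ltW.
Unshelve. all: by end_near. Qed.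

End cluster.

Section lower_bound.
Context (R : realType) (N L : nat) (sys : 'I_N -> renewal_system R L)
  (ext : probability (L.-tuple R) R) (ymax zmax B : R).
Hypothesis h_y : forall n (x : sample (sys n)) (i : nat),
  (i < frame_length x)%N -> `|frame_penalty x i| <= ymax.
Hypothesis h_z : forall n (x : sample (sys n)) (i : nat) (l : 'I_L),
  (i < frame_length x)%N -> `|tnth (frame_perf x i) l| <= zmax.
Hypothesis h_B1 : 1 <= B.
Hypothesis h_B : forall n, residual_bound (sys n) B.
Hypothesis h_compact : forall n, compact (ratio_set (sys n)).

Let V : normedModType R := (R * 'rV[R]_L)%type.
Let T := fun _ : 'I_N => (V : topologicalType).
Let hulls : set (prod_topology T) := [set f | forall n, convex_hull (@ratio_set _ _ (sys n)) (f n)].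

(** Tychonoff over the systems. The map [c] writes penalty and performance in one row, so that
    Caratheodory applies in dimension [1 + L]. *)
Lemma compact_hulls : compact hulls.
Proof.
apply: (@tychonoff _ T (fun n => convex_hull (@ratio_set _ _ (sys n)))) => n.
pose c (v : V) : 'rV[R]_(1 + L) := row_mx (v.1%:M) v.2.
have cl : linear c.
  move=> a u v; rewrite /c /= -[_ *: u.1]/(a * u.1) scale_row_mx add_row_mx.
  by rewrite raddfD /= scale_scalar_mx.
pose lc := GRing.isLinear.Build _ _ _ _ c cl.
pose c' : {linear V -> 'rV[R]_(1 + L)} := HB.pack c lc.
apply: (@compact_convex_hull _ _ _ c'); last exact: h_compact.
move=> u v /eq_row_mx[/matrixP/(_ 0 0)]; rewrite !mxE eqxx !mulr1n => e1 e2.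
by rewrite [u]surjective_pairing [v]surjective_pairing e1 e2.
Qed.

Lemma continuous_coord l : continuous (fun v : V => v.2 ord0 l).
Proof.
move=> v; apply: (continuous_comp (f := snd) (g := fun z : 'rV[R]_L => z ord0 l)).
  exact: cvg_snd.
exact: coord_continuous.
Qed.

Lemma continuous_fst : continuous (fun v : V => v.1).
Proof. by move=> v; exact: cvg_fst. Qed.

Lemma policy_lower_bound (pi : decision_sequence sys ext) :
  exists fg : prod_topology T, [/\ hulls fg,
    ((\sum_n (fg n).1)%:E <= objective pi)%E &
    forall l, ((\sum_n (fg n).2 ord0 l)%:E <= constraint_value pi l)%E].
Proof.
pose C := 2 * ((ymax + `|zmax|) * B) + 1 + B.
pose good t n (q : R * ('I_L -> R) * V) := (0 < t)%N ->
  [/\ convex_hull (@ratio_set _ _ (sys n)) q.2,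
      (\sum_(u < t) 'E_(ds_prob pi)[ds_y pi n u])%E = q.1.1%:E,
      forall l, (\sum_(u < t) 'E_(ds_prob pi)[(fun w => tnth (ds_z pi n u w) l)])%E = (q.1.2 l)%:E,
      `|t%:R^-1 * q.1.1 - q.2.1| <= C / t%:R &
      forall l, `|t%:R^-1 * q.1.2 l - q.2.2 ord0 l| <= C / t%:R].
have /choice[q hq] : forall t, exists q : 'I_N -> R * ('I_L -> R) * V, forall n, good t n (q n).
  move=> t; have [t0|] := ltnP 0 t; last first.
    (* Horizon 0 has no average; [good] is vacuous there, and any value will do. *)
    by move=> t0; exists (fun _ => (0, fun=> 0, (0 : V))) => n; rewrite /good ltnNge t0.
  have /choice[f hf] : forall n, exists q, good t n q; last by exists f.
  move=> n; have [X [Z [v [h1 h2 h3 h4 h5]]]] :=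
    policy_near_hull pi (h_y (n := n)) (h_z (n := n)) h_B1 (@h_B n) (@h_compact n) t0.
  by exists (X, Z, v).
pose w t : prod_topology T := fun n => (q t n).2.
have [|p [hp clus]] := compact_hulls (F := w @ \oo) _.
  exists 1%N => // t /= t0 n; by have [] := hq t n t0.
exists p; split => //.
- apply: (@cluster_le R N L w p fst _ (fun t n => (q t n).1.1) C _ continuous_fst clus) (lexx _).
  + move=> t t0; congr (_ * _)%E; rewrite exchange_big/= -sumEFin; apply: eq_bigr => n _.
    by have [] := hq t n t0.
  + by move=> t n t0; have [] := hq t n t0.
- move=> l.
  apply: (@cluster_le R N L w p (fun v => v.2 ord0 l) _ (fun t n => (q t n).1.2 l) C _ (@continuous_coord l) clus) (lexx _).
  + move=> t t0; congr (_ * _)%E; rewrite exchange_big/= -sumEFin; apply: eq_bigr => n _.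
    by have [] := hq t n t0.
  + by move=> t n t0; have [_ _ _ _] := hq t n t0.
Qed.

(** [policy_lower_bound] is used twice: for [pi0] it shows that the set of admissible points is
    nonempty, and for any other feasible policy it supplies an admissible point to compare with the
    minimizer. *)
Lemma exists_minimizer (pi0 : decision_sequence sys ext) : feasible pi0 ->
  exists fg : 'I_N -> R * 'rV[R]_L,
  [/\ forall n, convex_hull (@ratio_set _ _ (sys n)) (fg n),
      forall l, \sum_n (fg n).2 ord0 l <= ext_mean ext l &
      forall pi : decision_sequence sys ext, feasible pi ->
        ((\sum_n (fg n).1)%:E <= objective pi)%E].
Proof.
move=> feas0.
pose X : set (prod_topology T) := hulls `&`
  \bigcap_(l : 'I_L) [set f : prod_topology T | \sum_n (f n).2 ord0 l <= ext_mean ext l].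
have inX (pi : decision_sequence sys ext) (fg : prod_topology T) : feasible pi -> hulls fg ->
    (forall l, ((\sum_n (fg n).2 ord0 l)%:E <= constraint_value pi l)%E) -> X fg.
  move=> feas hfg fgl; split=> // l _; rewrite /= -lee_fin.
  by apply: (le_trans (fgl l)); exact: feas.
have cX : compact X.
  apply: compact_closedI; first exact: compact_hulls.
  apply: closed_bigI => l _.
  apply: (closed_comp (f := fun f : prod_topology T => \sum_n (f n).2 ord0 l)
    (D := [set x | x <= ext_mean ext l])).
    by move=> f _; apply: (@continuous_sum_coord R N L (fun v => v.2 ord0 l)); exact: continuous_coord.
  exact: closed_le.
have X0 : X !=set0.
  by have [fg [h1 _ h3]] := policy_lower_bound pi0; exists fg; exact: inX h1 h3.
have cf : {within X, continuous (fun f : prod_topology T => \sum_n (f n).1)}.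
  apply: continuous_subspaceT => f; apply: (@continuous_sum_coord R N L fst); exact: continuous_fst.
have [fg Xfg fgmin] := compact_EVT_min X0 cX cf.
exists fg; split.
- by move=> n; have := set_mem Xfg; case=> + _; apply.
- by move=> l; have := set_mem Xfg; case=> _ /(_ l I).
- move=> pi feas; have [fg' [h1 h2 h3]] := policy_lower_bound pi.
  apply: le_trans h2; rewrite lee_fin; apply: fgmin; rewrite inE; exact: inX h1 h3.
Qed.

End lower_bound.

(** * Stationary randomized policies *)

Lemma measurable_preimageT d1 d2 (X : measurableType d1) (Y : measurableType d2)
    (f : X -> Y) Z : measurable_fun setT f -> measurable Z -> measurable (f @^-1` Z).
Proof. by move=> mf mZ; rewrite -[X in measurable X]setTI; exact: mf. Qed.

Lemma measurable_random_index d d' (X : measurableType d) (Y : measurableType d')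
    (tau : X -> nat) (f : nat -> X -> Y) : measurable_fun setT tau ->
  (forall s, measurable_fun setT (f s)) -> measurable_fun setT (fun w => f (tau w) w).
Proof.
move=> mtau mf _ Z mZ; rewrite setTI (_ : _ @^-1` _ =
    \bigcup_s (tau @^-1` [set s] `&` f s @^-1` Z)).
  apply: bigcupT_measurable => s; apply: measurableI.
    by rewrite -[X in measurable X]setTI; exact: mtau.
  by rewrite -[X in measurable X]setTI; exact: mf.
by apply/seteqP; split => [w Zw|w [s _ [/= <-]]//]; exists (tau w).
Qed.

Section finite_choice.
Context (R : realType) d d' (A : measurableType d) (S : measurableType d')
  (kappa : R.-pker A ~> S) (m : nat) (p : 'I_m -> R) (a : 'I_m -> A).
Hypotheses (p0 : forall j, 0 <= p j) (p1 : \sum_j p j = 1).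

Lemma measurable_pair_cst (b : A) : measurable_fun setT (fun x : S => (b, x)).
Proof. exact: measurable_pair1. Qed.

(** The part of the joint law of action and frame in which [a j] is drawn, with [j] of value [k].
    Since [msum] runs over natural numbers, the ordinal is recovered by [insub]. *)
Definition choice_component (k : nat) : {measure set (A * S) -> \bar R} :=
  if insub k is Some j then
    mscale (NngNum (p0 j)) (pushforward_measure (kappa (a j)) (measurable_pair_cst (a j)))
  else mzero.

Definition choice_law : set (A * S) -> \bar R := msum choice_component m.

HB.instance Definition _ := Measure.on choice_law.

Lemma ge0_integral_choice_law (h : A * S -> \bar R) : measurable_fun setT h ->
  (forall z, 0 <= h z)%E ->
  (\int[choice_law]_z h z = \sum_j (p j)%:E * \int[kappa (a j)]_x h (a j, x))%E.
Proof.
move=> mh h0; rewrite /choice_law ge0_integral_measure_sum//; apply: eq_bigr => j _.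
rewrite /choice_component valK ge0_integral_mscale//; congr (_ * _)%E.
exact: ge0_integral_pushforward_measure.
Qed.

Lemma choice_lawE F : measurable F ->
  (choice_law F = \sum_j (p j)%:E * kappa (a j) [set x | F (a j, x)])%E.
Proof.
move=> mF; have := @ge0_integral_choice_law (fun z => (\1_F z)%:E).
rewrite integral_indic// setIT => ->.
- apply: eq_bigr => j _; congr (_ * _)%E.
  rewrite -[X in _ = kappa (a j) X]setIT -integral_indic//.
  by rewrite -[X in measurable X]setTI; exact: measurable_pair_cst.
- by apply/measurable_EFinP; exact: measurable_indic.
- by move=> z; rewrite lee_fin.
Qed.

Lemma choice_lawT : choice_law setT = 1%E.
Proof.
rewrite choice_lawE//; under eq_bigr do rewrite (prob_kernel (s := kappa)) mule1.
by rewrite sumEFin p1.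
Qed.

HB.instance Definition _ := Measure_isProbability.Build _ _ R choice_law choice_lawT.

Definition choice_probability : probability (A * S)%type R := choice_law.

End finite_choice.

Section coordinate_integral.
Local Open Scope ereal_scope.
Context (R : realType) (I : countType) (d : I -> measure_display)
  (T : forall i, measurableType (d i)) (mu : forall i, probability (T i) R).

Lemma ge0_integral_coordinate i (H : set (Omega T)) (h : T i -> \bar R) : measurable H ->
  (forall (x : Omega T) (y : T i), H (eqtype.dfwith x y) <-> H x) ->
  measurable_fun setT h -> (forall z, 0 <= h z) ->
  \int[product_measure mu]_(w in H) h (w i) = product_measure mu H * \int[mu i]_z h z.
Proof.
move=> mH dH mh h0.
pose Q := mixture (product_measure mu) (kdirac (@measurable_id _ (T i) setT))
  (measurable_coordinate (i := i)) mH.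
have QE : \int[Q]_z h z = \int[product_measure mu]_(w in H) h (w i).
  rewrite ge0_integral_mixture//; apply: eq_integral => w _.
  by rewrite /kdirac /= integral_dirac// diracT mul1e.
have PHfin : product_measure mu H \is a fin_num by exact: fin_num_measure.
have PH0 : (0 <= fine (product_measure mu H))%R by exact: fine_ge0.
rewrite -QE -[product_measure mu H]fineK//.
rewrite -(@ge0_integral_mscale _ _ _ (mu i) setT measurableT (NngNum PH0))//.
apply: eq_measure_integral => F mF _.
transitivity (product_measure mu H * mu i F); last by rewrite -[in LHS](fineK PHfin).
rewrite -(product_measure_indep mu mH dH mF) [LHS]mixtureE// setIC.
have mG : measurable [set x : Omega T | F (x i)].
  by rewrite -[X in measurable X]setTI; exact: measurable_coordinate.
rewrite -(integral_indic _ mH mG); apply: eq_integral => w _.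
by rewrite /kdirac /= diracE !indicE.
Qed.

End coordinate_integral.

Section stationary_policy.
Context (R : realType) (N L : nat) (sys : 'I_N -> renewal_system R L)
  (ext : probability (L.-tuple R) R).
Variables (m : 'I_N -> nat) (p : forall n, 'I_(m n) -> R) (a : forall n, 'I_(m n) -> action (sys n)).
Hypotheses (p0 : forall n (j : 'I_(m n)), 0 <= p j) (p1 : forall n, \sum_j @p n j = 1).

(* The sample space is a product over pairs of a slot [t] and [c : option 'I_N].
   The coordinate [(t, Some n)] is the action that system [n] takes and the frame
   that it starts if it renews at slot [t] (and is ignored otherwise); the
   coordinate [(t, None)] is the value of the external process at slot [t]. *)
Definition slot_display (c : option 'I_N) : measure_display :=
  if c is Some n then measure_prod_display (action_display (sys n), sample_display (sys n))
  else measure_tuple_display default_measure_display.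

Definition slot_type (c : option 'I_N) : measurableType (slot_display c) :=
  match c return measurableType (slot_display c) with
  | Some n => (action (sys n) * sample (sys n))%type
  | None => (L.-tuple R)%type
  end.

Definition slot_law (c : option 'I_N) : probability (slot_type c) R :=
  match c return probability (slot_type c) R with
  | Some n => choice_probability (frame_law (sys n)) (@a n) (@p0 n) (p1 n)
  | None => ext
  end.

Let I : countType := (nat * option 'I_N)%type.
Let T (i : I) := slot_type i.2.
Let Om := Omega T.
Let P : probability Om R := product_measure (fun i : I => slot_law i.2).

Definition frame_from (n : 'I_N) (t : nat) (w : Om) : action (sys n) * sample (sys n) := w (t, Some n).
Definition length_from n t w := frame_length (frame_from n t w).2.

Fixpoint renewal_slot n k (w : Om) : nat :=
  if k is k'.+1 then
    (renewal_slot n k' w + length_from n (renewal_slot n k' w) w)%N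
  else 0%N.

(* The beginning of the frame of system [n] that contains slot [t]. *)
Fixpoint last_renewal n t (w : Om) : nat :=
  if t is t'.+1 then
    let s := last_renewal n t' w in
    if (s + length_from n s w == t)%N then t else s
  else 0%N.

Definition pol_len n k w := length_from n (renewal_slot n k w) w.
Definition pol_act n k w := (frame_from n (renewal_slot n k w) w).1.
Definition pol_y n t w :=
  let s := last_renewal n t w in frame_penalty (frame_from n s w).2 (t - s).
Definition pol_z n t w :=
  let s := last_renewal n t w in frame_perf (frame_from n s w).2 (t - s).
Definition pol_d t (w : Om) : L.-tuple R := w (t, None).

Lemma length_from_gt0 n t w : (0 < length_from n t w)%N.
Proof. exact: frame_length_gt0. Qed.

Lemma renewal_timeE n k w : renewal_time pol_len n k w = renewal_slot n k w.
Proof.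
elim: k => [|k IH]; first by rewrite /renewal_time big_ord0.
by move: IH; rewrite /renewal_time big_ord_recr /= => ->.
Qed.

(** Links the two recursions: [renewal_slot] counts frames, whereas [last_renewal] scans slots. *)
Lemma last_renewal_in_frame n k w i : (i < pol_len n k w)%N ->
  last_renewal n (renewal_slot n k w + i) w = renewal_slot n k w.
Proof.
elim: k i => [|k IH] i; rewrite /pol_len /=.
  elim: i => // i IHi il; rewrite add0n /= IHi ?(ltnW il)//.
  by rewrite add0n gtn_eqF.
set s := renewal_slot n k w; set l := length_from n s w.
have l0 : (0 < l)%N by exact: length_from_gt0.
(* The hypothesis for [k] covers the last slot of that frame, at offset [l.-1]. The frame ends
   there, so the scan moves on to [s + l]. *)
have base : last_renewal n (s + l) w = (s + l)%N.
  have := IH l.-1; rewrite /pol_len -/s -/l ltn_predL => /(_ l0) E.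
  have lE : (s + l = (s + l.-1).+1)%N by rewrite -addnS prednK.
  by rewrite {1}lE /= E -/l -lE eqxx.
elim: i => [|i IHi il]; first by rewrite addn0.
rewrite addnS /= IHi ?(ltnW il)//.
by rewrite gtn_eqF// -addnS ltn_add2l.
Qed.

Lemma measurable_frame_from n t : measurable_fun setT (frame_from n t).
Proof. exact: (measurable_coordinate (T := T) (i := (t, Some n))). Qed.

Lemma measurable_frame_fst n t : measurable_fun setT (fun w => (frame_from n t w).1).
Proof.
apply: (@measurableT_comp _ _ _ _ _ _ fst _ (frame_from n t)).
  exact: measurable_fst.
exact: measurable_frame_from.
Qed.

Lemma measurable_frame_snd n t : measurable_fun setT (fun w => (frame_from n t w).2).
Proof.
apply: (@measurableT_comp _ _ _ _ _ _ snd _ (frame_from n t)).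
  exact: measurable_snd.
exact: measurable_frame_from.
Qed.

Lemma measurable_length_from n t : measurable_fun setT (length_from n t).
Proof.
apply: (measurableT_comp (@measurable_frame_length _ _ (sys n))).
exact: measurable_frame_snd.
Qed.

Lemma measurable_renewal_slot n k : measurable_fun setT (renewal_slot n k).
Proof.
elim: k => [|k IH]; first exact: measurable_cst.
apply: (@measurable_random_index _ _ _ _ (renewal_slot n k)
  (fun s w => s + length_from n s w)%N IH) => s.
by apply: measurable_fun_addn; [exact: measurable_cst|exact: measurable_length_from].
Qed.

Lemma measurable_last_renewal n t : measurable_fun setT (last_renewal n t).
Proof.
elim: t => [|t IH]; first exact: measurable_cst.
apply: (@measurable_random_index _ _ _ _ (last_renewal n t)
  (fun s w => if (s + length_from n s w == t.+1)%N then t.+1 else s) IH) => s.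
apply: (@measurableT_comp _ _ _ _ _ _ (fun l : nat => if (s + l == t.+1)%N then t.+1 else s)) => //.
exact: measurable_length_from.
Qed.

Lemma measurable_pol_len n k : measurable_fun setT (pol_len n k).
Proof.
exact: (measurable_random_index (measurable_renewal_slot n k) (measurable_length_from n)).
Qed.

Lemma measurable_pol_act n k : measurable_fun setT (pol_act n k).
Proof.
apply: (@measurable_random_index _ _ _ _ (renewal_slot n k)
  (fun s w => (frame_from n s w).1) (measurable_renewal_slot n k)) => s.
exact: measurable_frame_fst.
Qed.

Lemma measurable_pol_y n t : measurable_fun setT (pol_y n t).
Proof.
apply: (@measurable_random_index _ _ _ _ (last_renewal n t)
  (fun s w => frame_penalty (frame_from n s w).2 (t - s)) (measurable_last_renewal n t)) => s.
apply: (@measurableT_comp _ _ _ _ _ _ (fun x : sample (sys n) => frame_penalty x (t - s))).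
  exact: measurable_frame_penalty.
exact: measurable_frame_snd.
Qed.

Lemma measurable_pol_z n t : measurable_fun setT (pol_z n t).
Proof.
apply: (@measurable_random_index _ _ _ _ (last_renewal n t)
  (fun s w => frame_perf (frame_from n s w).2 (t - s)) (measurable_last_renewal n t)) => s.
apply: (@measurableT_comp _ _ _ _ _ _ (fun x : sample (sys n) => frame_perf x (t - s))).
  exact: measurable_frame_perf.
exact: measurable_frame_snd.
Qed.

Lemma measurable_pol_d t : measurable_fun setT (pol_d t).
Proof. exact: (measurable_coordinate (T := T) (i := (t, None))). Qed.

(* The external process is included at all times, since decisions must not foresee
   its future. *)
Definition agree_before t (w w' : Om) :=
  forall i : I, ((i.1 < t)%N || (i.2 == None)) -> w i = w' i.

Lemma agree_frame t n s w w' : agree_before t w w' -> (s < t)%N ->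
  frame_from n s w = frame_from n s w'.
Proof. by move=> ww' st; apply: (ww' (s, Some n)); rewrite /= st. Qed.

Lemma agree_length t n s w w' : agree_before t w w' -> (s < t)%N ->
  length_from n s w = length_from n s w'.
Proof. by move=> ww' st; rewrite /length_from (agree_frame n ww' st). Qed.

Lemma agree_sym t w w' : agree_before t w w' -> agree_before t w' w.
Proof. by move=> ww' i it; rewrite ww'. Qed.

(** Frames have positive length, so a renewal at a slot [s <= t] is decided by frames begun strictly
    before [t]. *)
Lemma agree_renewal t n k s w w' : agree_before t w w' -> (s <= t)%N ->
  renewal_slot n k w = s -> renewal_slot n k w' = s.
Proof.
move=> ww'; elim: k s => // k IH s st /= ks.
have kt : (renewal_slot n k w < t)%N.
  apply: leq_trans st; rewrite -ks -addn1 leq_add2l; exact: length_from_gt0.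
by rewrite (IH _ (ltnW kt) erefl) -(agree_length n ww' kt).
Qed.

Lemma last_renewal_le n t w : (last_renewal n t w <= t)%N.
Proof. by elim: t => //= t IH; case: ifP => // _; exact: leqW. Qed.

Lemma agree_last_renewal t n u w w' : agree_before t w w' -> (u <= t)%N ->
  last_renewal n u w = last_renewal n u w'.
Proof.
move=> ww'; elim: u => //= u IH ut; rewrite -IH ?(ltnW ut)//.
rewrite -(agree_length n ww')//; exact: leq_ltn_trans (last_renewal_le n u w) ut.
Qed.

(** An explicit substitute for generated sigma-algebras: these events form a sigma-algebra that
    includes [past] and [past_and_underway] at [t], and they visibly ignore the coordinates drawn
    from [t] on. *)
Definition determined_before t (H : set Om) :=
  measurable H /\ forall w w', agree_before t w w' -> H w -> H w'.

Lemma determined_before_sigma_algebra t : sigma_algebra setT (determined_before t).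
Proof.
split.
- by split=> [|w w' _ []]; exact: measurable0.
- move=> H [mH aH]; rewrite setTD; split; first exact: measurableC.
  by move=> w w' ww' nHw Hw'; apply: nHw; exact: aH (agree_sym ww') Hw'.
- move=> H aH; split; first by apply: bigcupT_measurable => k; case: (aH k).
  by move=> w w' ww' [k _ Hkw]; exists k => //; exact: (aH k).2 ww' Hkw.
Qed.

Lemma past_determined t H :
  past pol_len pol_act pol_y pol_z pol_d t H -> determined_before t H.
Proof.
apply: smallest_sub; first exact: determined_before_sigma_algebra.
move=> _ [[n [k [s [st ->]]]]|[[n [k [s [A [st mA ->]]]]]|[[n [s [B [st mB ->]]]]|
  [[n [s [C [st mC ->]]]]|[s [D [st mD ->]]]]]]].
- under eq_set do rewrite renewal_timeE.
  split; first exact: (measurable_preimageT (Z := [set s]) (measurable_renewal_slot n k)).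
  by move=> w w' ww'; exact: agree_renewal ww' st.
- under eq_set do rewrite renewal_timeE.
  split.
    apply: measurableI; first exact: (measurable_preimageT (Z := [set s]) (measurable_renewal_slot n k)).
    exact: (measurable_preimageT (@measurable_pol_act n k)).
  move=> w w' ww' [ks Aw]; split; first exact: agree_renewal ww' (ltnW st) ks.
  by move: Aw; rewrite /pol_act ks (agree_renewal ww' (ltnW st) ks) (agree_frame n ww' st).
- split; first exact: (measurable_preimageT (measurable_pol_y n s)).
  move=> w w' ww' /=; rewrite /pol_y -(agree_last_renewal n ww' (ltnW st)).
  by rewrite (agree_frame n ww')// (leq_ltn_trans (last_renewal_le n s w)).
- split; first exact: (measurable_preimageT (measurable_pol_z n s)).
  move=> w w' ww' /=; rewrite /pol_z -(agree_last_renewal n ww' (ltnW st)).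
  by rewrite (agree_frame n ww')// (leq_ltn_trans (last_renewal_le n s w)).
- split; first exact: (measurable_preimageT (measurable_pol_d s)).
  by move=> w w' ww' /=; rewrite /pol_d (ww' (s, None))//= orbT.
Qed.

(** A slot [u >= t] may still belong to a frame begun before [t]. Its variables are then read from
    the coordinate of the first slot of that frame, on which the two outcomes agree. *)
Lemma agree_in_frame t n k s u w w' : agree_before t w w' -> (s < t)%N ->
  renewal_slot n k w = s -> (u < s + pol_len n k w)%N ->
  exists2 v, last_renewal n u w = v /\ last_renewal n u w' = v & (v < t)%N.
Proof.
move=> ww' st ks uk; have [ut|tu] := ltnP u t.
  exists (last_renewal n u w); last exact: leq_ltn_trans (last_renewal_le n u w) ut.
  by rewrite (agree_last_renewal n ww' (ltnW ut)).
have us : u = (s + (u - s))%N by rewrite subnKC// (leq_trans (ltnW st)).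
have il : (u - s < pol_len n k w)%N by rewrite -(ltn_add2l s) -us.
have ks' := agree_renewal ww' (ltnW st) ks.
have il' : (u - s < pol_len n k w')%N.
  by move: il; rewrite /pol_len ks ks' (agree_length n ww' st).
exists s => //; split; first by rewrite us -{1}ks last_renewal_in_frame.
by rewrite us -{1}ks' last_renewal_in_frame.
Qed.

Lemma underway_determined t H :
  past_and_underway pol_len pol_act pol_y pol_z pol_d t H -> determined_before t H.
Proof.
apply: smallest_sub; first exact: determined_before_sigma_algebra.
have mk n k s : measurable [set w | renewal_slot n k w = s].
  exact: (measurable_preimageT (Z := [set s]) (measurable_renewal_slot n k)).
have ml n k s u : measurable [set w | (u < s + pol_len n k w)%N].
  exact: (measurable_preimageT (Z := [set l | (u < s + l)%N]) (measurable_pol_len n k)).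
move=> E [/past_determined//|].
move=> [[n [k [s [l [st ->]]]]]|[[n [k [s [u [B [st mB ->]]]]]]|
  [[n [k [s [u [C [st mC ->]]]]]]|[u [D [mD ->]]]]]].
- under eq_set do rewrite renewal_timeE.
  split.
    apply: measurableI; first exact: mk.
    exact: (measurable_preimageT (Z := [set l]) (measurable_pol_len n k)).
  move=> w w' ww' [ks lw]; split; first exact: agree_renewal ww' (ltnW st) ks.
  by move: lw; rewrite /pol_len ks (agree_renewal ww' (ltnW st) ks) (agree_length n ww' st).
- under eq_set do rewrite renewal_timeE.
  split.
    rewrite (_ : mkset _ = [set w | renewal_slot n k w = s] `&`
       [set w | (u < s + pol_len n k w)%N] `&` pol_y n u @^-1` B).
      apply: measurableI; first by apply: measurableI; [exact: mk|exact: ml].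
      exact: (measurable_preimageT (measurable_pol_y n u)).
    by apply/seteqP; split => w /= [] // [].
  move=> w w' ww' [ks uk]; have [v [vw vw'] vt] := agree_in_frame ww' st ks uk.
  rewrite /= /pol_y vw vw' (agree_frame n ww' vt) => yB; split => //.
    exact: agree_renewal ww' (ltnW st) ks.
  by move: uk; rewrite /pol_len ks (agree_renewal ww' (ltnW st) ks) (agree_length n ww' st).
- under eq_set do rewrite renewal_timeE.
  split.
    rewrite (_ : mkset _ = [set w | renewal_slot n k w = s] `&`
       [set w | (u < s + pol_len n k w)%N] `&` pol_z n u @^-1` C).
      apply: measurableI; first by apply: measurableI; [exact: mk|exact: ml].
      exact: (measurable_preimageT (measurable_pol_z n u)).
    by apply/seteqP; split => w /= [] // [].
  move=> w w' ww' [ks uk]; have [v [vw vw'] vt] := agree_in_frame ww' st ks uk.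
  rewrite /= /pol_z vw vw' (agree_frame n ww' vt) => yB; split => //.
    exact: agree_renewal ww' (ltnW st) ks.
  by move: uk; rewrite /pol_len ks (agree_renewal ww' (ltnW st) ks) (agree_length n ww' st).
- split; first exact: (measurable_preimageT (measurable_pol_d u)).
  by move=> w w' ww' /=; rewrite /pol_d (ww' (u, None))//= orbT.
Qed.

Lemma agree_dfwith t n s (x : Om) (b : T (s, Some n)) : (t <= s)%N ->
  agree_before t x (eqtype.dfwith x b).
Proof.
move=> ts [u c] /= uc; rewrite dfwith_out//; apply/eqP => -[us cn].
by move: uc; rewrite -us -cn ltnNge ts.
Qed.

Lemma determined_resample t n s H : determined_before t H -> (t <= s)%N ->
  forall (x : Om) (b : T (s, Some n)), H (eqtype.dfwith x b) <-> H x.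
Proof.
move=> [_ aH] ts x b; have xb := agree_dfwith x b ts.
by split; apply: aH => //; exact: agree_sym.
Qed.

(** * The clauses of [decision_sequence] for this policy *)

Lemma frame_law_indep n t (H : set Om) (G : set (action (sys n) * sample (sys n))) :
  determined_before t H -> measurable G ->
  P (H `&` [set w | G (frame_from n t w)]) =
    (P H * choice_probability (frame_law (sys n)) (@a n) (@p0 n) (p1 n) G)%E.
Proof.
move=> dH mG; have := determined_resample dH (leqnn t) => rH.
exact: (product_measure_indep (fun i : I => slot_law i.2) (i := (t, Some n)) dH.1 (rH n) mG).
Qed.

Lemma ge0_integral_frame n t (H : set Om) (h : action (sys n) * sample (sys n) -> \bar R) :
  determined_before t H -> measurable_fun setT h -> (forall z, 0 <= h z)%E ->
  (\int[P]_(w in H) h (frame_from n t w) =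
    P H * \int[choice_probability (frame_law (sys n)) (@a n) (@p0 n) (p1 n)]_z h z)%E.
Proof.
move=> dH mh h0; have rH := determined_resample dH (leqnn t).
exact: (ge0_integral_coordinate (fun i : I => slot_law i.2) (i := (t, Some n)) dH.1 (rH n) mh h0).
Qed.

Lemma pol_d_iid k (D : nat -> set (L.-tuple R)) : (forall t, measurable (D t)) ->
  P [set w | forall t, (t < k)%N -> D t (pol_d t w)] = (\prod_(t < k) ext (D t))%E.
Proof.
move=> mD.
have mk j : measurable [set w | forall t, (t < j)%N -> D t (pol_d t w)].
  rewrite (_ : mkset _ = \bigcap_(t in `I_j) (pol_d t @^-1` D t))//.
  by apply: bigcap_measurableType => t _; exact: (measurable_preimageT (measurable_pol_d t)).
elim: k => [|k IH].
  by rewrite big_ord0 -[RHS](probability_setT P); congr (P _); apply/seteqP; split.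
rewrite big_ord_recr /= -IH.
rewrite -(product_measure_indep (fun i : I => slot_law i.2) (i := (k, None)) (mk k) _ (mD k)).
  congr (P _); apply/seteqP; split => [w h|w [h hk] t].
    by split; [move=> t tk; apply: h; exact: leqW|exact: h].
  by rewrite ltnS leq_eqVlt => /orP[/eqP ->//|]; exact: h.
move=> x y; have E t : (t < k)%N -> pol_d t (eqtype.dfwith x y) = pol_d t x.
  move=> tk; rewrite /pol_d dfwith_out//; apply: contraTneq tk => -[->].
  by rewrite ltnn.
by split => /= h t tk; have := h t tk; rewrite E.
Qed.

Lemma measurable_frame_event n l (B : nat -> set R) (C : nat -> set (L.-tuple R)) :
  (forall i, measurable (B i)) -> (forall i, measurable (C i)) ->
  measurable (@frame_event _ _ (sys n) l B C).
Proof.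
move=> mB mC; rewrite (_ : frame_event _ _ _ = (@frame_length _ _ (sys n)) @^-1` [set l] `&`
  \bigcap_(i in `I_l) (((fun x => frame_penalty x i) @^-1` B i) `&`
    ((fun x => frame_perf x i) @^-1` C i)))//.
apply: measurableI; first exact: (measurable_preimageT (@measurable_frame_length _ _ _)).
apply: bigcap_measurableType => i _; apply: measurableI.
  exact: (measurable_preimageT (@measurable_frame_penalty _ _ _ i)).
exact: (measurable_preimageT (@measurable_frame_perf _ _ _ i)).
Qed.

Lemma pol_frame n k t w (l : nat) (B : nat -> set R) (C : nat -> set (L.-tuple R)) :
  renewal_slot n k w = t ->
  (pol_len n k w = l /\ forall i, (i < l)%N -> B i (pol_y n (t + i) w) /\ C i (pol_z n (t + i) w)) <->
  frame_event l B C (frame_from n t w).2.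
Proof.
move=> kt; have E i : (i < pol_len n k w)%N -> last_renewal n (t + i) w = t.
  by move=> il; rewrite -kt last_renewal_in_frame.
have El : pol_len n k w = frame_length (frame_from n t w).2 by rewrite /pol_len kt.
rewrite /frame_event /= -El; split=> -[kl h]; split => // i il.
  by have := h i il; rewrite /pol_y /pol_z E ?kl// addKn.
by have := h i il; rewrite /pol_y /pol_z E ?kl// addKn.
Qed.

Lemma renewal_determined n k t H : determined_before t H ->
  determined_before t (H `&` [set w | renewal_slot n k w = t]).
Proof.
move=> [mH aH]; split.
  apply: measurableI => //.
  exact: (measurable_preimageT (Z := [set t]) (measurable_renewal_slot n k)).
move=> w w' ww' [Hw kt]; split; first exact: aH ww' Hw.
exact: agree_renewal ww' (leqnn t) kt.
Qed.

(** If the [k]-th renewal falls on [t], action and frame are the coordinate [(t, Some n)], which is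
    independent of [H']. The left side involves this coordinate through an event and the right side
    through its action only; both become integrals against [choice_law]. *)
Lemma pol_renewal n k t H (A : set (action (sys n))) (l : nat)
    (B : nat -> set R) (C : nat -> set (L.-tuple R)) :
  past pol_len pol_act pol_y pol_z pol_d t H -> measurable A ->
  (forall i, measurable (B i)) -> (forall i, measurable (C i)) ->
  let E := H `&` [set w | renewal_time pol_len n k w = t /\ A (pol_act n k w)] in
  P (E `&` [set w | pol_len n k w = l /\ forall i, (i < l)%N ->
      B i (pol_y n (t + i) w) /\ C i (pol_z n (t + i) w)]) =
  (\int[P]_(w in E) frame_law (sys n) (pol_act n k w) (frame_event l B C))%E.
Proof.
move=> /past_determined /(renewal_determined n k) dH mA mB mC /=.
set H' := H `&` _ in dH.
have mF := measurable_frame_event n l mB mC.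
set F := frame_event l B C in mF.
pose h (z : action (sys n) * sample (sys n)) : \bar R :=
  if z.1 \in A then frame_law (sys n) z.1 F else 0%E.
have mA1 : measurable_fun setT (fun z : action (sys n) * sample (sys n) => z.1 \in A).
  apply: (measurable_fun_bool true); rewrite setTI (_ : _ @^-1` _ = fst @^-1` A).
    exact: (measurable_preimageT measurable_fst).
  by apply/seteqP; split => z /=; [move/set_mem|move/mem_set].
have mh : measurable_fun setT h.
  apply: measurable_fun_ifT => //.
  exact: measurableT_comp (measurable_kernel (frame_law (sys n)) _ mF) measurable_fst.
have h0 z : (0 <= h z)%E by rewrite /h; case: ifP.
pose G := [set z : action (sys n) * sample (sys n) | A z.1 /\ F z.2].
have mG : measurable G.
  rewrite (_ : G = fst @^-1` A `&` snd @^-1` F)//; apply: measurableI.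
    exact: (measurable_preimageT measurable_fst).
  exact: (measurable_preimageT measurable_snd).
transitivity (P (H' `&` [set w | G (frame_from n t w)])).
  congr (P _); apply/seteqP; split => w /=.
    rewrite renewal_timeE => -[[Hw [kt Aw]] lw]; split; first by split.
    split; first by move: Aw; rewrite /pol_act kt.
    exact/(pol_frame l B C kt).
  move=> [[Hw kt] [Aw Fw]]; split; last exact/(pol_frame l B C kt).
  by split => //; rewrite renewal_timeE /pol_act kt.
transitivity (\int[P]_(w in H') h (frame_from n t w))%E; last first.
  rewrite (_ : H `&` _ = H' `&` [set w | A (frame_from n t w).1]); last first.
    apply/seteqP; split => w /=.
      by rewrite renewal_timeE => -[Hw [kt Aw]]; split; [split|move: Aw; rewrite /pol_act kt].
    by move=> [[Hw kt] Aw]; split => //; rewrite renewal_timeE /pol_act kt.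
  rewrite [RHS]integral_mkcondr; apply: eq_integral => w /set_mem[Hw kt].
  rewrite patchE /h /pol_act kt.
  have -> : (w \in [set w | A (frame_from n t w).1]) = ((frame_from n t w).1 \in A) by [].
  by [].
(* What remains on both sides is the sum, over the [j] with [a j] in [A], of [p j] times the
   probability of [F] under [a j]. *)
rewrite frame_law_indep// ge0_integral_frame//; congr (_ * _)%E.
rewrite [LHS]choice_lawE// [RHS]ge0_integral_choice_law//; apply: eq_bigr => j _; congr (_ * _)%E.
rewrite /h /= integral_cst// [X in (_ * X)%E](prob_kernel (s := frame_law (sys n))) mule1.
case: ifPn => [/set_mem Aj|/negP nAj].
  by congr (frame_law _ _ _); apply/seteqP; split => x; [case|].
rewrite (_ : mkset _ = set0) ?measure0//.
by rewrite -subset0 => x [Aj _]; apply: nAj; exact/mem_set.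
Qed.

Lemma last_renewal_is_renewal n t w : exists k, renewal_slot n k w = last_renewal n t w.
Proof.
elim: t => [|t [k kt]]; first by exists 0%N.
rewrite /=; case: eqP => [E|_]; last by exists k.
by exists k.+1; rewrite /= kt.
Qed.

Lemma last_renewalP n t w :
  reflect (exists k, renewal_slot n k w = t) (last_renewal n t w == t).
Proof.
apply: (iffP eqP) => [E|[k <-]].
  by have [k kt] := last_renewal_is_renewal n t w; exists k; rewrite kt.
have := @last_renewal_in_frame n k w 0; rewrite addn0; apply.
exact: length_from_gt0.
Qed.

Section nonanticipating.
Variables (t : nat) (A : forall n, set (action (sys n))).
Hypothesis mA : forall n, measurable (@A n).

Definition action_prob n : R :=
  fine (choice_probability (frame_law (sys n)) (@a n) (@p0 n) (p1 n) (fst @^-1` @A n)).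

(** A system that does not renew at [t] decides nothing and contributes 1. The product over all
    systems is the [h] of [ds_nonanticipating]. *)
Definition decision_factor n (w : Om) : R := if last_renewal n t w == t then action_prob n else 1.

Definition complies (s : seq 'I_N) : set Om :=
  [set w | forall n, n \in s -> last_renewal n t w = t -> @A n (frame_from n t w).1].

Lemma measurable_fst_preimage n :
  measurable ((fst : action (sys n) * sample (sys n) -> _) @^-1` @A n).
Proof. exact: (measurable_preimageT measurable_fst). Qed.

Lemma action_prob01 n : 0 <= action_prob n <= 1.
Proof.
rewrite /action_prob fine_ge0//= -lee_fin fineK ?fin_num_measure//; last exact: measurable_fst_preimage.
apply: (probability_le1 (choice_probability (frame_law (sys n)) (@a n) (@p0 n) (p1 n))).
exact: measurable_fst_preimage.
Qed.

Lemma decision_factor01 n w : 0 <= decision_factor n w <= 1.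
Proof. by rewrite /decision_factor; case: ifP => _; rewrite ?action_prob01// ler01 lexx. Qed.

Lemma prod_decision_factor01 (s : seq 'I_N) w : 0 <= \prod_(n <- s) decision_factor n w <= 1.
Proof.
apply/andP; split; first by apply: prodr_ge0 => n _; have /andP[] := decision_factor01 n w.
elim: s => [|n s IH]; first by rewrite big_nil.
rewrite big_cons mulr_ile1//.
- by have /andP[] := decision_factor01 n w.
- by apply: prodr_ge0 => j _; have /andP[] := decision_factor01 j w.
- by have /andP[] := decision_factor01 n w.
Qed.

Definition renewing n : set Om := [set w | last_renewal n t w = t].

Lemma measurable_renewing n : measurable (renewing n).
Proof. exact: (measurable_preimageT (Z := [set t]) (measurable_last_renewal n t)). Qed.

Lemma renewing_determined n : determined_before t (renewing n).
Proof.
split; first exact: measurable_renewing.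
by move=> w w' ww'; rewrite /renewing /= (agree_last_renewal n ww').
Qed.

Lemma determined_setI (H K : set Om) :
  determined_before t H -> determined_before t K -> determined_before t (H `&` K).
Proof.
move=> [mH aH] [mK aK]; split; first exact: measurableI.
by move=> w w' ww' [Hw Kw]; split; [exact: aH ww' Hw|exact: aK ww' Kw].
Qed.

Lemma measurable_decision_factor n : measurable_fun setT (decision_factor n).
Proof.
apply: measurable_fun_ifT => //.
apply: (measurable_fun_bool true); rewrite setTI (_ : _ @^-1` _ = renewing n).
  exact: measurable_renewing.
by apply/seteqP; split => w /=; [move/eqP|move=> E; apply/eqP].
Qed.

Lemma measurable_complies s : measurable (complies s).
Proof.
rewrite (_ : complies s = \bigcap_(n in [set n | n \in s])
    (~` renewing n `|` frame_from n t @^-1` (fst @^-1` @A n))).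
  apply: fin_bigcap_measurable; first exact: finite_finset.
  move=> n _; apply: measurableU; first exact: measurableC (measurable_renewing n).
  exact: (@measurable_preimageT _ _ _ _ (fun w => (frame_from n t w).1) (@A n)
    (@measurable_frame_fst n t) (@mA n)).
apply/seteqP; split => w h n ns; last by move=> nt; have [] := h n ns.
by have [nt|nt] := pselect (renewing n w); [right; exact: h|left].
Qed.

(* Each system of [s] that renews at slot [t] contributes a factor through its own
   coordinate [(t, Some n)], on which [H] and the other conditions do not depend. *)
Lemma complies_law (s : seq 'I_N) (H : set Om) : uniq s -> determined_before t H ->
  P (H `&` complies s) = (\int[P]_(w in H) (\prod_(n <- s) decision_factor n w)%:E)%E.
Proof.
elim: s H => [|n s IH] H.
  move=> _ [mH _]; under eq_integral do rewrite big_nil.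
  rewrite integral_cst// mul1e; congr (P _).
  by apply/seteqP; split => w; [case|].
move=> /= /andP[ns us] dH.
have dR : determined_before t (H `&` renewing n) by exact: determined_setI (renewing_determined n).
have dN : determined_before t (H `\` renewing n).
  rewrite setDE; apply: determined_setI => //.
  rewrite -setTD; have [_ + _] := determined_before_sigma_algebra t; apply.
  exact: renewing_determined.
have mprod s' : measurable_fun setT (fun w => (\prod_(n <- s') decision_factor n w)%:E).
  apply/measurable_EFinP; apply: measurable_prod => k _.
  exact: measurable_decision_factor.
have prod0 s' w : (0 <= (\prod_(n <- s') decision_factor n w)%:E)%E.
  by rewrite lee_fin; have /andP[] := prod_decision_factor01 s' w.
have HE : H = (H `&` renewing n) `|` (H `\` renewing n).
  by rewrite setUIDK.
have dis : [disjoint H `&` renewing n & H `\` renewing n].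
  by apply/disj_setPS => w [[_ h] [_]].
rewrite [in RHS]HE ge0_integral_setU//; [|exact: dR.1|exact: dN.1|exact: measurable_funTS].
rewrite [in LHS]HE setIUl measureU//; last first.
- by rewrite -subset0 => w [[[_ h] _] [[_ +] _]].
- by apply: measurableI; [exact: dN.1|exact: measurable_complies].
- by apply: measurableI; [exact: dR.1|exact: measurable_complies].
congr (_ + _)%E.
- transitivity ((action_prob n)%:E * P ((H `&` renewing n) `&` complies s))%E.
    rewrite /action_prob fineK; last first.
      by apply: fin_num_measure; exact: measurable_fst_preimage.
    rewrite muleC.
    rewrite -(product_measure_indep (fun i : I => slot_law i.2) (i := (t, Some n)) _ _ (@measurable_fst_preimage n)).
    + congr (P _); apply/seteqP; split => w /=.
        move=> [[Hw nt] h]; split; last by apply: h => //; rewrite inE eqxx.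
        by split => // k ks; apply: h; rewrite inE ks orbT.
      move=> [[[Hw nt] h] An]; split => // k; rewrite inE => /orP[/eqP ->//|].
      exact: h.
    + by apply: measurableI; [exact: dR.1|exact: measurable_complies].
    + move=> w b; have E k : k \in s -> frame_from k t (eqtype.dfwith w b) = frame_from k t w.
        move=> ks; rewrite /frame_from dfwith_out//; apply: contraNneq ns => -[->].
        exact: ks.
      have El k := agree_last_renewal k (agree_dfwith w b (leqnn t)) (leqnn t).
      have rH := determined_resample dR (leqnn t) w b.
      split=> -[/rH Hw h]; split => // k ks kt.
        by rewrite -E//; apply: h => //; rewrite -El.
      by rewrite E//; apply: h => //; rewrite El.
  rewrite IH// -ge0_integralZl//; [|exact: dR.1|exact: measurable_funTS|]; last first.
    by rewrite lee_fin; have /andP[] := action_prob01 n.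
  apply: eq_integral => w /set_mem[_ nt].
  by rewrite big_cons EFinM /decision_factor nt eqxx.
- transitivity (P ((H `\` renewing n) `&` complies s)).
    congr (P _); apply/seteqP; split => w /= [[Hw nt] h]; split => // k.
      by move=> ks; apply: h; rewrite inE ks orbT.
    by rewrite inE => /orP[/eqP ->//|]; exact: h.
  rewrite IH//; apply: eq_integral => w /set_mem[_ nt].
  by rewrite big_cons {2}/decision_factor (introF eqP nt) mul1r.
Qed.

Lemma pol_nonanticipating : exists h : Om -> R,
  [/\ forall w, 0 <= h w <= 1,
      forall Y : set R, measurable Y -> past pol_len pol_act pol_y pol_z pol_d t (h @^-1` Y) &
      forall H, past_and_underway pol_len pol_act pol_y pol_z pol_d t H ->
        P (H `&` [set w | forall n k, renewal_time pol_len n k w = t -> @A n (pol_act n k w)]) =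
        (\int[P]_(w in H) (h w)%:E)%E].
Proof.
exists (fun w => \prod_(n < N) decision_factor n w); split.
- by move=> w; exact: prod_decision_factor01.
- move=> Y mY.
  rewrite /past; set G := (X in smallest _ X).
  (* Here it matters that [past] at [t] contains the renewals at slot [t] itself, since the factor
     of a system depends on whether it renews now. *)
  have mrenew n : (@measurable _ (g_sigma_algebraType G)) (renewing n).
    rewrite (_ : renewing n = \bigcup_k [set w | renewal_time pol_len n k w = t]).
      apply: (@bigcupT_measurable _ (g_sigma_algebraType G)) => k.
      by apply: sub_sigma_algebra; left; exists n, k, t; split.
    apply/seteqP; split => w /=.
      by move/eqP/last_renewalP => [k kt]; exists k => //=; rewrite renewal_timeE.
    move=> [k _ /=]; rewrite renewal_timeE => kt.
    by apply/eqP/last_renewalP; exists k.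
  have mh : measurable_fun setT
      (fun w : g_sigma_algebraType G => \prod_(n < N) decision_factor n w).
    apply: measurable_prod => n _.
    apply: measurable_fun_ifT => //.
    apply: (measurable_fun_bool true); rewrite setTI (_ : _ @^-1` _ = renewing n)//.
    by apply/seteqP; split => w /=; [move/eqP|move=> E; apply/eqP].
  by have := mh measurableT Y mY; rewrite setTI.
- move=> H /underway_determined dH.
  rewrite -(complies_law (index_enum_uniq _) dH); congr (P _).
  apply/seteqP; split => w [Hw h]; split => //.
    move=> n _ /eqP/last_renewalP[k kt].
    by have := h n k; rewrite renewal_timeE /pol_act kt; apply.
  move=> n k; rewrite renewal_timeE => kt; rewrite /pol_act kt; apply: h.
    exact: mem_index_enum.
  by apply/eqP/last_renewalP; exists k.
Qed.

End nonanticipating.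

Definition stationary_policy : decision_sequence sys ext :=
  @DecisionSequence R N L sys ext _ Om P pol_len pol_act pol_y pol_z pol_d
    (fun n k w => length_from_gt0 n (renewal_slot n k w) w)
    measurable_pol_len measurable_pol_act measurable_pol_y measurable_pol_z
    measurable_pol_d pol_d_iid pol_renewal pol_nonanticipating.

End stationary_policy.

(** * The averages of a stationary policy *)

Lemma limn_esup_le_near (R : realType) (u : nat -> \bar R) (a : nat -> R) (v C : R) :
  (forall t, (0 < t)%N -> u t = (a t)%:E) ->
  (forall t, (0 < t)%N -> a t <= v + C / t%:R) -> (limn_esup u <= v%:E)%E.
Proof.
move=> ua av; apply/lee_addgt0Pr => e e0.
have [k _ hk] := near_inv_le C e0.
rewrite /limn_esup /limf_esup.
apply: (@le_trans _ _ (ereal_sup (u @` [set t | (maxn k 1 <= t)%N]))).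
  by apply: ereal_inf_lbound; exists [set t | (maxn k 1 <= t)%N] => //; exists (maxn k 1).
apply: ge_ereal_sup => _ [t /= + <-]; rewrite geq_max => /andP[kt t0].
rewrite ua// -EFinD lee_fin (le_trans (av t t0))// lerD2l.
exact: hk.
Qed.

Section stationary_averages.
Context (R : realType) (N L : nat) (sys : 'I_N -> renewal_system R L)
  (ext : probability (L.-tuple R) R).
Variables (m : 'I_N -> nat) (p : forall n, 'I_(m n) -> R) (a : forall n, 'I_(m n) -> action (sys n)).
Hypotheses (p0 : forall n (j : 'I_(m n)), 0 <= p j) (p1 : forall n, \sum_j @p n j = 1).

Let pi := stationary_policy ext a p0 p1.

(** A draw at slot [t] is independent of the event that a renewal falls on [t], so [c] is the
    expected number of frames begun before [T]. It is not evaluated further: it cancels from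
    ratios. *)
Lemma frame_count_stationary n T : exists c : R, forall h : action (sys n) -> \bar R,
  measurable_fun setT h -> (forall x, 0 <= h x)%E ->
  (\int[frame_count pi n T]_x h x = c%:E * \sum_j (@p n j)%:E * h (a j))%E.
Proof.
pose q t k := (ds_prob pi (renewal_at (ds_len pi n) k t)).
have mq t k : measurable (renewal_at (ds_len pi n) k t).
  by apply: measurable_renewal_at => j; exact: ds_measurable_len.
have qE t k : q t k = (fine (q t k))%:E by rewrite fineK// fin_num_measure.
exists (\sum_(t < T) \sum_(k < T) fine (q t k)) => h mh h0.
have S0 : (0 <= \sum_j (@p n j)%:E * h (a j))%E.
  by apply: sume_ge0 => j _; rewrite mule_ge0// lee_fin.
rewrite ge0_integral_occupation// -sumEFin ge0_sume_distrl; last first.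
  by move=> t _; rewrite lee_fin sumr_ge0// => k _; exact: fine_ge0.
apply: eq_bigr => t _; rewrite -sumEFin ge0_sume_distrl; last first.
  by move=> k _; rewrite lee_fin; exact: fine_ge0.
apply: eq_bigr => k _; rewrite -qE /q.
have dk : determined_before t (renewal_at (ds_len pi n) k t).
  have := @renewal_determined R N L sys n k t setT; rewrite setTI.
  rewrite (_ : renewal_at _ k t = [set w | renewal_slot n k w = t]).
    by apply; split.
  by apply/seteqP; split => w /=; rewrite -renewal_timeE.
transitivity (\int[ds_prob pi]_(w in renewal_at (ds_len pi n) k t)
    h (frame_from n t w).1)%E.
  apply: eq_integral => w /set_mem; rewrite /renewal_at /= => kt.
  have {kt}kt : renewal_slot n k w = t by rewrite -renewal_timeE.
  by rewrite /pol_act kt.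
have mhf : measurable_fun setT (fun z : action (sys n) * sample (sys n) => h z.1).
  exact: measurableT_comp mh measurable_fst.
rewrite (ge0_integral_frame ext a p0 p1 dk mhf (fun z => h0 z.1)).
congr (_ * _)%E; rewrite [LHS](ge0_integral_choice_law _ _ _ mhf (fun z => h0 z.1)).
apply: eq_bigr => j _; congr (_ * _)%E; rewrite /= integral_cst//.
by rewrite [X in (_ * X)%E](prob_kernel (s := frame_law (sys n))) mule1.
Qed.

Lemma frame_count_stationary_real n T : exists c : R, forall f : action (sys n) -> R,
  (frame_count pi n T).-integrable setT (EFin \o f) ->
  \int[frame_count pi n T]_x f x = c * \sum_j @p n j * f (a j).
Proof.
have [c hc] := frame_count_stationary n T; exists c => f /integrableP[mf _].
rewrite /Rintegral integralE hc; [|exact: measurable_funepos|by move=> x].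
rewrite hc; [|exact: measurable_funeneg|by move=> x].
have fpE x : ((EFin \o f)^\+ x)%E = (Num.max (f x) 0)%:E by rewrite funeposE /= EFin_max.
have fnE x : ((EFin \o f)^\- x)%E = (Num.max (- f x) 0)%:E by rewrite funenegE /= EFin_max.
under eq_bigr do rewrite fpE -EFinM.
under [X in (_ - _ * X)%E]eq_bigr do rewrite fnE -EFinM.
rewrite !sumEFin -!EFinM -EFinB /= -mulrBr -sumrB; congr (_ * _); apply: eq_bigr => j _.
rewrite -mulrBr; congr (_ * _).
by rewrite !maxEle; case: ifP; case: ifP; lra.
Qed.

Section bounded.
Variables (ymax zmax B : R).
Hypothesis h_y : forall n (x : sample (sys n)) (i : nat),
  (i < frame_length x)%N -> `|frame_penalty x i| <= ymax.
Hypothesis h_z : forall n (x : sample (sys n)) (i : nat) (l : 'I_L),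
  (i < frame_length x)%N -> `|tnth (frame_perf x i) l| <= zmax.
Hypothesis h_B1 : 1 <= B.
Hypothesis h_B : forall n, residual_bound (sys n) B.

Let Theta n := \sum_j @p n j * That (a j).

Lemma mixed_length_gt0 n : 0 < Theta n.
Proof.
apply: (@lt_le_trans _ _ 1) => //; rewrite -(p1 n); apply: ler_sum => j _.
by rewrite ler_peMr// (That_ge1 (h_B (n := n))).
Qed.

Lemma ratio_near n T (f : action (sys n) -> R) (X M : R) : (0 < T)%N ->
  (frame_count pi n T).-integrable setT (EFin \o f) ->
  `|X - \int[frame_count pi n T]_x f x| <= M ->
  `|T%:R^-1 * X - (\sum_j @p n j * f (a j)) / Theta n| <=
    (M + `|(\sum_j @p n j * f (a j)) / Theta n| * B) / T%:R.
Proof.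
move=> T0 fi XM; have [c hc] := frame_count_stationary_real n T.
move: XM; rewrite hc//.
have [iT] := That_accounting pi h_B1 (@h_B n) T0; rewrite hc//.
set F := \sum_j @p n j * f (a j); rewrite -/(Theta n) => /andP[h1 h2] XM.
have Th := mixed_length_gt0 n; set v := F / Theta n.
(* This eliminates [c]: by the accounting of lengths, [c * Theta n] lies between [T] and [T + B]. *)
have FE : c * F = v * (c * Theta n) by rewrite /v; field; rewrite gt_eqF.
have T0' : 0 < T%:R :> R by rewrite ltr0n.
have -> : T%:R^-1 * X - v = T%:R^-1 * ((X - c * F) + v * (c * Theta n - T%:R)).
  by rewrite FE; field; rewrite gt_eqF.
rewrite normrM gtr0_norm ?invr_gt0// mulrC ler_pM2r ?invr_gt0//.
apply: (le_trans (ler_normD _ _)); rewrite lerD// normrM ler_wpM2l//.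
by rewrite ger0_norm; lra.
Qed.

Lemma stationary_objective :
  (objective pi <= (\sum_n (\sum_j @p n j * yhat (a j)) / Theta n)%:E)%E.
Proof.
set v := fun n => (\sum_j @p n j * yhat (a j)) / Theta n.
have /choice[X hX] : forall T, exists X : 'I_N -> R, forall n, (0 < T)%N ->
    (\sum_(u < T) 'E_(ds_prob pi)[ds_y pi n u])%E = (X n)%:E /\
    `|T%:R^-1 * X n - v n| <= (ymax * B + `|v n| * B) / T%:R.
  move=> T; have [T0|] := ltnP 0 T; last by exists (fun=> 0).
  suff /choice[X hX] : forall n, exists X, (\sum_(u < T) 'E_(ds_prob pi)[ds_y pi n u])%E = X%:E /\
    `|T%:R^-1 * X - v n| <= (ymax * B + `|v n| * B) / T%:R by exists X => n _.
  move=> n; have [X [XE iy Xn]] := penalty_accounting pi (@h_y n) h_B1 (@h_B n) T0.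
  by exists X; split => //; exact: ratio_near.
apply: (@limn_esup_le_near _ _ (fun T => T%:R^-1 * \sum_n X T n) _
  (\sum_n (ymax * B + `|v n| * B))).
  move=> T T0; rewrite EFinM; congr (_ * _)%E; rewrite exchange_big/= -sumEFin.
  by apply: eq_bigr => n _; have [] := hX T n T0.
move=> T T0; rewrite mulr_sumr mulr_suml -big_split /=; apply: ler_sum => n _.
by have [_] := hX T n T0; rewrite -/(v n) ler_norml => /andP[]; lra.
Qed.

Lemma stationary_constraint l :
  (constraint_value pi l <= (\sum_n (\sum_j @p n j * zhat (a j) ord0 l) / Theta n)%:E)%E.
Proof.
set v := fun n => (\sum_j @p n j * zhat (a j) ord0 l) / Theta n.
have /choice[X hX] : forall T, exists X : 'I_N -> R, forall n, (0 < T)%N ->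
    (\sum_(u < T) 'E_(ds_prob pi)[(fun w => tnth (ds_z pi n u w) l)])%E = (X n)%:E /\
    `|T%:R^-1 * X n - v n| <= (zmax * B + `|v n| * B) / T%:R.
  move=> T; have [T0|] := ltnP 0 T; last by exists (fun=> 0).
  suff /choice[X hX] : forall n, exists X,
    (\sum_(u < T) 'E_(ds_prob pi)[(fun w => tnth (ds_z pi n u w) l)])%E = X%:E /\
    `|T%:R^-1 * X - v n| <= (zmax * B + `|v n| * B) / T%:R by exists X => n _.
  move=> n; have [X [XE iy Xn]] := perf_accounting pi (@h_z n) h_B1 (@h_B n) l T0.
  by exists X; split => //; exact: (ratio_near T0 iy Xn).
apply: (@limn_esup_le_near _ _ (fun T => T%:R^-1 * \sum_n X T n) _
  (\sum_n (zmax * B + `|v n| * B))).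
  move=> T T0; rewrite EFinM; congr (_ * _)%E; rewrite exchange_big/= -sumEFin.
  by apply: eq_bigr => n _; have [] := hX T n T0.
move=> T T0; rewrite mulr_sumr mulr_suml -big_split /=; apply: ler_sum => n _.
by have [_] := hX T n T0; rewrite -/(v n) ler_norml => /andP[]; lra.
Qed.

End bounded.

End stationary_averages.

(** * From points of the performance regions to the optimal value *)

Lemma f_star_le (R : realType) (N L : nat)
    (sys : 'I_N -> renewal_system R L) (ext : probability (L.-tuple R) R)
    (ymax zmax B : R)
    (h_y : forall n (x : sample (sys n)) (i : nat),
       (i < frame_length x)%N -> `|frame_penalty x i| <= ymax)
    (h_z : forall n (x : sample (sys n)) (i : nat) (l : 'I_L),
       (i < frame_length x)%N -> `|tnth (frame_perf x i) l| <= zmax)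
    (h_B1 : 1 <= B) (h_B : forall n, residual_bound (sys n) B)
    (fg : 'I_N -> R * 'rV[R]_L) :
  (forall n, performance_region (sys n) (fg n)) ->
  (forall l : 'I_L, \sum_(n < N) (fg n).2 ord0 l <= ext_mean ext l) ->
  (f_star sys ext <= (\sum_(n < N) (fg n).1)%:E)%E.
Proof.
move=> fgP fgl.
(* The number of mixed actions varies with the system, hence the dependent pair; the quotients are
   written as in the bounds for the stationary policy. *)
pose good n (c : {m : nat & ('I_m -> R) * ('I_m -> action (sys n))}%type) :=
  [/\ forall i, 0 <= (projT2 c).1 i, \sum_i (projT2 c).1 i = 1,
    (fg n).1 = (\sum_j (projT2 c).1 j * yhat ((projT2 c).2 j)) /
      (\sum_j (projT2 c).1 j * That ((projT2 c).2 j)) &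
    forall l, (fg n).2 ord0 l = (\sum_j (projT2 c).1 j * zhat ((projT2 c).2 j) ord0 l) /
      (\sum_j (projT2 c).1 j * That ((projT2 c).2 j))].
have h n : exists c, good n c.
  have [y [z [T [[m [p [a [p0 p1 [-> -> ->]]]]] fE]]]] := fgP n.
  exists (existT _ m (p, a)); split => //= [|l]; rewrite fE//=.
  rewrite mxE mulrC summxE; congr (_ / _); apply: eq_bigr => j _.
  by rewrite mxE.
pose c n := projT1 (cid (h n)); have hc n : good n (c n) by exact: projT2 (cid (h n)).
have p0 n (j : 'I_(projT1 (c n))) : 0 <= (projT2 (c n)).1 j by have [] := hc n.
have p1 n : \sum_j (projT2 (c n)).1 j = 1 by have [] := hc n.
pose pi := stationary_policy ext (fun n => (projT2 (c n)).2) p0 p1.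
have feas : feasible pi.
  move=> l; apply: le_trans (stationary_constraint ext (fun n => (projT2 (c n)).2) p0 p1 h_z h_B1 h_B l) _.
  rewrite lee_fin; apply: le_trans (fgl l); apply: ler_sum => n _.
  by have [_ _ _ ->] := hc n.
apply: (@le_trans _ _ (objective pi)).
  by apply: ereal_inf_lbound; exists pi.
apply: le_trans (stationary_objective ext (fun n => (projT2 (c n)).2) p0 p1 h_y h_B1 h_B) _.
rewrite lee_fin; apply: ler_sum => n _.
by have [_ _ -> _] := hc n.
Qed.

Theorem lemma2p3p2 (R : realType) (N L : nat)
    (sys : 'I_N -> renewal_system R L) (ext : probability (L.-tuple R) R)
    (ymax zmax dmax B : R)
    (h_feasible : exists pi : decision_sequence sys ext, feasible pi)
    (h_y : forall n (x : sample (sys n)) (i : nat),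
       (i < frame_length x)%N -> `|frame_penalty x i| <= ymax)
    (h_z : forall n (x : sample (sys n)) (i : nat) (l : 'I_L),
       (i < frame_length x)%N -> `|tnth (frame_perf x i) l| <= zmax)
    (h_d : forall l : 'I_L, {ae ext, forall v, `|tnth v l| <= dmax})
    (h_B1 : 1 <= B)
    (h_B : forall n, residual_bound (sys n) B)
    (h_compact : forall n, compact (ratio_set (sys n))) :
  (exists fg : 'I_N -> R * 'rV[R]_L,
     [/\ forall n, performance_region (sys n) (fg n),
         (\sum_(n < N) (fg n).1)%:E = f_star sys ext &
         forall l : 'I_L, \sum_(n < N) (fg n).2 ord0 l <= ext_mean ext l])
  /\
  (forall fg : 'I_N -> R * 'rV[R]_L,
     (forall n, performance_region (sys n) (fg n)) ->
     (forall l : 'I_L, \sum_(n < N) (fg n).2 ord0 l <= ext_mean ext l) ->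
     (f_star sys ext <= (\sum_(n < N) (fg n).1)%:E)%E).
Proof.
have part2 fg := @f_star_le _ _ _ sys ext _ _ _ h_y h_z h_B1 h_B fg.
split; last exact: part2.
have [pi0 feas0] := h_feasible.
have [fg [fgh fgl fgmin]] := exists_minimizer h_y h_z h_B1 h_B h_compact feas0.
have fgP n : performance_region (sys n) (fg n).
  exact: (hull_sub_performance_region (h_B n)).
(* The second half is applied to the minimizer itself and gives [f_star] at most its value; the
   reverse holds because its value is below every feasible objective. *)
exists fg; split => //; apply/eqP; rewrite eq_le part2// andbT.
by apply: le_ereal_inf_tmp => _ [pi [feas ->]]; exact: fgmin.
Qed.
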